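(* Fix $T>0$ and a measurable function $\gamma:\mathbb{T}\to[0,1]$. The function $I_T(\cdot|\gamma):D([0,T],\mathcal{M}_+)\to[0,\infty]$ is lower semicontinuous and has compact level sets (that is, for every $q\ge0$ the set $\{\pi\in D([0,T],\mathcal{M}_+): I_T(\pi|\gamma)\le q\}$ is compact).
   Context: Fix $M\ge1$ and a strictly positive cylinder function $c(\eta)=c(\eta(-M),\dots,\eta(M))$ on $\{0,1\}$-valued configurations. With $\nu_\rho$ the Bernoulli product measure of density $\rho\in[0,1]$, define $B,D:[0,1]\to\mathbb{R}$ by $B(\rho)=\int[1-\eta(0)]c(\eta)\,d\nu_\rho$, $D(\rho)=\int\eta(0)c(\eta)\,d\nu_\rho$. Let $\chi(r)=r(1-r)$. Let $\mathbb{T}=\mathbb{R}/\mathbb{Z}$ and let $\mathcal{M}_+$ be the space of nonnegative measures on $\mathbb{T}$ with total mass at most $1$, with the weak topology. Let $\mathcal{M}_{+,1}\subset\mathcal{M}_+$ be the closed subset of absolutely continuous measures $\pi(du)=\rho(u)du$ with $0\le\rho\le1$ a.e. $D([0,T],\mathcal{M}_+)$ is the space of right-continuous trajectories with left limits, with the Skorokhod topology. $\langle\pi,G\rangle$ denotes $\int_{\mathbb{T}} G\,d\pi$ for measures, and $\langle f,g\rangle=\int_{\mathbb{T}}fg\,du$ for functions. $C^{m,n}([0,T]\times\mathbb{T})$ is the set of real functions $m$ times differentiable in time and $n$ times in space with continuous derivatives; $\nabla,\Delta$ are first and second spatial derivatives. Energy: for $\pi(t,du)=\rho(t,u)du$ in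 $D([0,T],\mathcal{M}_{+,1})$, $$\mathcal{Q}(\pi)=\sup_{G\in C^{0,1}([0,T]\times\mathbb{T})}\Big\{2\int_0^T\langle\rho_t,\nabla G_t\rangle dt-\int_0^T\int_{\mathbb{T}}G^2(t,u)\,du\,dt\Big\}\in[0,\infty].$$ For $G\in C^{1,2}([0,T]\times\mathbb{T})$ and $\pi\in D([0,T],\mathcal{M}_{+,1})$ set $$J_G(\pi)=\langle\pi_T,G_T\rangle-\langle\gamma,G_0\rangle-\int_0^T\langle\pi_t,\partial_tG_t+\tfrac12\Delta G_t\rangle dt-\frac12\int_0^T\langle\chi(\rho_t),(\nabla G_t)^2\rangle dt-\int_0^T\{\langle B(\rho_t),e^{G_t}-1\rangle+\langle D(\rho_t),e^{-G_t}-1\rangle\}dt,$$ and $J_G(\pi)=\infty$ if $\pi\in D([0,T],\mathcal{M}_+)\setminus D([0,T],\mathcal{M}_{+,1})$. Then $I_T(\pi|\gamma)=\sup_{G\in C^{1,2}([0,T]\times\mathbb{T})}J_G(\pi)$ if $\pi\in D([0,T],\mathcal{M}_{+,1})$ and $\mathcal{Q}(\pi)<\infty$, and $I_T(\pi|\gamma)=\infty$ otherwise. *)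

(* Defs.v *)
From HB Require Import structures.
From mathcomp Require Import all_boot all_order all_algebra.
From mathcomp Require Import all_classical all_reals all_analysis.
Import Order.TTheory GRing.Theory Num.Theory.
Import numFieldNormedType.Exports.

Set Implicit Arguments.
Unset Strict Implicit.
Unset Printing Implicit Defensive.

Local Open Scope classical_set_scope.
Local Open Scope ring_scope.

(** Conventions for the torus R/Z: a function on it is a 1-periodic function
    on R, and a Borel measure on it is a Borel measure on R concentrated on the
    fundamental domain [0, 1[. *)

Section Torus.
Context {R : realType}.

Definition periodic1 (f : R -> R) := forall u, f (u + 1) = f u.

Definition torus_dom : set R := `[0, 1[.

Record torus_measure := TorusMeasure {
  torus_meas :> subprobability (measurableTypeR R) R ;
  torus_measP : torus_meas (~` torus_dom) = 0%E
}.

HB.instance Definition _ := gen_eqMixin torus_measure.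
HB.instance Definition _ := gen_choiceMixin torus_measure.

Record torus_test := TorusTest {
  torus_fun :> R -> R ;
  torus_fun_continuous : continuous torus_fun ;
  torus_fun_periodic : periodic1 torus_fun
}.

Definition mpair (m : torus_measure) (g : R -> R) : R :=
  \int[m]_(u in torus_dom) g u.

Definition fpair (f g : R -> R) : R :=
  \int[lebesgue_measure]_(u in torus_dom) (f u * g u).

Definition torus_eval (m : torus_measure) : {ptws torus_test -> R} :=
  fun g => mpair m g.

Definition Mplus : Type := initial_topology torus_eval.
HB.instance Definition _ := Uniform.on Mplus.

Definition is_density (m : Mplus) (rho : R -> R) : Prop :=
  [/\ measurable_fun torus_dom rho,
      {ae lebesgue_measure, forall u, torus_dom u -> 0 <= rho u <= 1} &
      forall A : set R, measurable A ->
        (m : torus_measure) A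
        = (\int[lebesgue_measure]_(u in A `&` torus_dom) (rho u)%:E)%E].

Definition Mplus1 : set Mplus := [set m | exists rho, is_density m rho].

(** Some version of the density; meaningful only for [m] in [Mplus1]. *)
Definition density (m : Mplus) : R -> R := get (is_density m).

End Torus.

Arguments Mplus R : clear implicits.

Section Skorokhod.
Context {R : realType} {E : uniformType}.

(** A trajectory on [0, T] is encoded as the function on R that extends it by
    constants on both sides, so that the encoding is unique. *)
Record cadlag (T : R) := Cadlag {
  traj :> R -> E ;
  traj_right_continuous :
    forall t, 0 <= t < T -> traj s @[s --> t^'+] --> traj t ;
  traj_left_limits :
    forall t, 0 < t <= T -> exists l : E, traj s @[s --> t^'-] --> l ;
  traj_before : forall t, t < 0 -> traj t = traj 0 ;
  traj_after : forall t, T < t -> traj t = traj T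
}.

Context {T : R}.

HB.instance Definition _ := gen_eqMixin (cadlag T).
HB.instance Definition _ := gen_choiceMixin (cadlag T).

(** Increasing bijections of [0, T]; continuity is automatic. *)
Definition time_change (l : R -> R) : Prop :=
  {in `[0, T] &, {homo l : s t / s < t}} /\ l @` `[0, T] = `[0, T]%classic.

Definition skorokhod_close (d : R) (U : set (E * E)) :
    set (cadlag T * cadlag T) :=
  [set xy : cadlag T * cadlag T | exists2 l, time_change l &
     forall t, t \in `[0, T] -> `|l t - t| < d /\ U (xy.1 t, xy.2 (l t))].

(** The uniformity of the usual Skorokhod metric
    inf_l max (sup_t |l t - t|, sup_t dist (x t, y (l t))),
    written in terms of the uniformity of E. *)
Definition skorokhod_entourage : set_system (cadlag T * cadlag T) :=
  filter_from [set dU : R * set (E * E) | 0 < dU.1 /\ entourage dU.2]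
              (fun dU => skorokhod_close dU.1 dU.2).

Lemma time_change_id : time_change id.
Proof. by split => //; rewrite image_id. Qed.

Lemma time_change_in l t : time_change l -> t \in `[0, T] -> l t \in `[0, T].
Proof.
move=> [_ im] tT; have : (l @` `[0, T]) (l t) by exists t.
by rewrite im.
Qed.

Lemma time_change_comp l k :
  time_change l -> time_change k -> time_change (k \o l).
Proof.
move=> hl hk; split => [s t sT tT st|].
  by apply: hk.1; [exact: time_change_in|exact: time_change_in|exact: hl.1].
by rewrite -image_comp hl.2 hk.2.
Qed.

Lemma time_change_inv l : time_change l ->
  exists2 k, time_change k & forall t, t \in `[0, T] -> l (k t) = t.
Proof.
move=> hl; pose k t := get [set s | s \in `[0, T] /\ l s = t].
have kP t : t \in `[0, T] -> k t \in `[0, T] /\ l (k t) = t.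
  move=> tT; have : [set` `[0, T]] t by [].
  rewrite -{1}hl.2 => -[s sT lst].
  by apply: (@getPex _ [set s | s \in `[0, T] /\ l s = t]); exists s.
exists k => [|t /kP[]//]; split => [s t sT tT st|].
  have [ks ls] := kP _ sT; have [kt lt] := kP _ tT.
  rewrite ltNge le_eqVlt; apply/negP => /orP[/eqP e|/hl.1 h].
    by move: st; rewrite -ls -lt e ltxx.
  by move: (h kt ks); rewrite ls lt => /(lt_trans st); rewrite ltxx.
apply/seteqP; split => [_ [t tT <-]|s sT]; first exact: (kP _ tT).1.
have lsT := time_change_in hl sT; exists (l s) => //.
have [kT lk] := kP _ lsT.
case: (ltgtP (k (l s)) s) => // /hl.1 h.
  by move: (h kT sT); rewrite lk ltxx.
by move: (h sT kT); rewrite lk ltxx.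
Qed.

Local Open Scope relation_scope.

Lemma skorokhod_filter : Filter skorokhod_entourage.
Proof.
apply: filter_from_filter.
  by exists (1, setT); split => //=; exact: entourageT.
move=> [d U] [d' U'] [/= d0 eU] [/= d'0 eU'].
exists (Num.min d d', U `&` U').
  by split => /=; [rewrite lt_min d0|exact: filterI].
move=> [x y] [l hl /= h]; split; exists l => //= t /h;
  by rewrite lt_min => -[/andP[? ?] [? ?]].
Qed.

Lemma skorokhod_diagonal A : skorokhod_entourage A -> diagonal `<=` A.
Proof.
move=> [[d U] [/= d0 eU] sA] [x y] /= /diagonalP <-.
apply: sA; exists id; first exact: time_change_id.
by move=> t _; rewrite subrr normr0; split => //; exact: entourage_refl.
Qed.

Lemma skorokhod_inv A : skorokhod_entourage A -> skorokhod_entourage A^-1.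
Proof.
move=> [[d U] [/= d0 eU] sA]; exists (d, U^-1).
  by split => //=; exact: entourage_inv.
move=> [x y] [l hl /= h]; apply: sA; have [k hk lk] := time_change_inv hl.
exists k => // t tT; have /h := time_change_in hk tT.
by rewrite lk //= distrC.
Qed.

Lemma skorokhod_split A : skorokhod_entourage A ->
  exists2 B, skorokhod_entourage B & B \; B `<=` A.
Proof.
move=> [[d U] [/= d0 eU] sA].
exists (skorokhod_close (d / 2) (split_ent U)).
  by exists (d / 2, split_ent U) => //; split => //=; exact: divr_gt0.
move=> [x z] [y /= [l hl hxy] [k hk hyz]]; apply: sA => /=.
exists (k \o l); first exact: time_change_comp.
move=> t tT /=; have [h1 U1] := hxy _ tT.
have [h2 U2] := hyz _ (time_change_in hl tT).
split; last exact: entourage_split U1 U2.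
rewrite -(subrKA (l t)) (le_lt_trans (ler_normD _ _))//.
by rewrite [d]splitr ltrD.
Qed.

HB.instance Definition _ := isUniform.Build (cadlag T)
  skorokhod_filter skorokhod_diagonal skorokhod_inv skorokhod_split.

End Skorokhod.

Arguments cadlag {R} E T.

Section Rate_functional.
Context {R : realType}.

Section Reaction_rates.
Context (M : nat) (c : {ffun 'I_(M.*2.+1) -> bool} -> R).

(** A configuration on the window {-M, ..., M} is indexed by 'I_(2M+1), site x
    being index x + M. Cylinder functions on the window are integrated against
    the marginal of the Bernoulli product measure. *)
Definition origin : 'I_(M.*2.+1) := inord M.

Definition bernoulli_mass (r : R) (eta : {ffun 'I_(M.*2.+1) -> bool}) : R :=
  \prod_i (if eta i then r else 1 - r).

Definition bernoulli_mean (r : R) (f : {ffun 'I_(M.*2.+1) -> bool} -> R) : R :=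
  \sum_eta bernoulli_mass r eta * f eta.

Definition birth_rate (r : R) : R :=
  bernoulli_mean r (fun eta => (1 - (eta origin)%:R) * c eta).

Definition death_rate (r : R) : R :=
  bernoulli_mean r (fun eta => (eta origin)%:R * c eta).

End Reaction_rates.

Definition chi (r : R) : R := r * (1 - r).

Section Test_functions.
Context (T : R) (G : R -> R -> R).

(** Derivative relative to [0, T], hence one-sided at the endpoints. *)
Definition dt_quotient (t u s : R) : R := (G s u - G t u) / (s - t).

Definition dt (t u : R) : R :=
  lim (dt_quotient t u s @[s --> within `[0, T] t^']).

Definition dx (t : R) : R -> R := derive1 (G t).

Definition dxx (t : R) : R -> R := derive1 (derive1 (G t)).

End Test_functions.

Definition continuous_on_cylinder (T : R) (G : R -> R -> R) : Prop :=
  {within `[0, T] `*` [set: R], continuous (fun tu : R * R => G tu.1 tu.2)}.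

Definition C01 (T : R) : set (R -> R -> R) := [set G |
  [/\ forall t, t \in `[0, T] -> periodic1 (G t),
      forall t u, t \in `[0, T] -> derivable (G t) u 1,
      continuous_on_cylinder T G &
      continuous_on_cylinder T (dx G)]].

Definition C12 (T : R) : set (R -> R -> R) := [set G |
  [/\ C01 T G,
      forall t u, t \in `[0, T] -> derivable (dx G t) u 1,
      forall t u, t \in `[0, T] ->
        cvg (dt_quotient G t u s @[s --> within `[0, T] t^']),
      continuous_on_cylinder T (dxx G) &
      continuous_on_cylinder T (dt T G)]].

Definition time_int (T : R) (f : R -> R) : R :=
  \int[lebesgue_measure]_(t in `[0, T]) f t.

Definition D1 (T : R) : set (cadlag (Mplus R) T) :=
  [set pi | forall t, t \in `[0, T] -> Mplus1 (pi t)].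

Definition energy (T : R) (pi : cadlag (Mplus R) T) : \bar R :=
  ereal_sup [set (2 * time_int T (fun t => fpair (density (pi t)) (dx G t))
                  - time_int T (fun t => fpair (G t) (G t)))%:E
            | G in C01 T].

Section Rate.
Context (M : nat) (c : {ffun 'I_(M.*2.+1) -> bool} -> R).
Context (T : R) (gamma : R -> R).

Definition J_D1 (G : R -> R -> R) (pi : cadlag (Mplus R) T) : R :=
  mpair (pi T) (G T) - fpair gamma (G 0)
  - time_int T (fun t => mpair (pi t) (fun u => dt T G t u + 2^-1 * dxx G t u))
  - 2^-1 * time_int T (fun t =>
      fpair (fun u => chi (density (pi t) u)) (fun u => dx G t u ^+ 2))
  - time_int T (fun t =>
      fpair (fun u => birth_rate c (density (pi t) u))
            (fun u => expR (G t u) - 1)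
      + fpair (fun u => death_rate c (density (pi t) u))
              (fun u => expR (- G t u) - 1)).

Definition J (G : R -> R -> R) (pi : cadlag (Mplus R) T) : \bar R :=
  if `[< D1 pi >] then (J_D1 G pi)%:E else +oo%E.

Definition rate_function (pi : cadlag (Mplus R) T) : \bar R :=
  if `[< D1 pi /\ (energy pi < +oo)%E >]
  then ereal_sup [set J G pi | G in C12 T] else +oo%E.

End Rate.

End Rate_functional.

(* Main.v *)
Require Import Defs.
From HB Require Import structures.
From mathcomp Require Import all_boot all_order all_algebra.
From mathcomp Require Import all_classical all_reals all_analysis.
From mathcomp Require Import measurable_realfun.
From mathcomp Require Import ring lra.
Import Order.TTheory GRing.Theory Num.Theory.
Import numFieldNormedType.Exports.
Set Implicit Arguments.
Unset Strict Implicit.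
Unset Printing Implicit Defensive.
Local Open Scope classical_set_scope.
Local Open Scope ring_scope.

(** Write [below q] for the set of trajectories with densities in [0, 1] at all
    times and J_G <= q for every test function G. On this set the energy is
    automatically finite, so it is the level set of height q
    ([rate_le_below]). Both assertions follow from its compactness
    ([rate_compact]), and the proof works throughout with the Fourier
    coefficients x_p(t) = <pi_t, e_p>, where (e_p) is the real trigonometric
    orthonormal system and f_p is the frequency of e_p.

    A priori bounds. Two explicit families of test functions, finite
    trigonometric sums in space with smooth coefficients in time, are inserted
    into J_G <= q ([J_tsep_le]).
    - For b times a difference of two steep ramps in time times e_p, the
      final-time and time-derivative terms give b (x_p(t) - x_p(s)) in the
      limit of infinite steepness, and the others are at most K(b) (t - s). Hence b (x_p(t) - x_p(s)) <= q + K(b) (t - s) for every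
      real b ([modulus_le]); taking |b| large makes the coefficients
      equicontinuous in time, uniformly on the level set
      ([equicontinuous_xc]).
    - For the trajectory itself, smoothed by a Fejer mean in space and by a
      running average over [t, t + a] in time, the test function has values in
      [0, 1], so the reaction terms are bounded; the time derivative
      telescopes; what is left as a -> 0 bounds the weighted sum of
      f_p^2 x_p^2, integrated in time, by the same constant on the whole level
      set ([fenergy_bound]). By Bessel's inequality this bounds the energy
      ([energy_le]).

    Strong compactness. By Parseval's identity, which is proved here through
    Fejer means, the L2 distance between two trajectories of the level set is
    controlled by finitely many coefficients, since the energy makes the high
    frequencies uniformly small ([L2dist_le]). The functions B, D and chi are
    Lipschitz on [0, 1], so J_G is continuous for this distance and the
    convergence of pi_T ([J_D1_cont]).

    Existence of limits. Compactness is tested on ultrafilters. Along an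
    ultrafilter on the level set, every mass pi_t(A) converges; the limits are
    dominated by the Lebesgue measure, so they are countably additive in A and
    have a density in [0, 1] ([ultra_density]). Equicontinuity makes the limit
    continuous in t and the convergence of every pairing uniform in t
    ([ultra_path], [ultra_uniform]), which is Skorokhod convergence with the
    identity as time change ([ultra_skorokhod]). By the strong compactness
    above, J_G passes to the limit, which therefore belongs to the level set
    ([ultra_limit]).

    Lower semicontinuity. If a < I(pi) while every neighbourhood of pi meets
    the compact level set of height a, some trajectory of that level set is not
    separated from pi. Being continuous in time, it has the same pairings as
    pi at all times ([indistinguishable_pairings]), hence the same measures
    ([pairing_inj]) and the same value of every J_G, so I(pi) <= a after all
    ([rate_lsc]). *)

(** * Integrals of bounded measurable functions *)

Section Bounded_measurable.
Context {d : measure_display} {T : measurableType d} {R : realType}.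
Implicit Types (D : set T) (f g : T -> R).

(** On a set of finite measure such functions form an algebra of integrable
    functions: closure properties of this predicate replace all integrability
    side conditions below. *)
Definition bdm D f :=
  measurable_fun D f /\ exists C, forall x, D x -> `|f x| <= C.

Lemma bdm_cst D (c : R) : bdm D (cst c).
Proof. by split; [exact: measurable_cst|exists `|c|]. Qed.

Lemma bdmD D f g : bdm D f -> bdm D g -> bdm D (fun x => f x + g x).
Proof.
move=> [mf [C Cf]] [mg [C' Cg]]; split; first exact: measurable_funD.
exists (C + C') => x Dx; rewrite (le_trans (ler_normD _ _))// lerD//.
  exact: Cf.
exact: Cg.
Qed.

Lemma bdmM D f g : bdm D f -> bdm D g -> bdm D (fun x => f x * g x).
Proof.
move=> [mf [C Cf]] [mg [C' Cg]]; split; first exact: measurable_funM.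
by exists (C * C') => x Dx; rewrite normrM ler_pM// ?Cf ?Cg.
Qed.

Lemma bdmN D f : bdm D f -> bdm D (fun x => - f x).
Proof.
move=> [mf [C Cf]]; split; first exact: measurable_funN.
by exists C => x Dx; rewrite normrN Cf.
Qed.

Lemma bdmB D f g : bdm D f -> bdm D g -> bdm D (fun x => f x - g x).
Proof. by move=> bf /bdmN; exact: bdmD. Qed.

Lemma bdmZ D (r : R) f : bdm D f -> bdm D (fun x => r * f x).
Proof. exact: bdmM (bdm_cst _ _). Qed.

Lemma bdmX D n f : bdm D f -> bdm D (fun x => f x ^+ n).
Proof.
move=> bf; elim: n => [|n IH].
  by under eq_fun do rewrite expr0; exact: bdm_cst.
by under eq_fun do rewrite exprS; exact: bdmM.
Qed.

Lemma bdm_norm D f : bdm D f -> bdm D (fun x => `|f x|).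
Proof.
move=> [mf [C Cf]]; split; first exact: measurableT_comp.
by exists C => x Dx; rewrite normr_id Cf.
Qed.

Lemma bdm_sum D (I : Type) (r : seq I) (P : pred I) (F : I -> T -> R) :
  (forall i, P i -> bdm D (F i)) -> bdm D (fun x => \sum_(i <- r | P i) F i x).
Proof.
move=> bF; elim: r => [|i r IH].
  by under eq_fun do rewrite big_nil; exact: bdm_cst.
under eq_fun do rewrite big_cons.
by case: (boolP (P i)) => Pi //; apply: bdmD => //; exact: bF.
Qed.

Lemma eq_bdm D f g : {in D, f =1 g} -> bdm D f -> bdm D g.
Proof.
move=> fg [mf [C Cf]]; split; first exact: eq_measurable_fun mf.
by exists C => x Dx; rewrite -fg ?inE// Cf.
Qed.

Section Integral.
Context (mu : {measure set T -> \bar R}) (D : set T).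
Hypotheses (mD : measurable D) (muD : (mu D < +oo)%E).

Lemma bdm_integrable f : bdm D f -> mu.-integrable D (EFin \o f).
Proof.
move=> [mf [C Cf]]; apply: measurable_bounded_integrable => //.
exists C; split; first exact: num_real.
by move=> M CM x Dx; apply: le_trans (Cf _ Dx) (ltW CM).
Qed.

Local Notation I f := (\int[mu]_(x in D) f x).

Lemma bintD f g : bdm D f -> bdm D g ->
  \int[mu]_(x in D) (f x + g x) = I f + I g.
Proof. by move=> bf bg; apply: RintegralD => //; exact: bdm_integrable. Qed.

Lemma bintB f g : bdm D f -> bdm D g ->
  \int[mu]_(x in D) (f x - g x) = I f - I g.
Proof. by move=> bf bg; apply: RintegralB => //; exact: bdm_integrable. Qed.

Lemma bintZ r f : bdm D f -> \int[mu]_(x in D) (r * f x) = r * I f.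
Proof. by move=> bf; apply: RintegralZl => //; exact: bdm_integrable. Qed.

Lemma bintN f : bdm D f -> \int[mu]_(x in D) (- f x) = - I f.
Proof.
move=> bf; rewrite -mulN1r -bintZ//.
by apply: eq_Rintegral => x _; rewrite mulN1r.
Qed.

Lemma bint_sum (J : Type) (r : seq J) (P : pred J) (F : J -> T -> R) :
  (forall i, P i -> bdm D (F i)) ->
  \int[mu]_(x in D) (\sum_(i <- r | P i) F i x) = \sum_(i <- r | P i) I (F i).
Proof.
move=> bF; elim: r => [|i r IH].
  rewrite big_nil; under eq_Rintegral do rewrite big_nil.
  by rewrite Rintegral_cst// mul0r.
rewrite big_cons; under eq_Rintegral do rewrite big_cons.
case: (boolP (P i)) => Pi //; rewrite bintD ?IH//; first exact: bF.
by apply: bdm_sum.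
Qed.

Lemma le_bint f g : bdm D f -> bdm D g ->
  (forall x, D x -> f x <= g x) -> I f <= I g.
Proof.
by move=> bf bg fg; apply: le_Rintegral => //; exact: bdm_integrable.
Qed.

Lemma bint_cst r : \int[mu]_(x in D) r = r * fine (mu D).
Proof. exact: Rintegral_cst. Qed.

Lemma bint_le_cst f C : bdm D f -> (forall x, D x -> f x <= C) ->
  I f <= C * fine (mu D).
Proof. by move=> bf fC; rewrite -bint_cst; apply: le_bint => //; exact: bdm_cst. Qed.

Lemma abs_bint f : bdm D f -> `|I f| <= \int[mu]_(x in D) `|f x|.
Proof. by move=> bf; apply: le_normr_Rintegral => //; exact: bdm_integrable. Qed.

Lemma abs_bint_le_cst f C : bdm D f -> (forall x, D x -> `|f x| <= C) ->
  `|I f| <= C * fine (mu D).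
Proof.
move=> bf fC; rewrite (le_trans (abs_bint bf))// bint_le_cst//.
exact: bdm_norm.
Qed.

Lemma abs_bint_le f g : bdm D f -> bdm D g ->
  (forall x, D x -> `|f x| <= g x) -> `|I f| <= I g.
Proof.
move=> bf bg fC; rewrite (le_trans (abs_bint bf))// le_bint//.
exact: bdm_norm.
Qed.

Lemma ae_eq_bint f g : measurable_fun D f -> measurable_fun D g ->
  {ae mu, forall x, D x -> f x = g x} -> I f = I g.
Proof.
move=> mf mg fg; congr fine; apply: ae_eq_integral => //.
- exact/measurable_EFinP.
- exact/measurable_EFinP.
- by apply: filterS fg => x fg Dx /=; rewrite fg.
Qed.

Lemma cvg_bint (f_ : nat -> T -> R) f C :
  (forall n, measurable_fun D (f_ n)) ->
  (forall n x, D x -> `|f_ n x| <= C) ->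
  (forall x, D x -> f_ n x @[n --> \oo] --> f x) ->
  I (f_ n) @[n --> \oo] --> I f.
Proof.
move=> mf fC ff.
have mff : measurable_fun D f by exact: measurable_fun_cvg mf ff.
have [] := @dominated_convergence _ _ _ mu D mD
  (fun n x => (f_ n x)%:E) (EFin \o f) (cst C%:E).
- by move=> n; apply/measurable_EFinP.
- exact/measurable_EFinP.
- by apply: aeW => x Dx; apply: cvg_EFin; [exact: nearW|exact: ff].
- exact: (bdm_integrable (bdm_cst _ _)).
- by apply: aeW => x n Dx; rewrite lee_fin; exact: fC.
move=> iff _.
have -> : (\int[mu]_(x in D) (EFin \o f) x)%E = (I f)%:E.
  by rewrite /Rintegral fineK//; exact: integrable_fin_num.
by move=> /fine_cvgP[_].
Qed.

End Integral.
End Bounded_measurable.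

(** * Continuity on compact sets *)

(** Only one of the two points has to lie in [A]: in [cylinder_korovkin] the other
    one crosses the end of the period. *)
Lemma compact_unif_continuous {R : realType} {X : pseudoMetricType R}
    (A : set X) (f : X -> R) : compact A -> continuous f ->
  forall e, 0 < e -> exists2 d, 0 < d &
    forall x y, A x -> ball x d y -> `|f x - f y| < e.
Proof.
move=> /compact_near_coveringP cA cf e e0.
pose P (d : R) x := forall y, ball x d y -> `|f x - f y| < e.
have H : \forall d \near (0:R)^'+, A `<=` P d.
  apply: (cA R (0:R)^'+ P) => x Ax.
  have /cvgrPdist_lt/(_ (e/2)) : f @ x --> f x := cf x.
  rewrite divr_gt0// => /(_ isT) /nbhs_ballP [r /= r0 xr].
  exists (ball x (r/2), [set d | d < r/2]) => /=.
    split; first by apply: nbhsx_ballx; rewrite divr_gt0.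
    by apply: nbhs_right_lt; rewrite divr_gt0.
  move=> [x' d] [/= xx' dr] y xy.
  have h1 : `|f x - f x'| < e / 2.
    by apply: xr; apply: le_ball xx'; rewrite ler_pdivrMr// ler_peMr ?ler1n// ltW.
  have h2 : `|f x - f y| < e / 2.
    apply: xr; rewrite [r]splitr; apply: ball_triangle xx' _.
    by apply: le_ball xy; exact: ltW.
  rewrite (le_lt_trans (ler_distD (f x) _ _))// [e]splitr ltrD//.
  by rewrite distrC.
have [d [d0 dP]] : exists d : R, 0 < d /\ A `<=` P d.
  apply: (@filter_ex _ (0:R)^'+ _ (fun d => 0 < d /\ A `<=` P d)).
  by apply: filterI => //; exact: nbhs_right_gt.
by exists d => // x y Ax xy; exact: (dP x Ax).
Qed.

Lemma continuous_within_comp {X Y Z : topologicalType} (A : set Y)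
    (f : Y -> Z) (phi : X -> Y) :
  {within A, continuous f} -> continuous phi -> (forall x, A (phi x)) ->
  continuous (f \o phi).
Proof.
move=> cf cphi Aphi x V nV; have := cf (phi x) V nV.
rewrite /nbhs/= -nbhs_subspace_in//= => h0; have h := cphi x _ h0.
by apply: (@filterS _ (nbhs x) _ _ _ _ h) => y /= /(_ (Aphi y)).
Qed.

Section Clamp.
Context {R : realType}.

Definition clamp (a b x : R) := Num.max a (Num.min b x).

Lemma clamp_itv a b x : a <= b -> a <= clamp a b x <= b.
Proof. by move=> ab; rewrite /clamp le_max lexx/= ge_max ab ge_min lexx. Qed.

Lemma clamp_id a b x : a <= x <= b -> clamp a b x = x.
Proof. by move=> /andP[ax xb]; rewrite /clamp min_r// max_r. Qed.

Lemma continuous_clamp a b : continuous (clamp a b).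
Proof.
move=> x; apply: continuous_max; first exact: cvg_cst.
by apply: continuous_min; [exact: cvg_cst|exact: cvg_id].
Qed.

(** A function continuous relative to the cylinder extends continuously by
    freezing it outside the time interval; the facts below follow from this
    extension. *)
Lemma cylinder_clamp T (G : R -> R -> R) : 0 <= T ->
  continuous_on_cylinder T G ->
  continuous (fun tu : R * R => G (clamp 0 T tu.1) tu.2).
Proof.
move=> T0 cG.
pose phi (tu : R * R) := (clamp 0 T tu.1, tu.2).
apply: (@continuous_within_comp _ _ _ _ (fun tu : R * R => G tu.1 tu.2) phi cG).
- move=> tu; apply: (@cvg_pair _ _ _ _ (nbhs _)); last exact: cvg_snd.
  apply: (@continuous_comp _ _ _ fst (clamp 0 T)); first exact: cvg_fst.
  exact: continuous_clamp.
- by move=> [t u]; split => //=; rewrite in_itv/= clamp_itv.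
Qed.

Lemma cylinder_unif T (G : R -> R -> R) (a b : R) : 0 <= T ->
  continuous_on_cylinder T G -> forall e, 0 < e -> exists2 d, 0 < d &
  forall s t u v, 0 <= s <= T -> 0 <= t <= T -> a <= u <= b ->
   `|s - t| < d -> `|u - v| < d -> `|G s u - G t v| < e.
Proof.
move=> T0 cG e e0.
have cpt : compact (`[0, T]%classic `*` `[a, b]%classic : set (R * R)).
  by apply: compact_setX; exact: segment_compact.
have [d d0 H] := compact_unif_continuous cpt (cylinder_clamp T0 cG) e0.
exists d => // s t u v sT tT uab st uv.
have := H (s, u) (t, v); rewrite /= !clamp_id//; apply.
  by split => /=; rewrite in_itv.
by split.
Qed.

Lemma cylinder_bounded T (G : R -> R -> R) (a b : R) : 0 <= T ->
  continuous_on_cylinder T G -> exists2 C, 0 <= C &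
  forall t u, 0 <= t <= T -> a <= u <= b -> `|G t u| <= C.
Proof.
move=> T0 cG.
have cpt : compact (`[0, T]%classic `*` `[a, b]%classic : set (R * R)).
  by apply: compact_setX; exact: segment_compact.
have /compact_bounded [C [_ HC]] :=
  continuous_compact (continuous_subspaceT (cylinder_clamp T0 cG)) cpt.
exists (`|C| + 1); first by rewrite addr_ge0.
move=> t u tT uab; apply: (HC (`|C| + 1)).
  by rewrite (le_lt_trans (ler_norm _))// ltrDl.
exists (t, u); last by rewrite /= clamp_id.
by split => /=; rewrite in_itv.
Qed.

Lemma cylinder_cont_space T (G : R -> R -> R) t : 0 <= t <= T ->
  continuous_on_cylinder T G -> continuous (G t).
Proof.
move=> tT cG u.
have T0 : 0 <= T by case/andP: tT; exact: le_trans.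
have -> : G t = (fun tu : R * R => G (clamp 0 T tu.1) tu.2) \o (fun u => (t, u)).
  by apply/funext => v /=; rewrite clamp_id.
apply: continuous_comp; last exact: cylinder_clamp.
by apply: (@cvg_pair _ _ _ _ (nbhs _)); [exact: cvg_cst|exact: cvg_id].
Qed.

Lemma cylinder_cont_time T (G : R -> R -> R) u : 0 <= T ->
  continuous_on_cylinder T G -> continuous (fun t => G (clamp 0 T t) u).
Proof.
move=> T0 cG t.
have -> : (fun t => G (clamp 0 T t) u) =
  (fun tu : R * R => G (clamp 0 T tu.1) tu.2) \o (fun t => (t, u)) by [].
apply: continuous_comp; last exact: cylinder_clamp.
by apply: (@cvg_pair _ _ _ _ (nbhs _)); [exact: cvg_id|exact: cvg_cst].
Qed.

Lemma cylinder_meas_time T (G : R -> R -> R) u : 0 <= T ->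
  continuous_on_cylinder T G -> measurable_fun (`[0, T]%classic : set R) (G^~ u).
Proof.
move=> T0 cG.
apply: (@eq_measurable_fun _ _ _ _ _ (fun t => G (clamp 0 T t) u)).
  by move=> t; rewrite inE/= in_itv/= => tT; rewrite clamp_id.
apply: measurable_funTS; apply: continuous_measurable_fun.
exact: cylinder_cont_time.
Qed.

Lemma continuous_cylinder T (f : R -> R) : continuous f ->
  continuous_on_cylinder T (fun=> f).
Proof.
move=> cf; apply: continuous_subspaceT => tu.
by apply: continuous_comp; [exact: cvg_snd|exact: cf].
Qed.

End Clamp.

(** * The torus integral *)

Section Torus_integral.
Context {R : realType}.
Local Notation mu := (@lebesgue_measure R).
Local Notation dom := (@torus_dom R).
Local Notation bd := (@bdm _ (measurableTypeR R) R dom).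
Implicit Types f g : R -> R.

Definition tint f : R := \int[mu]_(u in dom) f u.

Lemma measurable_dom : measurable (dom : set (measurableTypeR R)).
Proof. exact: measurable_itv. Qed.

Lemma lebesgue_dom : mu dom = 1%E.
Proof. by rewrite /torus_dom lebesgue_measure_itv/= lte01 sube0. Qed.

Lemma lebesgue_dom_fin : (mu dom < +oo)%E.
Proof. by rewrite lebesgue_dom ltry. Qed.

Lemma fine_lebesgue_dom :
  fine ((mu : {measure set (measurableTypeR R) -> \bar R}) dom) = 1.
Proof. by rewrite [X in fine X]lebesgue_dom. Qed.

Lemma domP u : dom u <-> 0 <= u < 1.
Proof. by rewrite /torus_dom /= in_itv. Qed.

Lemma tintD f g : bd f -> bd g -> tint (fun u => f u + g u) = tint f + tint g.
Proof. by move=> bf bg; exact: (bintD measurable_dom lebesgue_dom_fin bf bg). Qed.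

Lemma tintB f g : bd f -> bd g -> tint (fun u => f u - g u) = tint f - tint g.
Proof. by move=> bf bg; exact: (bintB measurable_dom lebesgue_dom_fin bf bg). Qed.

Lemma tintZ r f : bd f -> tint (fun u => r * f u) = r * tint f.
Proof. by move=> bf; exact: (bintZ measurable_dom lebesgue_dom_fin _ bf). Qed.

Lemma tint_sum (I : Type) (r : seq I) (P : pred I) (F : I -> R -> R) :
  (forall i, P i -> bd (F i)) ->
  tint (fun u => \sum_(i <- r | P i) F i u) = \sum_(i <- r | P i) tint (F i).
Proof.
by move=> bf; exact: (bint_sum (mu := mu) measurable_dom lebesgue_dom_fin r bf).
Qed.

Lemma le_tint f g : bd f -> bd g -> (forall u, dom u -> f u <= g u) ->
  tint f <= tint g.
Proof. by move=> bf bg fg; exact: (le_bint measurable_dom lebesgue_dom_fin bf bg fg). Qed.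

Lemma tint_cst r : tint (fun=> r) = r.
Proof. by rewrite /tint (bint_cst _ measurable_dom) fine_lebesgue_dom mulr1. Qed.

Lemma eq_tint f g : (forall u, dom u -> f u = g u) -> tint f = tint g.
Proof. by move=> fg; apply: eq_Rintegral => u /[!inE]; exact: fg. Qed.

Lemma tint_ge0 f : (forall u, dom u -> 0 <= f u) -> 0 <= tint f.
Proof. by move=> f0; exact: Rintegral_ge0. Qed.

Lemma tint_le_cst f (C : R) : bd f -> (forall u, dom u -> f u <= C) -> tint f <= C.
Proof.
move=> bf fC.
have := bint_le_cst measurable_dom lebesgue_dom_fin bf fC.
by rewrite fine_lebesgue_dom mulr1.
Qed.

Lemma abs_tint_le_cst f (C : R) : bd f -> (forall u, dom u -> `|f u| <= C) ->
  `|tint f| <= C.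
Proof.
move=> bf fC.
have := abs_bint_le_cst measurable_dom lebesgue_dom_fin bf fC.
by rewrite fine_lebesgue_dom mulr1.
Qed.

Lemma abs_tint_le f g : bd f -> bd g -> (forall u, dom u -> `|f u| <= g u) ->
  `|tint f| <= tint g.
Proof. by move=> bf bg fg; exact: (abs_bint_le measurable_dom lebesgue_dom_fin bf bg fg). Qed.

Lemma continuous_bd f : continuous f -> bd f.
Proof.
move=> cf; split; first by apply: measurable_funTS; exact: continuous_measurable_fun.
have [C _ HC] := cylinder_bounded 0 1 (lexx 0) (@continuous_cylinder _ 0 _ cf).
exists C => u /domP/andP[u0 u1]; apply: (HC 0); first by rewrite lexx.
by rewrite u0 ltW.
Qed.

Definition cell (n j : nat) : set R := `[j%:R / n%:R, j.+1%:R / n%:R[%classic.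

Lemma measurable_cell n j : measurable (cell n j).
Proof. exact: measurable_itv. Qed.

(** Integrating a step function against a measure gives a finite combination of
    masses of cells. This reduces pairings to masses, both to express them by
    densities and to pass to the limit in them. *)
Definition stepf n g u := \sum_(j < n) g (j%:R / n%:R) * \1_(cell n j) u.

Lemma bdm_indic (A D : set R) : measurable A -> bdm D (\1_A : R -> R).
Proof.
move=> mA; split; first exact: measurable_indic.
by exists 1 => x _; rewrite indicE ger0_norm// lern1; case: (_ \in _).
Qed.

Lemma bdm_stepf n g D : bdm D (stepf n g).
Proof.
apply: bdm_sum => j _; apply: bdmZ; apply: bdm_indic; exact: measurable_cell.
Qed.

Lemma cell_sum n K (c : nat -> R) u : (0 < n)%N -> 0 <= u -> u * n%:R < K%:R ->
  exists k, [/\ cell n k u, (k < K)%N &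
    \sum_(j < K) c j * \1_(cell n j) u = c k].
Proof.
move=> n0 u0 uK.
have nu0 : 0 <= u * n%:R by rewrite mulr_ge0.
have /andP[tl tu] := truncn_itv nu0; set k := Num.truncn (u * n%:R) in tl tu.
have nR0 : 0 < n%:R :> R by rewrite ltr0n.
have kK : (k < K)%N by rewrite -(ltr_nat R) (le_lt_trans tl).
have cellP j : cell n j u -> j = k :> nat.
  rewrite /cell/= in_itv/= ler_pdivrMr// ltr_pdivlMr// => /andP[h1 h2].
  have jk : (j < k.+1)%N by rewrite -(ltr_nat R) (le_lt_trans _ tu).
  have kj : (k < j.+1)%N by rewrite -(ltr_nat R) (le_lt_trans tl).
  by apply/eqP; rewrite eqn_leq -ltnS jk -ltnS kj.
have kP : cell n k u.
  by rewrite /cell/= in_itv/= ler_pdivrMr// ltr_pdivlMr// tl.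
exists k; split => //.
rewrite (bigD1 (Ordinal kK))//= indicE mem_set// mulr1 big1 ?addr0// => j jk.
rewrite indicE memNset ?mulr0// => /cellP jE.
by move: jk; rewrite -val_eqE/= jE eqxx.
Qed.

Lemma stepfE n g u : (0 < n)%N -> dom u -> exists j,
  cell n j u /\ stepf n g u = g (j%:R / n%:R).
Proof.
move=> n0 /domP/andP[u0 u1].
have [|k [ck _ E]] := @cell_sum n n (fun j => g (j%:R / n%:R)) u n0 u0.
  by rewrite -[ltRHS]mul1r ltr_pM2r// ltr0n.
by exists k.
Qed.

Lemma stepf_approx (T : R) (G : R -> R -> R) : 0 <= T -> continuous_on_cylinder T G ->
  forall e : R, 0 < e -> \forall n \near \oo,
    forall t u, 0 <= t <= T -> dom u -> `|G t u - stepf n (G t) u| <= e.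
Proof.
move=> T0 cG e e0; have [d d0 H] := cylinder_unif 0 1 T0 cG e0.
have [N _ HN] : \forall n \near \oo, (n.+1%:R : R)^-1 < d.
  exact: near_infty_natSinv_lt (PosNum d0).
near=> n => t u tT du.
have n0 : (0 < n)%N by near: n; exact: nbhs_infty_gt.
have [j [cj ->]] := stepfE (G t) n0 du.
apply/ltW/H => //; first by case/domP/andP: du => -> /ltW.
  by rewrite subrr normr0.
move: cj; rewrite /cell/= in_itv/= => /andP[h1 h2].
rewrite ger0_norm ?subr_ge0// (@lt_le_trans _ _ (n%:R^-1))//.
  by rewrite ltrBlDr; apply: lt_le_trans h2 _; rewrite -natr1 mulrDl mul1r addrC.
have := HN n.-1; rewrite /= prednK// => /(_ _)/ltW; apply.
by rewrite -ltnS prednK//; near: n; exact: nbhs_infty_gt.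
Unshelve. all: by end_near. Qed.

Lemma stepf_approx_continuous g : continuous g ->
  forall e : R, 0 < e -> \forall n \near \oo,
    forall u, dom u -> `|g u - stepf n g u| <= e.
Proof.
move=> cg e e0.
have := stepf_approx (lexx 0) (@continuous_cylinder _ 0 _ cg) e0.
by apply: filterS => n H u du; apply: (H 0) => //; rewrite lexx.
Qed.

End Torus_integral.

(** * Measures on the torus and their densities *)

Section Measures.
Context {R : realType}.
Local Notation mu := (@lebesgue_measure R).
Local Notation dom := (@torus_dom R).
Local Notation bd := (@bdm _ (measurableTypeR R) R dom).
Implicit Types (f g h : R -> R) (m : @torus_measure R).

Lemma ae_lebesgueS (P Q : R -> Prop) : (forall u, P u -> Q u) ->
  {ae mu, forall u, P u} -> {ae mu, forall u, Q u}.
Proof.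
move=> PQ; apply: filterS => //; exact: (ae_filter_ringOfSetsType mu).
Qed.

Lemma tmass_fin m : (m dom < +oo)%E.
Proof.
apply: (@le_lt_trans _ _ 1%E); last exact: ltry.
apply: (@le_trans _ _ (m setT)); last exact: sprobability_setT.
apply: le_measure; rewrite ?inE//.
exact: measurable_dom.
Qed.

Lemma tmass_le1 m : fine (m dom) <= 1.
Proof.
rewrite -lee_fin fineK; last first.
  by rewrite ge0_fin_numE ?tmass_fin.
apply: (@le_trans _ _ (m setT)); last exact: sprobability_setT.
apply: le_measure; rewrite ?inE//.
exact: measurable_dom.
Qed.

Lemma abs_mpair_le m g (C : R) : 0 <= C -> bd g ->
  (forall u, dom u -> `|g u| <= C) -> `|mpair m g| <= C.
Proof.
move=> C0 bg gC.
have := abs_bint_le_cst measurable_dom (tmass_fin m) bg gC.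
by move/le_trans; apply; rewrite ler_piMr// tmass_le1.
Qed.

Lemma mpairB m f g : bd f -> bd g ->
  mpair m (fun u => f u - g u) = mpair m f - mpair m g.
Proof. by move=> bf bg; exact: (bintB measurable_dom (tmass_fin m) bf bg). Qed.

Lemma mpairZ m r f : bd f -> mpair m (fun u => r * f u) = r * mpair m f.
Proof. by move=> bf; exact: (bintZ measurable_dom (tmass_fin m) _ bf). Qed.

Lemma mpair_sum m (I : Type) (r : seq I) (P : pred I) (F : I -> R -> R) :
  (forall i, P i -> bd (F i)) ->
  mpair m (fun u => \sum_(i <- r | P i) F i u) = \sum_(i <- r | P i) mpair m (F i).
Proof.
by move=> bF; exact: (bint_sum (mu := m) measurable_dom (tmass_fin m) r bF).
Qed.

Lemma Rintegral_indic (nu : {measure set (measurableTypeR R) -> \bar R})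
    (A D : set R) :
  measurable (A : set (measurableTypeR R)) ->
  measurable (D : set (measurableTypeR R)) ->
  \int[nu]_(x in D) (\1_A x : R) = fine (nu (A `&` D)).
Proof. by move=> mA mD; rewrite /Rintegral integral_indic. Qed.

Lemma cell_dom n j : (j < n)%N -> cell n j `&` dom = cell n j :> set R.
Proof.
move=> jn; apply/setIidl => u; rewrite /cell /torus_dom/= !in_itv/=.
move=> /andP[h1 h2]; apply/andP; split.
  by apply: le_trans h1; rewrite divr_ge0.
apply: (lt_le_trans h2); rewrite ler_pdivrMr ?mul1r ?ler_nat//.
by rewrite ltr0n (leq_ltn_trans _ jn).
Qed.

Lemma mpair_stepf m n g :
  mpair m (stepf n g) = \sum_(j < n) g (j%:R / n%:R) * fine (m (cell n j)).
Proof.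
have bI j : bd (\1_(cell n j) : R -> R) by apply: bdm_indic; exact: measurable_cell.
rewrite mpair_sum; last by move=> j _; apply: bdmZ.
apply: eq_bigr => j _; rewrite mpairZ//; congr (_ * _).
rewrite /mpair Rintegral_indic//; [|exact: measurable_cell|exact: measurable_dom].
by rewrite cell_dom.
Qed.

Lemma mpair_cvg m g : continuous g ->
  \sum_(j < n) g (j%:R / n%:R) * fine (m (cell n j)) @[n --> \oo] --> mpair m g.
Proof.
move=> cg; apply/cvgrPdist_le => e e0.
have := stepf_approx_continuous cg e0; apply: filterS => n H.
have bs : bd (stepf n g) := bdm_stepf n g _.
rewrite -mpair_stepf -mpairB//; last exact: continuous_bd.
apply: abs_mpair_le => //; first exact: ltW.
by apply: bdmB bs; exact: continuous_bd.
Qed.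

Lemma tint_stepf n g w : bd w -> tint (fun u => w u * stepf n g u) =
  \sum_(j < n) g (j%:R / n%:R) * tint (fun u => w u * \1_(cell n j) u).
Proof.
move=> bw.
have bI j : bd (\1_(cell n j) : R -> R) by apply: bdm_indic; exact: measurable_cell.
rewrite (eq_tint (g := fun u => \sum_(j < n) g (j%:R / n%:R) *
   (w u * \1_(cell n j) u))).
  rewrite tint_sum; last by move=> j _; apply/bdmZ/bdmM.
  by apply: eq_bigr => j _; rewrite tintZ//; apply: bdmM.
by move=> u _; rewrite /stepf mulr_sumr; apply: eq_bigr => j _; rewrite mulrCA.
Qed.

Lemma tint_cvg w g : bd w -> (forall u, dom u -> `|w u| <= 1) -> continuous g ->
  \sum_(j < n) g (j%:R / n%:R) * tint (fun u => w u * \1_(cell n j) u)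
    @[n --> \oo] --> tint (fun u => w u * g u).
Proof.
move=> bw w1 cg; apply/cvgrPdist_le => e e0.
have := stepf_approx_continuous cg e0; apply: filterS => n H.
have bs : bd (stepf n g) := bdm_stepf n g _.
have bg : bd g by exact: continuous_bd.
rewrite -tint_stepf// -tintB; [|exact: bdmM..].
apply: abs_tint_le_cst; first by apply: bdmB; exact: bdmM.
move=> u du; rewrite -mulrBr normrM -[leRHS]mul1r.
by apply: ler_pM => //; [exact: w1|exact: H].
Qed.

(** Riemann sums in [u] turn the partial integral into a limit of finite
    combinations of functions measurable in [t]. *)
Lemma measurable_tint_param T (k : R -> R -> R) :
  (forall u, 0 <= u <= 1 -> measurable_fun (`[0, T]%classic : set R) (k^~ u)) ->
  (forall t, 0 <= t <= T -> continuous (k t)) ->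
  measurable_fun (`[0, T]%classic : set R) (fun t => tint (k t)).
Proof.
move=> mk ck.
apply: (measurable_fun_cvg (h := fun n t => \sum_(j < n) k t (j%:R / n%:R) *
    tint (fun u => 1 * \1_(cell n j) u))).
  move=> n; apply: measurable_sum => j; apply: measurable_funM => //.
  apply: mk; rewrite divr_ge0//= ler_pdivrMr ?mul1r ?ler_nat; first exact: ltnW.
  by rewrite ltr0n (leq_ltn_trans _ (ltn_ord j)).
move=> t; rewrite /= in_itv/= => tT.
rewrite (eq_tint (g := fun u => 1 * k t u)); last by move=> u _; rewrite mul1r.
apply: tint_cvg; [exact: bdm_cst| |exact: ck].
by move=> u _; rewrite normr1.
Qed.

Implicit Type mm : Mplus R.

(** The chosen density lies in [0, 1] only almost everywhere; clamping gives
    bounds at every point without changing any integral. *)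
Definition dens mm : R -> R := fun u => clamp 0 1 (density mm u).

Lemma densityP mm : Mplus1 mm -> is_density mm (density mm).
Proof. by move=> H; apply: getPex. Qed.

Lemma measurable_density mm : Mplus1 mm -> measurable_fun dom (density mm).
Proof. by move=> /densityP[]. Qed.

Lemma dens01 mm u : 0 <= dens mm u <= 1.
Proof. by rewrite /dens clamp_itv. Qed.

Lemma bd_dens mm : Mplus1 mm -> bd (dens mm).
Proof.
move=> H; split.
  apply: (@measurableT_comp _ _ _ _ _ _ (clamp 0 1)).
    by apply: continuous_measurable_fun; exact: continuous_clamp.
  exact: measurable_density.
by exists 1 => u _; have /andP[h0 h1] := dens01 mm u; rewrite ger0_norm.
Qed.

Lemma dens_ae mm : Mplus1 mm ->
  {ae mu, forall u, dom u -> density mm u = dens mm u}.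
Proof.
move=> /densityP[_ H _]; apply: ae_lebesgueS H => u H du.
by rewrite /dens clamp_id// H.
Qed.

Lemma fpair_density mm (Psi : R -> R) h : Mplus1 mm -> continuous Psi -> bd h ->
  fpair (fun u => Psi (density mm u)) h = tint (fun u => Psi (dens mm u) * h u).
Proof.
move=> H cP [mh _].
have mP : measurable_fun setT Psi by exact: continuous_measurable_fun.
apply: (ae_eq_bint measurable_dom).
- by apply: measurable_funM => //; apply: measurableT_comp => //; exact: measurable_density.
- apply: measurable_funM => //; apply: measurableT_comp => //.
  by have [] := bd_dens H.
- by apply: ae_lebesgueS (dens_ae H) => u E du; rewrite E.
Qed.

Lemma meas_density mm (A : set R) : Mplus1 mm -> measurable A ->
  fine ((mm : @torus_measure R) A) = tint (fun u => dens mm u * \1_A u).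
Proof.
move=> H mA; have [md _ ->//] := densityP H.
rewrite setIC integral_mkcondr; congr fine.
apply: ae_eq_integral => //.
- exact: measurable_dom.
- apply: (measurable_restrict _ mA measurable_dom).1; apply/measurable_EFinP.
  by apply: measurable_funS md => //; exact: measurable_dom.
- apply/measurable_EFinP; apply: measurable_funM; last exact: measurable_indic.
  by have [] := bd_dens H.
- apply: ae_lebesgueS (dens_ae H) => u E du; rewrite /restrict/= indicE E//.
  by case: ifP; rewrite ?mulr1 ?mulr0.
Qed.

(** Both sides are limits of the same sums over cells. *)
Lemma mpairE mm g : Mplus1 mm -> continuous g ->
  mpair mm g = tint (fun u => dens mm u * g u).
Proof.
move=> H cg.
have c1 := mpair_cvg (m := mm) cg.
have c2 := tint_cvg (bd_dens H) _ cg.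
apply: cvg_unique c1 _ => //=.
rewrite (_ : (fun n => _) = fun n => \sum_(j < n) g (j%:R / n%:R) *
    tint (fun u => dens mm u * \1_(cell n j) u)); last first.
  apply/funext => n; apply: eq_bigr => j _; rewrite meas_density//.
  exact: measurable_cell.
apply: c2 => u _; have /andP[h0 h1] := dens01 mm u; by rewrite ger0_norm.
Qed.

End Measures.

(** * The trigonometric system *)

Section FTC.
Context {R : realType}.
Local Notation mu := (@lebesgue_measure R).
Implicit Types F f g G : R -> R.

Lemma is_derive_continuous_at F (d x : R) : is_derive x 1 F d -> {for x, continuous F}.
Proof.
move=> dF; apply: differentiable_continuous; apply/derivable1_diffP.
exact: ex_derive.
Qed.

Lemma is_derive1_val F (d x : R) : is_derive x 1 F d -> derive1 F x = d.
Proof. by move=> dF; rewrite derive1E; exact: derive_val. Qed.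

Lemma Rintegral_FTC2 F f a b : a < b ->
  (forall x : R, a <= x <= b -> is_derive x 1 F (f x)) -> continuous f ->
  \int[mu]_(x in `[a, b]) f x = F b - F a.
Proof.
move=> ab dF cf; rewrite /Rintegral (@continuous_FTC2 _ _ F)//.
- exact: continuous_subspaceT.
- split.
  + move=> x; rewrite in_itv/= => /andP[ax xb]; apply: ex_derive; apply: dF.
    by rewrite !ltW.
  + apply: cvg_at_right_filter; apply: (is_derive_continuous_at (d := f a)).
    by apply: dF; rewrite lexx ltW.
  + apply: cvg_at_left_filter; apply: (is_derive_continuous_at (d := f b)).
    by apply: dF; rewrite lexx ltW.
- move=> x; rewrite in_itv/= => /andP[ax xb]; apply: is_derive1_val; apply: dF.
  by rewrite !ltW.
Qed.

Lemma is_derive1_continuous F f : (forall x : R, is_derive x 1 F (f x)) ->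
  continuous F.
Proof. by move=> dF x; exact: is_derive_continuous_at (dF x). Qed.

Lemma tint_closed f : continuous f -> tint f = \int[mu]_(x in `[0, 1]) f x.
Proof.
move=> cf; rewrite /tint /torus_dom Rintegral_itv_bndo_bndc//.
exact: (bdm_integrable measurable_dom lebesgue_dom_fin (continuous_bd cf)).
Qed.

Lemma tint_derive F f : (forall x : R, is_derive x 1 F (f x)) -> continuous f ->
  tint f = F 1 - F 0.
Proof. by move=> dF cf; rewrite tint_closed// (@Rintegral_FTC2 F f)//. Qed.

Lemma continuousM2 f g : continuous f -> continuous g ->
  continuous (fun x => f x * g x).
Proof. by move=> cf cg x; apply: continuousM; [exact: cf|exact: cg]. Qed.

Lemma continuousD2 f g : continuous f -> continuous g ->
  continuous (fun x => f x + g x).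
Proof. by move=> cf cg x; apply: continuousD; [exact: cf|exact: cg]. Qed.

Lemma continuousZ2 (r : R) f : continuous f -> continuous (fun x => r * f x).
Proof. by move=> cf; apply: continuousM2 => //; exact: cst_continuous. Qed.

Lemma continuous_lincomb (I : Type) (s : seq I) (c : I -> R) (F : I -> R -> R) :
  (forall i, continuous (F i)) -> continuous (fun x => \sum_(i <- s) c i * F i x).
Proof.
move=> cF; elim: s => [|i s IH].
  by under eq_fun do rewrite big_nil; exact: cst_continuous.
by under eq_fun do rewrite big_cons; apply: continuousD2 => //; exact: continuousZ2.
Qed.

Lemma tint_parts F f G g : (forall x : R, is_derive x 1 F (f x)) -> continuous f ->
  (forall x : R, is_derive x 1 G (g x)) -> continuous g ->
  tint (fun x => F x * g x) = F 1 * G 1 - F 0 * G 0 - tint (fun x => f x * G x).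
Proof.
move=> dF cf dG cg.
have cF := is_derive1_continuous dF; have cG := is_derive1_continuous dG.
have dFG (x : R) : is_derive x 1 (fun x => F x * G x) (F x * g x + f x * G x).
  have := is_deriveM (dF x) (dG x).
  by rewrite /GRing.scale/= [G x * f x]mulrC.
have cFG : continuous (fun x => F x * g x + f x * G x).
  by apply: continuousD2; exact: continuousM2.
have := tint_derive dFG cFG.
by rewrite tintD => [<-| |]; [rewrite addrK|apply/continuous_bd/continuousM2..].
Qed.

End FTC.

Section Trig.
Context {R : realType}.
Local Notation dom := (@torus_dom R).
Local Notation bd := (@bdm _ (measurableTypeR R) R dom).

Definition nrm (k : nat) : R := if k == 0%N then 1 else Num.sqrt 2.
Definition freq (k : nat) : R := pi *+ 2 * k%:R.
(** [(true, k)] is the k-th cosine and [(false, k)] the k-th sine. The zero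
    function [(false, 0)] is kept so that both families have the same indices. *)
Definition trig (p : bool * nat) (u : R) : R :=
  nrm p.2 * (if p.1 then cos (freq p.2 * u) else sin (freq p.2 * u)).
Definition flip (p : bool * nat) := (~~ p.1, p.2).
Definition sfreq (p : bool * nat) : R := if p.1 then - freq p.2 else freq p.2.

Lemma nrm_ge0 k : 0 <= nrm k.
Proof. by rewrite /nrm; case: ifP => // _; exact: sqrtr_ge0. Qed.

Lemma nrm_sqr k : nrm k ^+ 2 = if k == 0%N then 1 else 2.
Proof. by rewrite /nrm; case: ifP => _; rewrite ?expr1n ?sqr_sqrtr. Qed.

Lemma nrm_le2 k : nrm k <= 2.
Proof.
rewrite -(@ler_pXn2r _ 2)// ?nnegrE ?nrm_ge0// nrm_sqr; case: ifP => _; lra.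
Qed.

Lemma freq_ge0 k : 0 <= freq k.
Proof. by rewrite /freq mulr_ge0// mulrn_wge0// pi_ge0. Qed.

Lemma freq0 : freq 0 = 0. Proof. by rewrite /freq mulr0. Qed.

Lemma freq_inj k l : freq k = freq l -> k = l.
Proof.
move=> /mulfI H; apply/eqP; rewrite -(eqr_nat R); apply/eqP/H.
by rewrite mulrn_eq0/= gt_eqF// pi_gt0.
Qed.

Lemma is_derive_trig p (u : R) : is_derive u 1 (trig p) (sfreq p * trig (flip p) u).
Proof.
case: p => -[] k; rewrite /trig /sfreq /flip/=;
 apply: is_derive_eq; rewrite /GRing.scale/= ?mulr0 ?addr0 ?mulr1; ring.
Qed.

Lemma trig_continuous p : continuous (trig p).
Proof. exact: is_derive1_continuous (is_derive_trig p). Qed.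

Lemma bd_trig p : bd (trig p).
Proof. by apply: continuous_bd; exact: trig_continuous. Qed.

Lemma trig_periodic p : periodic1 (trig p).
Proof.
move=> u; rewrite /trig mulrDr mulr1 {2 4}/freq.
by rewrite mulr_natr; case: ifP => _; rewrite ?(periodicn (@cosD2pi R))
  ?(periodicn (@sinD2pi R)).
Qed.

Lemma trig_le2 p u : `|trig p u| <= 2.
Proof.
rewrite normrM ger0_norm ?nrm_ge0// -[leRHS]mulr1 ler_pM ?nrm_ge0 ?nrm_le2//.
by case: ifP => _; [exact: cos_max|exact: sin_max].
Qed.

Lemma trig_01 p : trig p 1 = trig p 0.
Proof. by rewrite -[1]add0r trig_periodic. Qed.

Lemma trig_false0 u : trig (false, 0%N) u = 0.
Proof. by rewrite /trig/= freq0 mul0r sin0 mulr0. Qed.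

Lemma trig_true0 u : trig (true, 0%N) u = 1.
Proof. by rewrite /trig/= freq0 mul0r cos0 mulr1. Qed.

Lemma flipK p : flip (flip p) = p.
Proof. by case: p => b k; rewrite /flip/= negbK. Qed.

Lemma sfreq_flip p : sfreq (flip p) = - sfreq p.
Proof. by case: p => -[] k; rewrite /sfreq /flip/= ?opprK. Qed.

Lemma sfreq_sqr p : sfreq p ^+ 2 = freq p.2 ^+ 2.
Proof. by rewrite /sfreq; case: ifP => // _; rewrite sqrrN. Qed.

Definition coef (f : R -> R) p : R := tint (fun u => f u * trig p u).

Lemma coef_false0 f : coef f (false, 0%N) = 0.
Proof.
rewrite /coef (eq_tint (g := fun=> 0)) ?tint_cst// => u _.
by rewrite trig_false0 mulr0.
Qed.

(** Integration by parts: the boundary terms cancel by periodicity. *)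
Lemma coef_derive F f p : (forall x : R, is_derive x 1 F (f x)) -> continuous f ->
  F 1 = F 0 -> coef f p = - (sfreq p * coef F (flip p)).
Proof.
move=> dF cf F01; rewrite /coef.
have cF := is_derive1_continuous dF.
have ct : continuous (fun x => sfreq p * trig (flip p) x).
  by apply: continuousZ2; exact: trig_continuous.
have := tint_parts dF cf (is_derive_trig p) ct.
rewrite F01 trig_01 subrr sub0r => /esym/eqP; rewrite eqr_oppLR => /eqP ->.
congr (- _); rewrite -tintZ.
  by apply: eq_tint => u _; rewrite mulrCA.
by apply/continuous_bd/continuousM2 => //; exact: trig_continuous.
Qed.

(** The squared norm of the function of index [p]: it is 1 except for the zero
    function. *)
Definition nsq (p : bool * nat) : R := (p != (false, 0%N))%:R.

(** Differentiation acts antisymmetrically by integration by parts and multiplies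
    by the frequency. Applied twice, this makes functions of different
    frequencies orthogonal; applied once, it makes the cosine and the sine of one
    frequency orthogonal and of equal norm. *)
Lemma trig_orthonormal p q :
  tint (fun u => trig p u * trig q u) = if p == q then nsq p else 0.
Proof.
pose ip p q := coef (trig p) q.
have ipC a b : ip a b = ip b a.
  by apply: eq_tint => u _; rewrite mulrC.
have parts a b : sfreq a * ip (flip a) b = - (sfreq b * ip a (flip b)).
  have <- := coef_derive (F := trig a) b (is_derive_trig a) _ (trig_01 a).
    rewrite /ip /coef -tintZ.
      by apply: eq_tint => u _; rewrite mulrA.
    by apply/continuous_bd/continuousM2; exact: trig_continuous.
  by apply: continuousZ2; exact: trig_continuous.
rewrite -/(coef _ _) -/(ip p q).
case: (eqVneq p q) => [<-|pq].
  case: p => b [|k].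
    case: b; rewrite /nsq /ip.
      rewrite /coef (eq_tint (g := fun=> 1)) ?tint_cst// => u _.
      by rewrite trig_true0 mulr1.
    by rewrite coef_false0 eqxx.
  have fk : freq k.+1 != 0.
    by rewrite -freq0; apply/eqP => /freq_inj.
  have E : ip (true, k.+1) (true, k.+1) = ip (false, k.+1) (false, k.+1).
    have := parts (true, k.+1) (false, k.+1).
    rewrite /sfreq /flip/= mulNr => /eqP; rewrite eqr_opp => /eqP /(mulfI fk) ->.
    by [].
  have S : ip (true, k.+1) (true, k.+1) + ip (false, k.+1) (false, k.+1) = 2.
    rewrite /ip /coef -tintD; [|by apply/continuous_bd/continuousM2; exact: trig_continuous..].
    rewrite (eq_tint (g := fun=> 2)) ?tint_cst// => u _.
    rewrite -!expr2 /trig/= !exprMn -mulrDr cos2Dsin2 mulr1.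
    by rewrite nrm_sqr.
  have -> : nsq (b, k.+1) = 1 by rewrite /nsq; case: b.
  by case: b; move: S; rewrite E => S; lra.
have [kl|kl] := eqVneq p.2 q.2.
  case: p q pq kl => a [|k] [b l] pq /= kl; rewrite -{l}kl in pq *.
    case: a b pq => -[] // _.
      by rewrite /ip coef_false0.
    by rewrite ipC /ip coef_false0.
  have fk : freq k.+1 != 0.
    by rewrite -freq0; apply/eqP => /freq_inj.
  have E : ip (true, k.+1) (false, k.+1) = 0.
    have := parts (true, k.+1) (true, k.+1).
    rewrite /sfreq /flip/= mulNr mulNr opprK => /eqP.
    rewrite -subr_eq0 -opprD oppr_eq0 -mulrDr mulf_eq0 (negbTE fk)/= ipC.
    by rewrite -mulr2n mulrn_eq0/= => /eqP.
  by case: a b pq => -[]; rewrite ?eqxx// ipC.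
have H : sfreq (flip p) * sfreq p * ip p q = sfreq (flip q) * sfreq q * ip p q.
  have h1 := parts (flip p) q; rewrite flipK in h1.
  have h2 := parts p (flip q); rewrite flipK in h2.
  transitivity (- sfreq q * (sfreq p * ip (flip p) (flip q))).
    by rewrite mulrAC h1; ring.
  by rewrite h2; ring.
rewrite !sfreq_flip !mulNr in H.
have {}H : freq p.2 ^+ 2 * ip p q = freq q.2 ^+ 2 * ip p q.
  by apply: oppr_inj; rewrite -!sfreq_sqr !expr2.
apply/eqP; have /eqP := H; rewrite -subr_eq0 -mulrBl mulf_eq0 => /orP[|//].
rewrite subr_eq0 eqrXn2 ?freq_ge0// => /eqP/freq_inj e.
by rewrite e eqxx in kl.
Qed.

End Trig.

(** * Fejer means *)

Section Fejer.
Context {R : realType}.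
Local Notation dom := (@torus_dom R).
Local Notation bd := (@bdm _ (measurableTypeR R) R dom).
Implicit Types (f g : R -> R) (N : nat) (p q : bool * nat).

Definition idx N : seq (bool * nat) :=
  [seq (b, k) | b <- [:: true; false], k <- iota 0 N].

Lemma uniq_idx N : uniq (idx N).
Proof.
by rewrite allpairs_uniq// ?iota_uniq// => -[? ?] [? ?] _ _ /= [-> ->].
Qed.

Lemma mem_idx N p : (p \in idx N) = (p.2 < N)%N.
Proof.
apply/allpairsP/idP => [[[b k] /= [_ + ->]]|pN].
  by rewrite mem_iota add0n.
exists p; split; first by case: p pN => -[] ? _; rewrite !inE.
  by rewrite mem_iota add0n.
by case: p pN.
Qed.

Lemma sum_idx N (F : bool * nat -> R) :
  \sum_(p <- idx N) F p = \sum_(k < N) (F (true, k : nat) + F (false, k : nat)).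
Proof.
rewrite big_allpairs/= !big_cons big_nil addr0 big_split/=.
by rewrite -!(big_mkord xpredT (fun k => F (_, k))) /index_iota subn0.
Qed.

(** The Fejer weights. *)
Definition wt N p : R := 1 - p.2%:R / N%:R.

Lemma wt01 N p : p \in idx N -> 0 <= wt N p <= 1.
Proof.
rewrite mem_idx => pN; have N0 : 0 < N%:R :> R by rewrite ltr0n (leq_ltn_trans _ pN).
rewrite /wt subr_ge0 ler_pdivrMr// mul1r ler_nat (ltnW pN)/=.
by rewrite lerBlDr lerDl divr_ge0.
Qed.

Definition trigpoly (a : bool * nat -> R) N u := \sum_(p <- idx N) a p * trig p u.

Lemma continuous_trigpoly a N : continuous (trigpoly a N).
Proof. by apply: continuous_lincomb; exact: trig_continuous. Qed.

Lemma bd_trigpoly a N : bd (trigpoly a N).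
Proof. by apply: continuous_bd; exact: continuous_trigpoly. Qed.

Lemma bd_coef f p : bd f -> bd (fun u => f u * trig p u).
Proof. by move=> bf; apply: bdmM => //; exact: bd_trig. Qed.

Lemma coefB f g p : bd f -> bd g -> coef (fun u => f u - g u) p = coef f p - coef g p.
Proof.
move=> bf bg; rewrite /coef -tintB; [|exact: bd_coef..].
by apply: eq_tint => u _; rewrite mulrBl.
Qed.

Lemma tint_trigpoly f a N : bd f ->
  tint (fun u => f u * trigpoly a N u) = \sum_(p <- idx N) a p * coef f p.
Proof.
move=> bf.
rewrite (eq_tint (g := fun u => \sum_(p <- idx N) a p * (f u * trig p u))).
  rewrite tint_sum; last by move=> p _; apply/bdmZ/bd_coef.
  by apply: eq_bigr => p _; rewrite tintZ//; exact: bd_coef.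
by move=> u _; rewrite mulr_sumr; apply: eq_bigr => p _; rewrite mulrCA.
Qed.

Lemma coef_trigpoly a N q : q \in idx N -> coef (trigpoly a N) q = a q * nsq q.
Proof.
move=> qN; rewrite /coef.
rewrite (eq_tint (g := fun u => trig q u * trigpoly a N u)); last first.
  by move=> u _; rewrite mulrC.
rewrite tint_trigpoly; last exact: bd_trig.
rewrite (bigD1_seq q)//= ?uniq_idx// big1 ?addr0.
  by rewrite /coef trig_orthonormal eqxx.
by move=> p pq; rewrite /coef trig_orthonormal eq_sym (negbTE pq) mulr0.
Qed.

Lemma tint_trigpoly2 a b N : tint (fun u => trigpoly a N u * trigpoly b N u) =
  \sum_(p <- idx N) a p * b p * nsq p.
Proof.
rewrite tint_trigpoly; last exact: bd_trigpoly.
by apply: eq_big_seq => p pN; rewrite coef_trigpoly//; ring.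
Qed.

Lemma nsq01 p : 0 <= (nsq p : R) <= 1.
Proof. by rewrite /nsq; case: (p != _); rewrite ?lexx ler01. Qed.

Lemma bessel f N : bd f ->
  \sum_(p <- idx N) coef f p ^+ 2 <= tint (fun u => f u ^+ 2).
Proof.
move=> bf; pose a := coef f.
have bt : bd (trigpoly a N) by exact: bd_trigpoly.
have : 0 <= tint (fun u => (f u - trigpoly a N u) ^+ 2).
  by apply: tint_ge0 => u _; exact: sqr_ge0.
rewrite (eq_tint (g := fun u => f u ^+ 2 - 2 * (f u * trigpoly a N u)
   + trigpoly a N u * trigpoly a N u)); last by move=> u _; ring.
rewrite tintD ?tintB ?tintZ; last 5 first.
- exact: bdmM.
- exact: bdmX.
- by apply: bdmZ; exact: bdmM.
- by apply: bdmB; [exact: bdmX|apply: bdmZ; exact: bdmM].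
- exact: bdmM.
rewrite tint_trigpoly// tint_trigpoly2.
have : \sum_(p <- idx N) a p * a p * nsq p <= \sum_(p <- idx N) a p * a p.
  apply: ler_sum => p _; rewrite ler_piMr// -?expr2 ?sqr_ge0//.
  by have /andP[] := nsq01 p.
under [in X in _ -> _ -> X]eq_bigr do rewrite expr2.
by rewrite /a; lra.
Qed.

(** Both sides are the square modulus of the sum of e^(ijx) over j < N. The left
    side is N times the Fejer kernel, which is therefore nonnegative. *)
Lemma fejer_sum N (x : R) :
  \sum_(k < N) (N%:R - k%:R) * ((if k == 0%N :> nat then 1 else 2) * cos (k%:R * x))
  = (\sum_(j < N) cos (j%:R * x)) ^+ 2 + (\sum_(j < N) sin (j%:R * x)) ^+ 2.
Proof.
pose al (k : nat) : R := if k == 0%N then 1 else 2.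
elim: N => [|N IH]; first by rewrite !big_ord0 expr0n/= addr0.
rewrite [in RHS]big_ord_recr [X in _ + X ^+ 2]big_ord_recr/=.
set C := \sum_(j < N) cos _; set S := \sum_(j < N) sin _.
have -> : (C + cos (N%:R * x)) ^+ 2 + (S + sin (N%:R * x)) ^+ 2 =
  (C ^+ 2 + S ^+ 2) + (2 * (C * cos (N%:R * x) + S * sin (N%:R * x)) + 1).
  have := cos2Dsin2 (N%:R * x); set a := cos (N%:R * x); set b := sin (N%:R * x).
  move=> ab; transitivity (C ^+ 2 + S ^+ 2 + (2 * (C * a + S * b) + (a ^+ 2 + b ^+ 2))).
    by ring.
  by rewrite ab.
rewrite -IH.
have -> : C * cos (N%:R * x) + S * sin (N%:R * x) =
    \sum_(k < N) cos (k.+1%:R * x).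
  rewrite mulr_suml mulr_suml -big_split/=.
  rewrite -(big_mkord xpredT (fun k => cos (k.+1%:R * x))).
  rewrite -(big_mkord xpredT (fun j => cos (j%:R * x) * cos (N%:R * x)
    + sin (j%:R * x) * sin (N%:R * x))) big_nat_rev/=.
  apply: eq_big_nat => j /andP[_ jN]; rewrite add0n -cosB -mulrBl.
  rewrite -cosN -mulNr opprB -natrB; last exact: leq_subr.
  by rewrite subKn.
rewrite big_ord_recr/= -/(al N).
have -> : \sum_(k < N) (N.+1%:R - k%:R) * (al k * cos (k%:R * x)) =
  \sum_(k < N) (N%:R - k%:R) * (al k * cos (k%:R * x))
  + \sum_(k < N) al k * cos (k%:R * x).
  by rewrite -big_split/=; apply: eq_bigr => k _; rewrite -natr1; ring.
rewrite -addrA; congr (_ + _).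
rewrite -natr1 addrAC subrr add0r mul1r.
rewrite -(big_ord_recr N (fun k : 'I_N.+1 => al k * cos (k%:R * x))) /=.
rewrite big_ord_recl/= /al/= mul0r cos0 mulr1 addrC; congr (_ + _).
by rewrite mulr_sumr; apply: eq_bigr.
Qed.

Definition fker N u v : R := \sum_(p <- idx N) wt N p * trig p u * trig p v.

Lemma trig_pair k (u v : R) :
  trig (true, k) u * trig (true, k) v + trig (false, k) u * trig (false, k) v =
  (if k == 0%N then 1 else 2) * cos (k%:R * (pi *+ 2 * (u - v))).
Proof.
rewrite -nrm_sqr; have -> : k%:R * (pi *+ 2 * (u - v)) = freq k * u - freq k * v.
  by rewrite /freq; ring.
by rewrite cosB /trig/=; ring.
Qed.

Lemma fkerE N u v : fker N u v = \sum_(k < N) (1 - k%:R / N%:R) *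
  ((if k == 0%N :> nat then 1 else 2) * cos (k%:R * (pi *+ 2 * (u - v)))).
Proof.
rewrite /fker sum_idx; apply: eq_bigr => k _; rewrite -trig_pair /wt/=; ring.
Qed.

Lemma fker_ge0 N u v : 0 <= fker N u v.
Proof.
case: N => [|N]; first by rewrite fkerE big_ord0.
have N0 : 0 < N.+1%:R :> R by rewrite ltr0n.
rewrite -(pmulr_rge0 _ N0) fkerE mulr_sumr.
rewrite (eq_bigr (fun k : 'I_N.+1 => (N.+1%:R - k%:R) *
   ((if k == 0%N :> nat then 1 else 2) * cos (k%:R * (pi *+ 2 * (u - v)))))).
  by rewrite fejer_sum addr_ge0// sqr_ge0.
move=> k _; rewrite (mulrA N.+1%:R); congr (_ * _).
by rewrite mulrBr mulr1 mulrCA divff ?mulr1// gt_eqF.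
Qed.

Lemma fker_trigpoly N u : fker N u = trigpoly (fun p => wt N p * trig p u) N.
Proof. by []. Qed.

Definition fejer N f u : R := trigpoly (fun p => wt N p * coef f p) N u.

Lemma bd_fker N u : bd (fker N u).
Proof. by rewrite fker_trigpoly; exact: bd_trigpoly. Qed.

Lemma fejerE N f u : bd f -> fejer N f u = tint (fun v => fker N u v * f v).
Proof.
move=> bf; rewrite (eq_tint (g := fun v => f v * fker N u v)); last first.
  by move=> v _; rewrite mulrC.
rewrite fker_trigpoly tint_trigpoly//.
by apply: eq_bigr => p _; rewrite mulrAC.
Qed.

Lemma idx0 N : (0 < N)%N -> (true, 0%N) \in idx N.
Proof. by rewrite mem_idx. Qed.

Lemma tint_fker N u : (0 < N)%N -> tint (fker N u) = 1.
Proof.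
move=> N0; have := coef_trigpoly (fun p => wt N p * trig p u) (idx0 N0).
rewrite -fker_trigpoly /coef (eq_tint (g := fker N u)).
  move=> ->; rewrite /nsq/= mulr1 trig_true0 /wt/= mul0r subr0 mulr1.
  by [].
by move=> v _; rewrite trig_true0 mulr1.
Qed.

Lemma fejer_le N f u (C : R) : (0 < N)%N -> bd f ->
  (forall v, dom v -> f v <= C) -> fejer N f u <= C.
Proof.
move=> N0 bf fC; rewrite fejerE// -[leRHS]mulr1 -(tint_fker u N0) -tintZ.
  apply: le_tint => [||v dv].
  - by apply: bdmM => //; exact: bd_fker.
  - by apply: bdmZ; exact: bd_fker.
  - by rewrite mulrC ler_wpM2r ?fker_ge0// fC.
exact: bd_fker.
Qed.

Lemma fejer_ge N f u (C : R) : (0 < N)%N -> bd f ->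
  (forall v, dom v -> C <= f v) -> C <= fejer N f u.
Proof.
move=> N0 bf fC; rewrite fejerE// -[leLHS]mulr1 -(tint_fker u N0) -tintZ.
  apply: le_tint => [||v dv].
  - by apply: bdmZ; exact: bd_fker.
  - by apply: bdmM => //; exact: bd_fker.
  - by rewrite [leRHS]mulrC ler_wpM2r ?fker_ge0// fC.
exact: bd_fker.
Qed.

Lemma abs_fejer_le N f u (C : R) : (0 < N)%N -> bd f ->
  (forall v, dom v -> `|f v| <= C) -> `|fejer N f u| <= C.
Proof.
move=> N0 bf fC; rewrite ler_norml fejer_le//= ?fejer_ge//.
  by move=> v /fC; rewrite ler_norml => /andP[].
by move=> v /fC; rewrite ler_norml => /andP[].
Qed.

Lemma tint_fker_cos N u : (1 < N)%N ->
  tint (fun v => fker N u v * (1 - cos (pi *+ 2 * (u - v)))) = N%:R^-1.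
Proof.
move=> N1; have N0 : (0 < N)%N by exact: ltnW.
have E v : cos (pi *+ 2 * (u - v)) = 2^-1 * (trig (true, 1%N) u * trig (true, 1%N) v
     + trig (false, 1%N) u * trig (false, 1%N) v).
  by rewrite trig_pair/= mul1r mulrA mulVf ?mul1r// pnatr_eq0.
have iN b : (b, 1%N) \in idx N by rewrite mem_idx.
rewrite (eq_tint (g := fun v => fker N u v -
   (2^-1 * trig (true, 1%N) u * (fker N u v * trig (true, 1%N) v)
   + 2^-1 * trig (false, 1%N) u * (fker N u v * trig (false, 1%N) v)))); last first.
  by move=> v _; rewrite E; ring.
have bt b : bd (fun v => 2^-1 * trig (b, 1%N) u * (fker N u v * trig (b, 1%N) v)).
  by apply: bdmZ; apply: bdmM; [exact: bd_fker|exact: bd_trig].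
have bb b : bd (fun v => fker N u v * trig (b, 1%N) v).
  by apply: bdmM; [exact: bd_fker|exact: bd_trig].
rewrite tintB; [|exact: bd_fker|exact: bdmD].
rewrite tintD// !tintZ// tint_fker//.
have cE b : tint (fun v => fker N u v * trig (b, 1%N) v) =
    (1 - N%:R^-1) * trig (b, 1%N) u.
  have := coef_trigpoly (fun p => wt N p * trig p u) (iN b).
  rewrite -fker_trigpoly /coef => ->; rewrite /nsq /wt/= mul1r.
  by case: b; rewrite mulr1.
rewrite !cE.
have /= := trig_pair 1 u u; rewrite subrr !mulr0 cos0 mulr1 => H.
transitivity (1 - 2^-1 * (1 - N%:R^-1) * (trig (true, 1%N) u * trig (true, 1%N) u +
  trig (false, 1%N) u * trig (false, 1%N) u)); first by ring.
by rewrite H; field; rewrite pnatr_eq0 -lt0n.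
Qed.

(** The kernel is nonnegative and integrates 1 - cos to exactly 1/N, so a modulus
    of the form e + C (1 - cos) is all that is needed of [g]. *)
Lemma fejer_korovkin N g u (e C : R) : (1 < N)%N -> bd g -> dom u ->
  (forall v, dom v -> `|g u - g v| <= e + C * (1 - cos (pi *+ 2 * (u - v)))) ->
  `|g u - fejer N g u| <= e + C / N%:R.
Proof.
move=> N1 bg du H; have N0 : (0 < N)%N by exact: ltnW.
have bk := bd_fker N u.
have bc : bd (fun v => 1 - cos (pi *+ 2 * (u - v))).
  apply: bdmB; first exact: bdm_cst.
  apply: continuous_bd => v; apply: continuous_comp; last exact: continuous_cos.
  by apply: continuousM; [exact: cst_continuous|apply: continuousB;
    [exact: cst_continuous|exact: cvg_id]].
have -> : g u - fejer N g u = tint (fun v => g u * fker N u v - fker N u v * g v).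
  by rewrite tintB; [rewrite tintZ// tint_fker// mulr1 fejerE|exact: bdmZ|exact: bdmM].
have -> : e + C / N%:R = tint (fun v => e * fker N u v +
    C * (fker N u v * (1 - cos (pi *+ 2 * (u - v))))).
  rewrite tintD; [|exact: bdmZ|by apply: bdmZ; exact: bdmM].
  by rewrite !tintZ//; [rewrite tint_fker// tint_fker_cos// mulr1|exact: bdmM].
apply: abs_tint_le.
- by apply: bdmB; [exact: bdmZ|exact: bdmM].
- by apply: bdmD; [exact: bdmZ|apply: bdmZ; exact: bdmM].
move=> v dv; rewrite [g u * _]mulrC -mulrBr normrM ger0_norm ?fker_ge0//.
rewrite (le_trans (ler_wpM2l (fker_ge0 _ _ _) (H v dv)))//.
by rewrite mulrDr [_ * e]mulrC [_ * (C * _)]mulrCA.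
Qed.

(** Near the diagonal of the torus uniform continuity gives [e]; away from it
    1 - cos is bounded below, and the oscillation is at most twice the bound. *)
Lemma cylinder_korovkin (T : R) (G : R -> R -> R) : 0 <= T ->
  (forall t, 0 <= t <= T -> periodic1 (G t)) ->
  continuous_on_cylinder T G -> forall e : R, 0 < e -> exists2 C, 0 <= C &
  forall t u v, 0 <= t <= T -> dom u -> dom v ->
    `|G t u - G t v| <= e + C * (1 - cos (pi *+ 2 * (u - v))).
Proof.
move=> T0 pG cG e e0.
have [d0 d0_gt0 Hd0] := cylinder_unif 0 1 T0 cG e0.
have [K K0 HK] := cylinder_bounded 0 1 T0 cG.
pose d : R := Num.min d0 (1/4).
have d_gt0 : 0 < d by rewrite lt_min d0_gt0 divr_gt0.
have dd0 : d <= d0 by rewrite ge_min lexx.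
have d4 : d <= 1/4 by rewrite ge_min lexx orbT.
have pi0 := pi_gt0 R.
have pi2 : 0 < pi *+ 2 :> R by rewrite mulr2n addr_gt0.
have c1 : 0 < 1 - cos (pi *+ 2 * d).
  rewrite subr_gt0 -[ltRHS]cos0 ltr_cos ?in_itv/=.
  - exact: mulr_gt0.
  - by rewrite lexx pi_ge0.
  - rewrite mulr_ge0 ?(ltW pi2) ?(ltW d_gt0)//=.
    have : 0 <= pi * (1 / 4 - d) by rewrite mulr_ge0 ?subr_ge0// ltW.
    by lra.
exists (2 * K / (1 - cos (pi *+ 2 * d))).
  by rewrite divr_ge0 ?mulr_ge0// ltW.
suff W t u v : 0 <= t <= T -> dom u -> dom v -> u <= v ->
    `|G t u - G t v| <= e + 2 * K / (1 - cos (pi *+ 2 * d)) * (1 - cos (pi *+ 2 * (u - v))).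
  move=> t u v tT du dv; case: (leP u v) => [uv|/ltW vu]; first exact: W.
  by rewrite distrC -[u - v]opprB mulrN cosN; exact: W.
move=> tT /domP/andP[u0 u1] /domP/andP[v0 v1] uv.
have uu : 0 <= u <= 1 by rewrite u0 ltW.
have vv : 0 <= v <= 1 by rewrite v0 ltW.
have cle (x : R) : 0 <= 2 * K / (1 - cos (pi *+ 2 * d)) * (1 - cos x).
  by rewrite mulr_ge0 ?divr_ge0 ?mulr_ge0 ?(ltW c1)// subr_ge0 cos_le1.
(* Close points; points close across the end of the period; distant points. *)
have [h|h] := ltP (v - u) d.
  rewrite (le_trans (ltW (Hd0 t t u v tT tT uu _ _)))// ?subrr ?normr0// ?lerDl//.
  by rewrite distrC ger0_norm ?subr_ge0// (lt_le_trans h).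
have [h'|h'] := ltP (1 - (v - u)) d.
  have -> : G t u = G t (u + 1) by rewrite pG.
  rewrite distrC (le_trans (ltW (Hd0 t t v (u+1) tT tT vv _ _)))// ?subrr ?normr0// ?lerDl//.
  rewrite distrC ger0_norm; last by lra.
  by apply: lt_le_trans dd0; lra.
have cc : 1 - cos (pi *+ 2 * d) <= 1 - cos (pi *+ 2 * (u - v)).
  rewrite lerD2l lerN2 -cosN -mulrN opprB.
  wlog h2 : u v u0 u1 v0 v1 uv uu vv h h' / v - u <= 1/2.
    move=> W; have [?|h2] := leP (v - u) (1/2); first exact: W.
    have -> : cos (pi *+ 2 * (v - u)) = cos (pi *+ 2 * ((1 - (v - u)) - 0)).
      rewrite subr0 -(cosN (_ * (1 - _))) -[RHS](@cosD2pi R); congr cos.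
      by ring.
    apply: W => //; lra.
  rewrite leNgt ltr_cos ?in_itv/=; first by rewrite -leNgt ler_pM2l// ltW.
    rewrite mulr_ge0 ?(ltW pi2) ?subr_ge0//=.
    have : 0 <= pi * (1 / 2 - (v - u)) by rewrite mulr_ge0 ?subr_ge0// ltW.
    by lra.
  rewrite mulr_ge0 ?(ltW pi2) ?(ltW d_gt0)//=.
  have : 0 <= pi * (1 / 4 - d) by rewrite mulr_ge0 ?subr_ge0// ltW.
  by lra.
apply: (@le_trans _ _ (2 * K)).
  rewrite (le_trans (ler_normB _ _))// mulr_natl mulr2n lerD// HK//.
rewrite -[leLHS]add0r lerD ?(ltW e0)// -mulrA ler_peMr ?mulr_ge0//.
by rewrite mulrC ler_pdivlMr// mul1r.
Qed.

Lemma fejer_unif (T : R) (G : R -> R -> R) : 0 <= T ->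
  (forall t, 0 <= t <= T -> periodic1 (G t)) ->
  continuous_on_cylinder T G -> forall e : R, 0 < e ->
  \forall N \near \oo, forall t u, 0 <= t <= T -> dom u ->
    `|G t u - fejer N (G t) u| <= e.
Proof.
move=> T0 pG cG e e0; have e20 : 0 < e / 2 by rewrite divr_gt0.
have [C C0 HC] := cylinder_korovkin T0 pG cG e20.
have HN : \forall N \near \oo, C / (e / 2) <= N%:R by exact: nbhs_infty_ger.
near=> N => t u tT du.
have N1 : (1 < N)%N by near: N; exact: nbhs_infty_gt.
have bG : bd (G t) by apply: continuous_bd; exact: cylinder_cont_space cG.
rewrite (le_trans (fejer_korovkin (e := e/2) (C := C) N1 bG du _))//.
  by move=> v dv; exact: HC.
rewrite {2}[e]splitr lerD2l ler_pdivrMr ?ltr0n ?(ltnW N1)//.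
by rewrite mulrC -ler_pdivrMr//; near: N.
Unshelve. all: by end_near. Qed.

Lemma fejer_cvg g : continuous g -> periodic1 g -> forall e : R, 0 < e ->
  \forall N \near \oo, forall u, dom u -> `|g u - fejer N g u| <= e.
Proof.
move=> cg pg e e0.
have := @fejer_unif 0 (fun=> g) (lexx 0) (fun _ _ => pg) (continuous_cylinder cg) e e0.
by apply: filterS => N H u du; apply: (H 0) => //; rewrite lexx.
Qed.

(** The Fejer analogue of the squared L2 norm, see [vfejerE] and [parseval]. *)
Definition vfejer N f : R := \sum_(p <- idx N) wt N p * coef f p ^+ 2.

Lemma vfejerE N f : bd f -> vfejer N f = tint (fun u => f u * fejer N f u).
Proof.
by move=> bf; rewrite /fejer tint_trigpoly//; apply: eq_bigr => p _; rewrite expr2 mulrA.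
Qed.

Lemma tint_fejer_sqr N f : tint (fun u => fejer N f u ^+ 2) <= vfejer N f.
Proof.
rewrite (eq_tint (g := fun u => fejer N f u * fejer N f u)); last by move=> u _; rewrite expr2.
rewrite /fejer tint_trigpoly2 /vfejer big_seq [leRHS]big_seq; apply: ler_sum => p pN.
have /andP[w0 w1] := wt01 pN; have /andP[n0 n1] := nsq01 p.
rewrite mulrACA -expr2 -mulrA [_ * _ * nsq p]mulrC expr2 -mulrA ler_wpM2l//.
rewrite mulrA ler_piMl ?mulr_ile1// -expr2 sqr_ge0//.
Qed.

End Fejer.

(** * Approximation by continuous periodic functions and Parseval's identity *)

Section Parseval.
Context {R : realType}.
Local Notation mu := (@lebesgue_measure R).
Local Notation dom := (@torus_dom R).
Local Notation bd := (@bdm _ (measurableTypeR R) R dom).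
Implicit Types (f g h : R -> R).

Definition periodize g (u : R) : R := g (u - (Num.floor u)%:~R).

Lemma periodize_periodic g : periodic1 (periodize g).
Proof.
move=> u; rewrite /periodize; congr g.
rewrite (_ : Num.floor (u + 1) = Num.floor u + 1); last first.
  by rewrite floorDrz ?int_num1// floor1.
by rewrite rmorphD/=; ring.
Qed.

Lemma periodize_dom g u : dom u -> periodize g u = g u.
Proof.
move=> /domP u01; rewrite /periodize (_ : Num.floor u = 0) ?subr0//.
exact: floor_def.
Qed.

(** Around any point the periodization is the sum of three translates of [g],
    whose supports do not overlap. *)
Lemma periodize_continuous g : continuous g ->
  (forall x, x <= 0 \/ 1 <= x -> g x = 0) -> continuous (periodize g).
Proof.
move=> cg g0 u0; pose n : R := (Num.floor u0)%:~R.
have /andP[n1 n2] : n <= u0 < n + 1.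
  by rewrite /n ge_floor/= -[1 in ltRHS]/(1%:~R) -rmorphD/= floorD1_gt.
have cs (x : R) : continuous (fun u => g (u - x)).
  move=> u; apply: continuous_comp; last exact: cg.
  by apply: continuousB; [exact: cvg_id|exact: cst_continuous].
have H : continuous (fun u => g (u - (n - 1)) + (g (u - n) + g (u - (n + 1)))).
  by apply: continuousD2 => //; apply: continuousD2.
have E : \forall u \near u0,
    g (u - (n - 1)) + (g (u - n) + g (u - (n + 1))) = periodize g u.
  have : \forall u \near u0, u \in `]n - 1, n + 2[.
    by apply: near_in_itvoo; rewrite in_itv/=; lra.
  apply: filterS => u; rewrite in_itv/= => /andP[h1 h2].
  rewrite /periodize.
  have [h|h] := ltP u n.
    rewrite (@floor_def _ _ (Num.floor u0 - 1)); last first.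
      by rewrite subrK rmorphB/= -/n h andbT; lra.
    rewrite rmorphB/= -/n (g0 (u - n)) ?(g0 (u - (n+1))) ?addr0//; left; lra.
  have [h'|h'] := ltP u (n + 1).
    rewrite (@floor_def _ _ (Num.floor u0)); last first.
      by rewrite rmorphD/= -/n h h'.
    rewrite -/n (g0 (u - (n - 1))) ?(g0 (u - (n+1))) ?addr0 ?add0r//; [left|right]; lra.
  rewrite (@floor_def _ _ (Num.floor u0 + 1)); last first.
    by rewrite !rmorphD/= -/n h'/=; lra.
  rewrite rmorphD/= -/n (g0 (u - (n - 1))) ?(g0 (u - n)) ?add0r//; right; lra.
rewrite /continuous_at; have -> : periodize g u0 = g (u0 - (n - 1)) + (g (u0 - n) + g (u0 - (n + 1))).
  by rewrite (nbhs_singleton E).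
apply: cvg_trans (H u0); apply: near_eq_cvg.
by apply: filterS E => u ->.
Qed.

Definition cutoff (d u : R) : R := clamp 0 1 (Num.min u (1 - u) / d).

Lemma cutoff_continuous d : continuous (cutoff d).
Proof.
move=> u; apply: (@continuous_comp _ _ _ (fun u : R => Num.min u (1 - u) / d)
  (clamp (0 : R) 1)); last exact: continuous_clamp.
apply: continuousM; last exact: cst_continuous.
apply: continuous_min; first exact: cvg_id.
by apply: continuousB; [exact: cst_continuous|exact: cvg_id].
Qed.

Lemma cutoff01 d u : 0 <= cutoff d u <= 1.
Proof. by rewrite /cutoff clamp_itv. Qed.

Lemma cutoff0 (d u : R) : 0 < d -> u <= 0 \/ 1 <= u -> cutoff d u = 0.
Proof.
move=> d0 H; rewrite /cutoff /clamp max_l// ge_min; apply/orP; right.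
rewrite ler_pdivrMr// mul0r ge_min; apply/orP.
by case: H => H; [left|right; rewrite subr_le0].
Qed.

Lemma cutoff1 (d u : R) : 0 < d -> d <= u -> u <= 1 - d -> cutoff d u = 1.
Proof.
move=> d0 du ud; rewrite /cutoff /clamp min_l ?max_r//.
by rewrite ler_pdivlMr// mul1r le_min du lerBrDr addrC -lerBrDr.
Qed.

Lemma tint_cutoff (d : R) : 0 < d -> tint (fun u => 1 - cutoff d u) <= 2 * d.
Proof.
move=> d0.
have bA (a b : R) : bd (\1_(`[a, b]%classic) : R -> R).
  by apply: bdm_indic; exact: measurable_itv.
have bc : bd (fun u => 1 - cutoff d u).
  by apply: bdmB; [exact: bdm_cst|apply: continuous_bd; exact: cutoff_continuous].
have len (a b : R) : a <= b -> tint (\1_(`[a, b]%classic) : R -> R) <= b - a.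
  move=> ab; rewrite /tint Rintegral_indic//; last exact: measurable_dom.
  rewrite -lee_fin fineK; last first.
    rewrite ge0_fin_numE//; apply: le_lt_trans lebesgue_dom_fin.
    apply: le_measure; rewrite ?inE//; [|exact: measurable_dom].
    by apply: measurableI; [exact: measurable_itv|exact: measurable_dom].
  apply: (@le_trans _ _ (mu `[a, b]%classic)).
    apply: le_measure; rewrite ?inE//.
    by apply: measurableI; [exact: measurable_itv|exact: measurable_dom].
  rewrite lebesgue_measure_itv/= lte_fin; case: ltP => h.
    by rewrite EFinB.
  by rewrite lee_fin subr_ge0.
apply: (@le_trans _ _ (tint (fun u => \1_(`[0, d]%classic) u +
    \1_(`[1 - d, 1]%classic) u))).
  apply: le_tint => //; first exact: bdmD.
  move=> u /domP/andP[u0 u1]; have /andP[c0 c1] := cutoff01 d u.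
  have i0 (A : set R) : 0 <= \1_A u :> R by rewrite indicE.
  have [ud|ud] := leP u d.
    rewrite (@indicE _ _ `[0, d]%classic) mem_set/= ?in_itv/= ?u0//.
    by have := i0 `[1 - d, 1]%classic; lra.
  have [ud'|ud'] := leP (1 - d) u.
    rewrite (@indicE _ _ `[1 - d, 1]%classic) mem_set/= ?in_itv/= ?ud' ?(ltW u1)//.
    by have := i0 `[0, d]%classic; lra.
  by rewrite (cutoff1 d0 (ltW ud) (ltW ud')) subrr addr_ge0.
rewrite tintD//; have := len 0 d (ltW d0); have := len (1 - d) 1; lra.
Qed.

(** A continuous L1 approximation is clamped, then cut off near the integers so
    that it extends periodically; the cut costs the length of the two end
    intervals. *)
Lemma dense_continuous_periodic f (e : R) : bd f ->
  (forall u, dom u -> `|f u| <= 1) -> 0 < e ->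
  exists g, [/\ continuous g, periodic1 g & tint (fun u => `|f u - g u|) <= e].
Proof.
move=> bf f1 e0; have e20 : 0 < e / 2 by rewrite divr_gt0.
have intf := bdm_integrable measurable_dom lebesgue_dom_fin bf.
have [h_ [ch ih cv]] :=
  approximation_continuous_integrable measurable_dom lebesgue_dom_fin intf.
have [n Hn] : exists n, fine (\int[mu]_(z in dom) `|(f z - h_ n z)%:E|)%E < e / 2.
  have /fine_cvgP[_ cv'] := cv.
  by apply: (@filter_ex _ \oo); exact: cvgr_lt cv' _ e20.
pose h := h_ n; pose h1 u := clamp (-1) 1 (h u).
pose d := e / 4; have d0 : 0 < d by rewrite divr_gt0.
have ch1 : continuous h1.
  by move=> u; apply: (@continuous_comp _ _ _ h (clamp (-1 : R) 1));
    [exact: ch|exact: continuous_clamp].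
pose g0 u := h1 u * cutoff d u.
have cg0 : continuous g0 by apply: continuousM2 => //; exact: cutoff_continuous.
exists (periodize g0); split.
- apply: periodize_continuous => // x Hx.
  by rewrite /g0 cutoff0// mulr0.
- exact: periodize_periodic.
have bh : bd h by apply: continuous_bd; exact: ch.
have bh1 : bd h1 by apply: continuous_bd.
have bc : bd (fun u => 1 - cutoff d u).
  by apply: bdmB; [exact: bdm_cst|apply: continuous_bd; exact: cutoff_continuous].
apply: (@le_trans _ _ (tint (fun u => `|f u - h u| + (1 - cutoff d u)))).
  rewrite (eq_tint (g := fun u => `|f u - g0 u|)); last first.
    by move=> u du; rewrite periodize_dom.
  apply: le_tint.
  - by apply/bdm_norm/bdmB => //; exact: continuous_bd.
  - by apply: bdmD => //; apply/bdm_norm/bdmB.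
  move=> u du; have := f1 u du; have /andP[c0 c1] := cutoff01 d u.
  rewrite ler_norml => /andP[fa fb].
  have /andP[ha hb] : -1 <= h1 u <= 1 by rewrite clamp_itv//; lra.
  have H1 : `|f u - h1 u| <= `|f u - h u|.
    have [k|k] := leP (h u) (-1).
      have -> : h1 u = -1 by rewrite /h1 /clamp min_r ?max_l//; lra.
      by rewrite !ger0_norm; lra.
    have [k'|k'] := leP 1 (h u).
      have -> : h1 u = 1 by rewrite /h1 /clamp min_l ?max_r//; lra.
      by rewrite !ler0_norm; lra.
    by rewrite /h1 clamp_id// !ltW.
  apply: (@le_trans _ _ (`|f u - h1 u| + `|h1 u - g0 u|)); first exact: ler_distD.
  rewrite lerD//; have -> : h1 u - g0 u = h1 u * (1 - cutoff d u) by rewrite /g0; ring.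
  rewrite normrM [X in _ * X]ger0_norm ?subr_ge0// ler_piMl ?subr_ge0//.
  by rewrite ler_norml ha.
rewrite tintD//; last by apply/bdm_norm/bdmB.
rewrite [e in leRHS]splitr lerD//.
  exact: ltW.
by rewrite (le_trans (tint_cutoff d0))// /d; lra.
Qed.

Lemma tint_fejer_sym N f g : bd f -> bd g ->
  tint (fun u => f u * fejer N g u) = tint (fun u => g u * fejer N f u).
Proof.
move=> bf bg; rewrite /fejer !tint_trigpoly//.
by apply: eq_bigr => p _; ring.
Qed.

Lemma bd_fejer N f : bd (fejer N f).
Proof. exact: bd_trigpoly. Qed.

(** Fejer means are symmetric and contract the uniform norm, so an L1
    approximation of f by g costs the same on both sides. *)
Lemma parseval f : bd f -> (forall u, dom u -> `|f u| <= 1) ->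
  vfejer N f @[N --> \oo] --> tint (fun u => f u ^+ 2).
Proof.
move=> bf f1; apply/cvgrPdist_le => e e0.
have e3 : 0 < e / 3 by rewrite divr_gt0.
have [g [cg pg fg]] := dense_continuous_periodic bf f1 e3.
have bg : bd g by exact: continuous_bd.
near=> N.
have N0 : (0 < N)%N by near: N; exact: nbhs_infty_gt.
have bfg : bd (fun u => f u - g u) by exact: bdmB.
have bp h : bd (fejer N h) := bd_fejer N h.
have HN u : dom u -> `|g u - fejer N g u| <= e / 3.
  by move: u; near: N; exact: fejer_cvg.
(* Each term on the right contains a small difference and a bounded factor. *)
have -> : tint (fun u => f u ^+ 2) - vfejer N f =
    tint (fun u => f u * (f u - g u)) + tint (fun u => f u * (g u - fejer N g u))
    - tint (fun u => fejer N f u * (f u - g u)).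
  have E1 : tint (fun u => fejer N f u * (f u - g u)) =
      vfejer N f - tint (fun u => f u * fejer N g u).
    rewrite vfejerE// (tint_fejer_sym N bf bg) -tintB; [|exact: bdmM..].
    by apply: eq_tint => u _; ring.
  have E2 : tint (fun u => f u * (f u - g u)) =
      tint (fun u => f u ^+ 2) - tint (fun u => f u * g u).
    rewrite -tintB; [|exact: bdmX|exact: bdmM].
    by apply: eq_tint => u _; ring.
  have E3 : tint (fun u => f u * (g u - fejer N g u)) =
      tint (fun u => f u * g u) - tint (fun u => f u * fejer N g u).
    rewrite -tintB; [|exact: bdmM..].
    by apply: eq_tint => u _; ring.
  by rewrite E1 E2 E3; ring.
have A w : bd w -> (forall u, dom u -> `|w u| <= 1) ->
    `|tint (fun u => w u * (f u - g u))| <= e / 3.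
  move=> bw w1; apply: le_trans fg; apply: abs_tint_le.
  - exact: bdmM.
  - exact: bdm_norm.
  - by move=> u du; rewrite normrM ler_piMl// w1.
have B : `|tint (fun u => f u * (g u - fejer N g u))| <= e / 3.
  apply: abs_tint_le_cst; first by apply: bdmM => //; exact: bdmB.
  move=> u du; rewrite normrM (le_trans _ (HN u du))// ler_piMl//.
  exact: f1.
have A1 := A f bf f1.
have A2 : `|tint (fun u => fejer N f u * (f u - g u))| <= e / 3.
  by apply: A => // u du; exact: abs_fejer_le.
rewrite (le_trans (ler_normB _ _))//.
have := ler_normD (tint (fun u => f u * (f u - g u)))
  (tint (fun u => f u * (g u - fejer N g u))).
lra.
Unshelve. all: by end_near. Qed.

Lemma vfejer_ge0 N f : 0 <= vfejer N f.
Proof.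
rewrite /vfejer big_seq; apply: sumr_ge0 => p pN.
by rewrite mulr_ge0 ?sqr_ge0//; have /andP[] := @wt01 R N p pN.
Qed.

Lemma vfejer_le1 N f : (0 < N)%N -> bd f -> (forall u, dom u -> `|f u| <= 1) ->
  vfejer N f <= 1.
Proof.
move=> N0 bf f1; rewrite vfejerE//; apply: tint_le_cst.
  by apply: bdmM => //; exact: bd_fejer.
move=> u du; rewrite (le_trans (ler_norm _))// normrM mulr_ile1 ?normr_ge0//.
  exact: f1.
exact: abs_fejer_le.
Qed.

Lemma fejer_cvg_L2 f : bd f -> (forall u, dom u -> `|f u| <= 1) ->
  tint (fun u => (f u - fejer N f u) ^+ 2) @[N --> \oo] --> 0.
Proof.
move=> bf f1.
have H : tint (fun u => f u ^+ 2) - vfejer N f @[N --> \oo] --> 0.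
  rewrite -(subrr (tint (fun u => f u ^+ 2))); apply: cvgB; first exact: cvg_cst.
  exact: parseval.
apply: (squeeze_cvgr _ (cvg_cst 0) H); apply: nearW => N.
have bp : bd (fejer N f) := bd_fejer N f.
rewrite tint_ge0; last by move=> u _; exact: sqr_ge0.
rewrite (eq_tint (g := fun u => (f u ^+ 2 - 2 * (f u * fejer N f u)) + fejer N f u ^+ 2));
  last by move=> u _; ring.
have b1 : bd (fun u => f u ^+ 2) by exact: bdmX.
have b2 : bd (fun u => 2 * (f u * fejer N f u)) by apply/bdmZ/bdmM.
rewrite tintD ?tintB ?tintZ//; [|exact: bdmM|exact: bdmB|exact: bdmX].
rewrite -vfejerE//; have := tint_fejer_sqr N f; lra.
Qed.

End Parseval.

(** * Time integrals and measurability in time *)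

Section Time.
Context {R : realType} (T : R).
Hypothesis T0 : 0 < T.
Local Notation mu := (@lebesgue_measure R).
Local Notation itv := (`[0, T]%classic : set R).
Local Notation tb := (@bdm _ (measurableTypeR R) R itv).
Implicit Types f g : R -> R.

Let mitv : measurable (itv : set (measurableTypeR R)).
Proof. exact: measurable_itv. Qed.

Lemma lebesgue_itv : mu itv = T%:E.
Proof. by rewrite lebesgue_measure_itv/= lte_fin T0 oppr0 addr0. Qed.

Let itv_fin : (mu itv < +oo)%E.
Proof. by rewrite lebesgue_itv ltry. Qed.

Let fine_itv : fine ((mu : {measure set (measurableTypeR R) -> \bar R}) itv) = T.
Proof. by rewrite [X in fine X]lebesgue_itv. Qed.

Lemma itvP0 t : itv t <-> 0 <= t <= T.
Proof. by rewrite /= in_itv. Qed.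

Lemma timeD f g : tb f -> tb g ->
  time_int T (fun t => f t + g t) = time_int T f + time_int T g.
Proof. by move=> bf bg; exact: (bintD mitv itv_fin bf bg). Qed.

Lemma timeB f g : tb f -> tb g ->
  time_int T (fun t => f t - g t) = time_int T f - time_int T g.
Proof. by move=> bf bg; exact: (bintB mitv itv_fin bf bg). Qed.

Lemma timeZ r f : tb f -> time_int T (fun t => r * f t) = r * time_int T f.
Proof. by move=> bf; exact: (bintZ mitv itv_fin _ bf). Qed.

Lemma le_time f g : tb f -> tb g -> (forall t, 0 <= t <= T -> f t <= g t) ->
  time_int T f <= time_int T g.
Proof.
by move=> bf bg fg; apply: (le_bint mitv itv_fin bf bg) => t /itvP0; exact: fg.
Qed.

Lemma eq_time f g : (forall t, 0 <= t <= T -> f t = g t) ->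
  time_int T f = time_int T g.
Proof. by move=> fg; apply: eq_Rintegral => t; rewrite inE/= in_itv/=; exact: fg. Qed.

Lemma time_cst r : time_int T (fun=> r) = r * T.
Proof. by rewrite /time_int (bint_cst _ mitv) fine_itv. Qed.

Lemma abs_time_le f g : tb f -> tb g ->
  (forall t, 0 <= t <= T -> `|f t| <= g t) -> `|time_int T f| <= time_int T g.
Proof.
by move=> bf bg fg; apply: (abs_bint_le mitv itv_fin bf bg) => t /itvP0; exact: fg.
Qed.

Lemma time_ge0 f : (forall t, 0 <= t <= T -> 0 <= f t) -> 0 <= time_int T f.
Proof. by move=> f0; apply: Rintegral_ge0 => t /itvP0; exact: f0. Qed.

Lemma cvg_time (f_ : nat -> R -> R) f (C : R) :
  (forall n, measurable_fun itv (f_ n)) ->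
  (forall n t, 0 <= t <= T -> `|f_ n t| <= C) ->
  (forall t, 0 <= t <= T -> f_ n t @[n --> \oo] --> f t) ->
  time_int T (f_ n) @[n --> \oo] --> time_int T f.
Proof.
move=> mf fC ff.
apply: (cvg_bint mitv itv_fin (C := C) mf) => [n t|t] /itvP0; [exact: fC|exact: ff].
Qed.

Lemma continuous_tb f : continuous f -> tb f.
Proof.
move=> cf; split; first by apply: measurable_funTS; exact: continuous_measurable_fun.
have [C _ HC] := cylinder_bounded 0 T (lexx 0) (@continuous_cylinder _ 0 _ cf).
by exists C => u /itvP0 uT; apply: (HC 0); rewrite ?lexx.
Qed.

(** Rounding the time up on a grid of mesh 1/n gives step functions, which
    converge pointwise by right continuity. *)
Lemma measurable_right_continuous f :
  (forall t, 0 <= t < T -> f s @[s --> t^'+] --> f t) -> measurable_fun itv f.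
Proof.
move=> rc.
(* The right end of the cell, but never beyond T. *)
pose r (n k : nat) : R := Num.min T (k.+1%:R / n.+1%:R).
pose K n := (Num.truncn (T * n.+1%:R)).+1.
apply: (measurable_fun_cvg (h := fun n t =>
    \sum_(j < K n) f (r n j) * \1_(cell n.+1 j) t)).
  move=> n; apply: measurable_sum => j; apply: measurable_funM => //.
  by apply: measurable_indic; exact: measurable_cell.
move=> t /itvP0 /andP[t0 tT].
have E n : exists2 k, cell n.+1 k t & \sum_(j < K n) f (r n j) * \1_(cell n.+1 j) t = f (r n k).
  have [|||k [? _ ?]] := @cell_sum R n.+1 (K n) (fun j => f (r n j)) t => //.
    rewrite (@le_lt_trans _ _ (T * n.+1%:R))// ?ler_wpM2r//.
    by have /andP[] := truncn_itv (mulr_ge0 (ltW T0) (ler0n R n.+1)).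
  by exists k.
have nb n k : cell n.+1 k t -> t < k.+1%:R / n.+1%:R <= t + n.+1%:R^-1.
  rewrite /cell/= in_itv/= => /andP[h1 ->]/=.
  by rewrite -natr1 mulrDl mul1r lerD2r.
move: tT; rewrite le_eqVlt => /predU1P[tT|tT].
  rewrite (_ : (fun n => _) = cst (f t)); first exact: cvg_cst.
  apply/funext => n /=; have [k ck ->] := E n; rewrite /r min_l ?tT//.
  by have /andP[] := nb _ _ ck; rewrite tT => /ltW.
apply/cvgrPdist_le => e e0.
have : 0 <= t < T by rewrite t0.
move=> /rc /cvgrPdist_le /(_ e e0) [d /= d0 Hd].
have [N _ HN] := near_infty_natSinv_lt (PosNum d0).
exists N => // n /HN/= nd; have [k ck ->] := E n.
have /andP[h1 h2] := nb _ _ ck.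
have rt : t < r n k by rewrite /r lt_min tT.
apply: Hd => //=; rewrite distrC ger0_norm ?subr_ge0 ?(ltW rt)// ltrBlDl.
rewrite (@le_lt_trans _ _ (t + n.+1%:R^-1))// ?ltrD2l//.
by rewrite (le_trans _ h2)// /r ge_min lexx orbT.
Qed.

End Time.

(** * Functions that are Lipschitz on the unit interval *)

Section Lipschitz.
Context {R : realType}.
Local Notation dom := (@torus_dom R).
Local Notation bd := (@bdm _ (measurableTypeR R) R dom).

Definition lip01 (Psi : R -> R) := continuous Psi /\ exists2 L, 0 <= L &
  forall a b, 0 <= a <= 1 -> 0 <= b <= 1 ->
    `|Psi a - Psi b| <= L * `|a - b| /\ `|Psi a| <= L.

Lemma lip01_cst r : lip01 (fun=> r).
Proof.
split; first exact: cst_continuous.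
by exists `|r| => // a b _ _; rewrite subrr normr0 mulr_ge0.
Qed.

Lemma lip01_id : lip01 id.
Proof.
split; first by move=> x; exact: cvg_id.
by exists 1 => // a b /andP[a0 a1] _; rewrite mul1r; split => //; rewrite ger0_norm.
Qed.

Lemma lip01D P Q : lip01 P -> lip01 Q -> lip01 (fun r => P r + Q r).
Proof.
move=> [cP [L L0 HP]] [cQ [L' L'0 HQ]]; split; first exact: continuousD2.
exists (L + L'); first exact: addr_ge0.
move=> a b ab bb; have [h1 h2] := HP a b ab bb; have [h3 h4] := HQ a b ab bb.
split; last by rewrite (le_trans (ler_normD _ _))// lerD.
rewrite opprD addrACA mulrDl (le_trans (ler_normD _ _))// lerD//.
Qed.

Lemma lip01M P Q : lip01 P -> lip01 Q -> lip01 (fun r => P r * Q r).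
Proof.
move=> [cP [L L0 HP]] [cQ [L' L'0 HQ]]; split; first exact: continuousM2.
exists (2 * L * L'); first by rewrite !mulr_ge0.
move=> a b ab bb; have [h1 h2] := HP a b ab bb; have [h3 h4] := HQ a b ab bb.
have [_ h5] := HP b a bb ab.
split; last first.
  rewrite normrM; apply: (@le_trans _ _ (L * L')); first exact: ler_pM.
  by rewrite -mulrA mulr_natl mulr2n lerDl mulr_ge0.
have -> : P a * Q a - P b * Q b = (P a - P b) * Q a + P b * (Q a - Q b) by ring.
have -> : 2 * L * L' * `|a - b| = (L * `|a - b|) * L' + L * (L' * `|a - b|) by ring.
by rewrite (le_trans (ler_normD _ _))// !normrM lerD// ler_pM.
Qed.

Lemma lip01_sum (I : Type) (r : seq I) (F : I -> R -> R) :
  (forall i, lip01 (F i)) -> lip01 (fun x => \sum_(i <- r) F i x).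
Proof.
move=> lF; elim: r => [|i r IH].
  by under eq_fun do rewrite big_nil; exact: lip01_cst.
by under eq_fun do rewrite big_cons; apply: lip01D.
Qed.

Lemma lip01_prod (I : Type) (r : seq I) (F : I -> R -> R) :
  (forall i, lip01 (F i)) -> lip01 (fun x => \prod_(i <- r) F i x).
Proof.
move=> lF; elim: r => [|i r IH].
  by under eq_fun do rewrite big_nil; exact: lip01_cst.
by under eq_fun do rewrite big_cons; apply: lip01M.
Qed.

Lemma lip01_compl : lip01 (fun r => 1 - r).
Proof.
have := lip01D (lip01_cst 1) (lip01M (lip01_cst (-1)) lip01_id).
by under eq_fun do rewrite mulN1r.
Qed.

Lemma lip01_bernoulli M (f : {ffun 'I_(M.*2.+1) -> bool} -> R) :
  lip01 (fun r => bernoulli_mean r f).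
Proof.
apply: lip01_sum => eta; apply: lip01M; last exact: lip01_cst.
by apply: lip01_prod => i; case: (eta i); [exact: lip01_id|exact: lip01_compl].
Qed.

Lemma lip01_birth M (c : {ffun 'I_(M.*2.+1) -> bool} -> R) : lip01 (birth_rate c).
Proof. exact: lip01_bernoulli. Qed.

Lemma lip01_death M (c : {ffun 'I_(M.*2.+1) -> bool} -> R) : lip01 (death_rate c).
Proof. exact: lip01_bernoulli. Qed.

Lemma lip01_chi : lip01 (@chi R).
Proof. exact: lip01M lip01_id lip01_compl. Qed.

Lemma bd_lip01 Psi r : lip01 Psi -> bd r -> (forall u, dom u -> 0 <= r u <= 1) ->
  bd (fun u => Psi (r u)).
Proof.
move=> [cP [L L0 HP]] [mr _] r01; split.
  by apply: measurableT_comp => //; exact: continuous_measurable_fun.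
by exists L => u du; have [] := HP (r u) (r u) (r01 u du) (r01 u du).
Qed.

(** Young's inequality; it lets an L1 distance be estimated by an L2 distance
    with a free parameter [e], so that square roots never appear. *)
Lemma tint_abs_le_sqr (w : R -> R) (e : R) : 0 < e -> bd w ->
  tint (fun u => `|w u|) <= e + tint (fun u => w u ^+ 2) / e.
Proof.
move=> e0 bw.
have -> : e + tint (fun u => w u ^+ 2) / e = tint (fun u => e + e^-1 * w u ^+ 2).
  rewrite tintD; [|exact: bdm_cst|by apply: bdmZ; exact: bdmX].
  by rewrite tint_cst tintZ ?[e^-1 * _]mulrC//; exact: bdmX.
apply: le_tint; first exact: bdm_norm.
  by apply: bdmD; [exact: bdm_cst|apply: bdmZ; exact: bdmX].
move=> u _; rewrite -[in leRHS]real_normK ?num_real//.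
rewrite -(ler_pM2l e0) mulrDr mulrA divff ?gt_eqF// mul1r.
by have := sqr_ge0 (e - `|w u|); have := sqr_ge0 e; nra.
Qed.

Lemma lip01_diff Psi L (r1 r2 h : R -> R) (H e : R) : lip01 Psi -> 0 <= L ->
  (forall a b, 0 <= a <= 1 -> 0 <= b <= 1 ->
    `|Psi a - Psi b| <= L * `|a - b| /\ `|Psi a| <= L) ->
  bd r1 -> bd r2 -> bd h ->
  (forall u, dom u -> 0 <= r1 u <= 1) -> (forall u, dom u -> 0 <= r2 u <= 1) ->
  (forall u, dom u -> `|h u| <= H) -> 0 < e ->
  `|tint (fun u => Psi (r1 u) * h u) - tint (fun u => Psi (r2 u) * h u)| <=
  L * H * (e + tint (fun u => (r1 u - r2 u) ^+ 2) / e).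
Proof.
move=> lP L0 HP b1 b2 bh r1P r2P hH e0.
have bP1 := bd_lip01 lP b1 r1P; have bP2 := bd_lip01 lP b2 r2P.
have H0 : 0 <= H.
  have : dom 0 by apply/domP; rewrite lexx ltr01.
  by move/hH; exact: le_trans.
rewrite -tintB; [|exact: bdmM..].
apply: (@le_trans _ _ (L * H * tint (fun u => `|r1 u - r2 u|))).
  rewrite -tintZ; last by apply/bdm_norm/bdmB.
  apply: abs_tint_le.
  - by apply: bdmB; exact: bdmM.
  - by apply: bdmZ; apply/bdm_norm/bdmB.
  move=> u du; rewrite -mulrBl normrM mulrAC ler_pM//; last exact: hH.
  by have [] := HP _ _ (r1P u du) (r2P u du).
rewrite ler_wpM2l ?mulr_ge0// tint_abs_le_sqr//; exact: bdmB.
Qed.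

End Lipschitz.

(** * The weak topology through finitely many test functions *)

Section Weak_topology.
Context {R : realType}.

Lemma finI_from_ex {I : choiceType} {T : Type} (f : I -> set T) (A : set T) :
  (exists i, f i = A) -> finI_from [set: I] f A.
Proof. by move=> [i <-]; exact: finI_from1. Qed.

Lemma entourage_test (g : torus_test) (e : R) : 0 < e ->
  entourage [set mm : Mplus R * Mplus R | `|mpair mm.1 g - mpair mm.2 g| < e].
Proof.
move=> e0.
pose E := [set ff : {ptws (@torus_test R) -> R} * {ptws (@torus_test R) -> R} |
  `|ff.1 g - ff.2 g| < e].
exists E => //.
have entE : entourage [set xy : R * R | `|xy.1 - xy.2| < e].
  by rewrite -entourage_ballE; exists e.
have entP : @entourage (initial_topology (@proj (@torus_test R) (fun=> R) g)) E.
  by exists [set xy : R * R | `|xy.1 - xy.2| < e].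
rewrite /entourage/=; exists E => //.
have pf : `[< @entourage (initial_topology (@proj (@torus_test R) (fun=> R) g)) E >].
  exact/asboolP.
by apply: finI_from_ex; exists (exist _ (g, E) pf).
Qed.

(** A weak entourage involves finitely many test functions only; along a filter,
    this finiteness becomes stability under finite intersections. *)
Lemma entourage_Mplus_near (U : set (Mplus R * Mplus R)) (I : Type)
    (F : set_system I) (Q : I -> set (Mplus R * Mplus R)) : Filter F ->
  entourage U ->
  (forall (g : torus_test) (e : R), 0 < e ->
    \forall i \near F, forall mm, Q i mm -> `|mpair mm.1 g - mpair mm.2 g| < e) ->
  \forall i \near F, Q i `<=` U.
Proof.
move=> FF entU H; move: entU; rewrite /entourage/= => -[V].
unfold entourage; simpl; move=> [A [D _ <-] AV] VU.
have K := @filter_bigI _ _ D (fun k => [set i | forall mm, Q i mm ->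
  (projT1 k).2 (torus_eval mm.1, torus_eval mm.2)]) F FF.
apply: (filterS _ (K _)) => [i Hi mm Qmm|k kD].
  by apply: VU; apply: AV => k kD; exact: (Hi k kD mm Qmm).
case: k kD => -[g E] /= /asboolP [W entW WE] _.
move: entW; rewrite -entourage_ballE => -[e /= e0 eW].
have := H g e e0; apply: filterS => i Hi mm Qmm.
by apply: WE; apply: eW; exact: Hi.
Qed.

Lemma mpair_cvg_Mplus (g : torus_test) (m : Mplus R) (F : set_system R)
    (x : R -> Mplus R) : Filter F -> x s @[s --> F] --> m ->
  mpair (x s) g @[s --> F] --> mpair m g.
Proof.
move=> FF /cvg_entourageP xm; apply/cvgrPdist_lt => e e0.
by have h := xm _ (entourage_test g e0); apply: (@filterS _ F _ _ _ _ h) => s.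
Qed.

Lemma cvg_Mplus (x : R -> Mplus R) (m : Mplus R) (F : set_system R) : Filter F ->
  (forall g : torus_test, mpair (x s) g @[s --> F] --> mpair m g) ->
  x s @[s --> F] --> m.
Proof.
move=> FF H; apply/cvg_entourageP => U entU.
have := @entourage_Mplus_near U R F (fun s => [set (m, x s)]) FF entU.
have K : forall (g : torus_test) (e : R), 0 < e ->
    \forall i \near F, forall mm : Mplus R * Mplus R, mm = (m, x i) -> `|mpair mm.1 g - mpair mm.2 g| < e.
  move=> g e e0; have /cvgrPdist_lt /(_ e e0) := H g.
  by apply: filterS => s hs _ ->.
by move=> /(_ K); apply: filterS => s; apply.
Qed.

End Weak_topology.

(** * Fourier coefficients along a trajectory *)

Section Cylinder_closure.
Context {R : realType} (T : R).
Implicit Types G H : R -> R -> R.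
Local Notation cyl := (continuous_on_cylinder T).

Lemma cylD G H : cyl G -> cyl H -> cyl (fun t u => G t u + H t u).
Proof. by move=> cG cH tu; apply: continuousD; [exact: cG|exact: cH]. Qed.

Lemma cylM G H : cyl G -> cyl H -> cyl (fun t u => G t u * H t u).
Proof. by move=> cG cH tu; apply: continuousM; [exact: cG|exact: cH]. Qed.

Lemma cyl_cst r : cyl (fun _ _ => r).
Proof. by move=> tu; exact: cst_continuous. Qed.

Lemma cylZ r G : cyl G -> cyl (fun t u => r * G t u).
Proof. by move=> cG; apply: cylM => //; exact: cyl_cst. Qed.

Lemma cyl_comp (phi : R -> R) G : continuous phi -> cyl G ->
  cyl (fun t u => phi (G t u)).
Proof.
move=> cphi cG tu; apply: (@continuous_comp _ _ _ _ phi); first exact: cG.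
exact: cphi.
Qed.

Lemma cyl_sum (I : Type) (r : seq I) (F : I -> R -> R -> R) :
  (forall i, cyl (F i)) -> cyl (fun t u => \sum_(i <- r) F i t u).
Proof.
move=> cF; elim: r => [|i r IH].
  rewrite (_ : (fun t u => _) = fun _ _ => 0); first exact: cyl_cst.
  by apply/funext => t; apply/funext => u; rewrite big_nil.
rewrite (_ : (fun t u => _) = fun t u => F i t u + \sum_(j <- r) F j t u).
  exact: cylD.
by apply/funext => t; apply/funext => u; rewrite big_cons.
Qed.

Lemma cyl_exp G : cyl G -> cyl (fun t u => expR (G t u) - 1).
Proof.
move=> cG; apply: cylD; last exact: cyl_cst.
apply: cyl_comp => //.
exact: continuous_expR.
Qed.

Lemma cylN G : cyl G -> cyl (fun t u => - G t u).
Proof. by move=> cG; apply: cyl_comp => // x; exact: continuousN. Qed.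

Lemma cylX2 G : cyl G -> cyl (fun t u => G t u ^+ 2).
Proof. by move=> cG; under eq_fun do under eq_fun do rewrite expr2; exact: cylM. Qed.

End Cylinder_closure.

Section Paths.
Context {R : realType} (T : R).
Hypothesis T0 : 0 < T.
Local Notation dom := (@torus_dom R).
Local Notation bd := (@bdm _ (measurableTypeR R) R dom).
Local Notation itv := (`[0, T]%classic : set R).
Local Notation tb := (@bdm _ (measurableTypeR R) R itv).
Local Notation cyl := (continuous_on_cylinder T).
Implicit Types (pi : cadlag (Mplus R) T).

Let T0' : 0 <= T. Proof. exact: ltW. Qed.

Definition trig_test p : @torus_test R :=
  TorusTest (@trig_continuous R p) (@trig_periodic R p).

Lemma measurable_mpair pi (g : torus_test) :
  measurable_fun itv (fun t => mpair (pi t) g).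
Proof.
apply: measurable_right_continuous => // t tT.
by apply: mpair_cvg_Mplus; exact: traj_right_continuous.
Qed.

(** The Fourier coefficients along a trajectory, defined by the pairing so that
    they make sense and are regular in time for every trajectory. *)
Definition xc pi p t := mpair (pi t) (@trig R p).

Lemma abs_xc_le pi p t : `|xc pi p t| <= 2.
Proof.
by apply: abs_mpair_le => // [|u _]; [exact: bd_trig|exact: trig_le2].
Qed.

Lemma tb_xc pi p : tb (xc pi p).
Proof.
split; last by exists 2 => t _; exact: abs_xc_le.
exact: (measurable_mpair pi (trig_test p)).
Qed.

Lemma coef_dens pi p t : D1 pi -> 0 <= t <= T ->
  coef (dens (pi t)) p = xc pi p t.
Proof.
by move=> pD tT; rewrite /xc mpairE//; [exact: pD|exact: trig_continuous].
Qed.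

Section Nonlinear.
Variables (pi : cadlag (Mplus R) T) (pD : D1 pi).

Lemma bd_densD t : 0 <= t <= T -> bd (dens (pi t)).
Proof. by move=> tT; apply: bd_dens; exact: pD. Qed.

Lemma fejer_dens01 N t u : 0 <= t <= T -> 0 <= fejer N.+1 (dens (pi t)) u <= 1.
Proof.
move=> tT; have bt := bd_densD tT; apply/andP; split.
  by apply: fejer_ge => // v _; have /andP[] := dens01 (pi t) v.
by apply: fejer_le => // v _; have /andP[] := dens01 (pi t) v.
Qed.

(** A nonlinear function of the density is not a function of pairings. Its Fejer
    means are, and they converge in L2 at each time, so the integral is a limit
    of functions measurable in time. *)
Lemma measurable_lip01 Psi (h : R -> R -> R) : lip01 Psi -> cyl h ->
  measurable_fun itv (fun t => tint (fun u => Psi (dens (pi t) u) * h t u)).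
Proof.
move=> lP ch; have [cP [L L0 HP]] := lP.
have [H H0 HH] := cylinder_bounded 0 1 T0' ch.
apply: (measurable_fun_cvg (h := fun N t =>
  tint (fun u => Psi (fejer N.+1 (dens (pi t)) u) * h t u))).
  move=> N; apply: measurable_tint_param => [u _|t tT].
    apply: measurable_funM; last exact: cylinder_meas_time.
    apply: (@measurableT_comp _ _ _ _ _ _ Psi).
      exact: continuous_measurable_fun.
    apply: (@eq_measurable_fun _ _ _ _ _
      (fun t => \sum_(p <- idx N.+1) wt N.+1 p * xc pi p t * trig p u)).
      move=> t; rewrite inE => /itvP0 tT; rewrite /fejer /trigpoly.
      by apply: eq_bigr => p _; rewrite coef_dens.
    apply: measurable_sum => p; apply: measurable_funM => //.
    by apply: measurable_funM => //; have [] := tb_xc pi p.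
  apply: continuousM2; last exact: cylinder_cont_space ch.
  move=> u; apply: (@continuous_comp _ _ _ _ Psi); last exact: cP.
  exact: continuous_trigpoly.
move=> t /itvP0 tT; apply/cvgrPdist_le => e e0.
have bt := bd_densD tT.
pose K := L * H + 1; have K0 : 0 < K by rewrite ltr_wpDl ?mulr_ge0.
pose eta := e / (2 * K); have eta0 : 0 < eta by rewrite divr_gt0 ?mulr_gt0.
have cL2 : tint (fun u => (dens (pi t) u - fejer N (dens (pi t)) u) ^+ 2) @[N --> \oo] --> 0.
  by apply: fejer_cvg_L2 => // u _; have /andP[? ?] := dens01 (pi t) u; rewrite ger0_norm.
have /cvgrPdist_le /(_ (eta ^+ 2)) := cL2.
rewrite exprn_gt0// => /(_ isT) [N0 _ HN]; exists N0 => // N /= NN.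
have := HN N.+1 (leqW NN); rewrite /= sub0r normrN.
set s := tint _ => hs.
apply: (@le_trans _ _ (L * H * (eta + s / eta))).
  apply: lip01_diff => //.
  - exact: bd_fejer.
  - by apply: continuous_bd; exact: cylinder_cont_space ch.
  - by move=> u _; exact: dens01.
  - by move=> u _; exact: fejer_dens01.
  - by move=> u /domP/andP[u0 u1]; apply: HH => //; rewrite u0 ltW.
have s1 : s / eta <= eta.
  by rewrite ler_pdivrMr// -expr2 (le_trans _ hs)// ler_norm.
apply: (@le_trans _ _ (K * (eta + eta))).
  rewrite ler_pM// ?mulr_ge0 ?lerD//.
    have s0 : 0 <= s by apply: tint_ge0 => u _; exact: sqr_ge0.
    by rewrite addr_ge0 ?(ltW eta0)// divr_ge0// ltW.
  by rewrite lerDl.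
have -> // : K * (eta + eta) = e by rewrite /eta; field; rewrite gt_eqF.
Qed.

Lemma tb_lip01 Psi (h : R -> R -> R) : lip01 Psi -> cyl h ->
  tb (fun t => tint (fun u => Psi (dens (pi t) u) * h t u)).
Proof.
move=> lP ch; split; first exact: measurable_lip01.
have [cP [L L0 HP]] := lP.
have [H H0 HH] := cylinder_bounded 0 1 T0' ch.
exists (L * H) => t /itvP0 tT; apply: abs_tint_le_cst.
  apply: bdmM; last by apply: continuous_bd; exact: cylinder_cont_space ch.
  by apply: bd_lip01 => //; [exact: bd_densD|move=> u _; exact: dens01].
move=> u /domP/andP[u0 u1]; rewrite normrM ler_pM//; last first.
  by apply: HH => //; rewrite u0 ltW.
by have [] := HP _ _ (dens01 (pi t) u) (dens01 (pi t) u).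
Qed.

Lemma tb_lin (h : R -> R -> R) : cyl h ->
  tb (fun t => tint (fun u => dens (pi t) u * h t u)).
Proof. exact: tb_lip01 lip01_id. Qed.

End Nonlinear.

Section J_formula.
Context (M : nat) (c : {ffun 'I_(M.*2.+1) -> bool} -> R) (gamma : R -> R).

Lemma J_D1E G pi : D1 pi -> C12 T G ->
  J_D1 c gamma G pi = mpair (pi T) (G T) - fpair gamma (G 0)
  - time_int T (fun t => tint (fun u => dens (pi t) u * (dt T G t u + 2^-1 * dxx G t u)))
  - 2^-1 * time_int T (fun t => tint (fun u => chi (dens (pi t) u) * dx G t u ^+ 2))
  - (time_int T (fun t => tint (fun u => birth_rate c (dens (pi t) u) * (expR (G t u) - 1)))
   + time_int T (fun t => tint (fun u => death_rate c (dens (pi t) u) * (expR (- G t u) - 1)))).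
Proof.
move=> pD [[pG dG cG cdx] ddG dtG cdxx cdt]; rewrite /J_D1.
have cs (h : R -> R -> R) t : cyl h -> 0 <= t <= T -> continuous (h t).
  by move=> ch tT; exact: cylinder_cont_space ch.
have B1 := tb_lip01 pD (lip01_birth c) (cyl_exp cG).
have B2 := tb_lip01 pD (lip01_death c) (cyl_exp (cylN cG)).
rewrite -(timeD T0 B1 B2).
have E1 : time_int T (fun t => mpair (pi t) (fun u => dt T G t u + 2^-1 * dxx G t u)) =
    time_int T (fun t => tint (fun u => dens (pi t) u * (dt T G t u + 2^-1 * dxx G t u))).
  apply: eq_time => t tT; rewrite mpairE//; first exact: pD.
  apply: (cs (fun t u => dt T G t u + 2^-1 * dxx G t u)) => //.
  by apply: cylD => //; exact: cylZ.
have E2 : time_int T (fun t => fpair (fun u => chi (density (pi t) u))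
      (fun u => dx G t u ^+ 2)) =
    time_int T (fun t => tint (fun u => chi (dens (pi t) u) * dx G t u ^+ 2)).
  apply: eq_time => t tT; apply: fpair_density; first exact: pD.
    by have [] := @lip01_chi R.
  by apply: continuous_bd; apply: (cs (fun t u => dx G t u ^+ 2)) => //; exact: cylX2.
have E3 : time_int T (fun t =>
      fpair (fun u => birth_rate c (density (pi t) u)) (fun u => expR (G t u) - 1)
      + fpair (fun u => death_rate c (density (pi t) u)) (fun u => expR (- G t u) - 1)) =
    time_int T (fun t => tint (fun u => birth_rate c (dens (pi t) u) * (expR (G t u) - 1))
      + tint (fun u => death_rate c (dens (pi t) u) * (expR (- G t u) - 1))).
  apply: eq_time => t tT; congr (_ + _); apply: fpair_density; try exact: pD.
  + by have [] := lip01_birth c.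
  + apply: continuous_bd; apply: (cs (fun t u => expR (G t u) - 1)) => //.
    exact: cyl_exp.
  + by have [] := lip01_death c.
  + apply: continuous_bd; apply: (cs (fun t u => expR (- G t u) - 1)) => //.
    by apply: cyl_exp; exact: cylN.
by rewrite E1 E2 E3.
Qed.

End J_formula.

End Paths.

(** * Strong compactness from the Fourier energy *)

Section Energy.
Context {R : realType} (T : R).
Hypothesis T0 : 0 < T.
Local Notation dom := (@torus_dom R).
Local Notation bd := (@bdm _ (measurableTypeR R) R dom).
Local Notation itv := (`[0, T]%classic : set R).
Local Notation tb := (@bdm _ (measurableTypeR R) R itv).
Local Notation cyl := (continuous_on_cylinder T).
Implicit Types (pi : cadlag (Mplus R) T).

Let T0' : 0 <= T. Proof. exact: ltW. Qed.

(** The squared L2 norm of the space derivative, computed on the Fejer mean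
    through Fourier coefficients. Unlike the energy it is a finite sum of
    continuous functions of pairings. *)
Definition fenergy_density pi N t : R :=
  \sum_(p <- idx N) wt N p * freq p.2 ^+ 2 * xc pi p t ^+ 2.

Definition fenergy pi N : R := time_int T (fenergy_density pi N).

Lemma tb_fenergy_density pi N : tb (fenergy_density pi N).
Proof. by apply: bdm_sum => p _; apply: bdmZ; apply: bdmX; exact: tb_xc. Qed.

Lemma sum_idx_lt N L : \sum_(p <- idx N) ((p.2 < L)%N%:R : R) <= 2 * L%:R.
Proof.
rewrite sum_idx.
elim: N => [|N IH]; first by rewrite big_ord0 mulr_ge0.
have H n : \sum_(k < n) ((k < L)%N%:R + (k < L)%N%:R : R) = 2 * (minn n L)%:R.
  elim: n => [|n IHn]; first by rewrite big_ord0 min0n mulr0.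
  rewrite big_ord_recr/= IHn; case: (ltnP n L) => nL.
    rewrite (minn_idPl nL) -natr1 -[true%:R]/(1 : R); ring.
  by rewrite (minn_idPr (leqW nL)) -[false%:R]/(0 : R) !addr0.
by rewrite H ler_pM2l// ler_nat geq_minr.
Qed.

Section Compare.
Variables (pi pi' : cadlag (Mplus R) T).
Hypotheses (pD : D1 pi) (pD' : D1 pi').

Let w t u := dens (pi t) u - dens (pi' t) u.

Lemma bd_densB t : 0 <= t <= T -> bd (fun u => dens (pi t) u - dens (pi' t) u).
Proof. by move=> tT; apply: bdmB; exact: bd_densD. Qed.

Lemma densB_le1 t u : `|dens (pi t) u - dens (pi' t) u| <= 1.
Proof.
have /andP[a b] := dens01 (pi t) u; have /andP[a' b'] := dens01 (pi' t) u.
by rewrite ler_norml; apply/andP; split; lra.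
Qed.

Let vw N t := \sum_(p <- idx N) wt N p * (xc pi p t - xc pi' p t) ^+ 2.

Let vwE N t : 0 <= t <= T -> vfejer N (w t) = vw N t.
Proof.
move=> tT; apply: eq_bigr => p _.
by rewrite coefB ?coef_dens//; exact: bd_densD.
Qed.

Let tb_vw N : tb (vw N).
Proof.
by apply: bdm_sum => p _; apply: bdmZ; apply: bdmX; apply: bdmB; exact: tb_xc.
Qed.

Let cvg_vw t : 0 <= t <= T -> vw N t @[N --> \oo] --> tint (fun u => w t u ^+ 2).
Proof.
move=> tT; have := @parseval _ (w t) (bd_densB tT) (fun u _ => densB_le1 t u).
by under eq_cvg do rewrite vwE//.
Qed.

Lemma tb_L2dist : tb (fun t => tint (fun u => (dens (pi t) u - dens (pi' t) u) ^+ 2)).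
Proof.
split.
  apply: (measurable_fun_cvg (h := vw)); first by move=> N; have [] := tb_vw N.
  by move=> t /itvP0; exact: cvg_vw.
exists 1 => t /itvP0 tT; apply: abs_tint_le_cst.
  by apply: bdmX; exact: bd_densB.
by move=> u _; rewrite normrX exprn_ile1// densB_le1.
Qed.

(** High frequencies are small by the energy, low ones by hypothesis. *)
Lemma L2dist_le (C eta : R) (L : nat) : (0 < L)%N -> 0 <= eta ->
  (forall N, fenergy pi N.+1 <= C) -> (forall N, fenergy pi' N.+1 <= C) ->
  (forall p t, (p.2 < L)%N -> 0 <= t <= T -> `|xc pi p t - xc pi' p t| <= eta) ->
  time_int T (fun t => tint (fun u => (dens (pi t) u - dens (pi' t) u) ^+ 2)) <=
    2 * L%:R * eta ^+ 2 * T + 4 * C / freq L ^+ 2.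
Proof.
move=> L0 eta0 HC HC' Heta.
have fL : 0 < freq L ^+ 2 :> R.
  rewrite exprn_gt0// lt_def freq_ge0 andbT -freq0; apply/eqP => /freq_inj.
  by move=> E; rewrite E in L0.
have c : time_int T (vw N.+1) @[N --> \oo] -->
    time_int T (fun t => tint (fun u => w t u ^+ 2)).
  apply: (@cvg_time _ T T0 (fun N => vw N.+1) _ 1).
  - by move=> N; have [] := tb_vw N.+1.
  - move=> N t tT; rewrite -vwE// ger0_norm ?vfejer_ge0//.
    apply: vfejer_le1 => //; first exact: bd_densB.
    by move=> u _; exact: densB_le1.
  - by move=> t tT; have := cvg_vw tT; rewrite -(cvg_shiftS (vw ^~ t)).
rewrite -(cvg_lim _ c)//; apply: limr_le; first by apply/cvg_ex; eexists; exact: c.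
apply: nearW => N; set n := N.+1.
have P t : 0 <= t <= T -> vw n t <= 2 * L%:R * eta ^+ 2 +
    2 / freq L ^+ 2 * (fenergy_density pi n t + fenergy_density pi' n t).
  move=> tT.
  have -> : fenergy_density pi n t + fenergy_density pi' n t =
     \sum_(p <- idx n) wt n p * freq p.2 ^+ 2 * (xc pi p t ^+ 2 + xc pi' p t ^+ 2).
    by rewrite -big_split/=; apply: eq_bigr => p _; ring.
  apply: (@le_trans _ _ (\sum_(p <- idx n) ((p.2 < L)%N%:R * eta ^+ 2 +
     2 / freq L ^+ 2 * (wt n p * freq p.2 ^+ 2 * (xc pi p t ^+ 2 + xc pi' p t ^+ 2))))).
    rewrite /vw big_seq [leRHS]big_seq; apply: ler_sum => p pn.
    have /andP[w0 w1] := @wt01 R _ _ pn.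
    have s0 : 0 <= xc pi p t ^+ 2 + xc pi' p t ^+ 2 by rewrite addr_ge0 ?sqr_ge0.
    case: (ltnP p.2 L) => pL.
      rewrite mul1r -[leLHS]addr0 lerD//.
        rewrite -[leRHS]mul1r ler_pM ?sqr_ge0//.
        rewrite -[leLHS]real_normK ?num_real// lerXn2r ?nnegrE//.
        exact: Heta.
      by rewrite mulr_ge0 ?divr_ge0 ?(ltW fL)// mulr_ge0// mulr_ge0// sqr_ge0.
    rewrite mul0r add0r.
    have h1 : (xc pi p t - xc pi' p t) ^+ 2 <= 2 * (xc pi p t ^+ 2 + xc pi' p t ^+ 2).
      have := sqr_ge0 (xc pi p t + xc pi' p t); nra.
    (* This ratio trades a high frequency for the energy weight. *)
    have h2 : 1 <= freq p.2 ^+ 2 / freq L ^+ 2 :> R.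
      rewrite ler_pdivlMr// mul1r lerXn2r ?nnegrE ?freq_ge0//.
      by rewrite /freq ler_wpM2l ?ler_nat// mulrn_wge0 ?pi_ge0.
    apply: (@le_trans _ _ (wt n p * (2 * (xc pi p t ^+ 2 + xc pi' p t ^+ 2)))).
      by rewrite ler_wpM2l.
    have -> : 2 / freq L ^+ 2 * (wt n p * freq p.2 ^+ 2 * (xc pi p t ^+ 2 + xc pi' p t ^+ 2)) =
       wt n p * (2 * (xc pi p t ^+ 2 + xc pi' p t ^+ 2)) * (freq p.2 ^+ 2 / freq L ^+ 2) by ring.
    by rewrite ler_peMr// mulr_ge0// mulr_ge0.
  rewrite big_split/= -mulr_suml -mulr_sumr lerD2r ler_wpM2r ?sqr_ge0//.
  exact: sum_idx_lt.
have b1 := tb_fenergy_density pi n; have b2 := tb_fenergy_density pi' n.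
have b3 : tb (fun t => 2 / freq L ^+ 2 * (fenergy_density pi n t + fenergy_density pi' n t)).
  by apply: bdmZ; exact: bdmD.
have b4 : tb (fun=> 2 * L%:R * eta ^+ 2) by exact: bdm_cst.
apply: (le_trans (le_time T0 (tb_vw n) (bdmD b4 b3) P)).
rewrite (timeD T0 b4 b3) (time_cst T0) (timeZ T0 _ (bdmD b1 b2)) (timeD T0 b1 b2).
rewrite lerD2l.
have -> : 4 * C / freq L ^+ 2 = 2 / freq L ^+ 2 * (C + C) by ring.
rewrite ler_wpM2l ?divr_ge0 ?(ltW fL)//.
by apply: lerD; [exact: HC|exact: HC'].
Qed.

Lemma lip01_time_diff Psi (h : R -> R -> R) L H (e : R) : lip01 Psi -> cyl h ->
  0 <= L -> (forall a b, 0 <= a <= 1 -> 0 <= b <= 1 ->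
    `|Psi a - Psi b| <= L * `|a - b| /\ `|Psi a| <= L) ->
  (forall t u, 0 <= t <= T -> 0 <= u <= 1 -> `|h t u| <= H) -> 0 < e ->
  `|time_int T (fun t => tint (fun u => Psi (dens (pi t) u) * h t u)) -
    time_int T (fun t => tint (fun u => Psi (dens (pi' t) u) * h t u))| <=
  L * H * (e * T + time_int T (fun t => tint (fun u =>
     (dens (pi t) u - dens (pi' t) u) ^+ 2)) / e).
Proof.
move=> lP ch L0 HP HH e0.
have b1 := tb_lip01 T0 pD lP ch; have b2 := tb_lip01 T0 pD' lP ch.
have bS := tb_L2dist.
rewrite -(timeB T0 b1 b2).
have -> : L * H * (e * T + time_int T (fun t => tint (fun u =>
     (dens (pi t) u - dens (pi' t) u) ^+ 2)) / e) =
   time_int T (fun t => L * H * (e + e^-1 * tint (fun u =>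
     (dens (pi t) u - dens (pi' t) u) ^+ 2))).
  have b3 := bdmZ e^-1 bS; have b4 : tb (fun=> e) by exact: bdm_cst.
  rewrite (timeZ T0 _ (bdmD b4 b3)) (timeD T0 b4 b3) (time_cst T0) (timeZ T0 _ bS).
  by rewrite [e^-1 * _]mulrC.
apply: (abs_time_le T0 (bdmB b1 b2)).
  by apply: bdmZ; apply: bdmD; [exact: bdm_cst|exact: bdmZ].
move=> t tT; rewrite [e^-1 * _]mulrC; apply: lip01_diff => //.
- exact: bd_densD.
- exact: bd_densD.
- by apply: continuous_bd; exact: cylinder_cont_space ch.
- by move=> u _; exact: dens01.
- by move=> u _; exact: dens01.
- by move=> u /domP/andP[u0 u1]; apply: HH => //; rewrite u0 ltW.
Qed.

End Compare.

Lemma lip01_time_cont Psi (h : R -> R -> R) : lip01 Psi -> cyl h ->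
  exists2 K, 0 <= K & forall pi pi' (e : R), D1 pi -> D1 pi' -> 0 < e ->
  `|time_int T (fun t => tint (fun u => Psi (dens (pi t) u) * h t u)) -
    time_int T (fun t => tint (fun u => Psi (dens (pi' t) u) * h t u))| <=
  K * (e * T + time_int T (fun t => tint (fun u =>
     (dens (pi t) u - dens (pi' t) u) ^+ 2)) / e).
Proof.
move=> lP ch; have [cP [L L0 HP]] := lP.
have [H H0 HH] := cylinder_bounded 0 1 T0' ch.
exists (L * H); first exact: mulr_ge0.
by move=> pi pi' e pD pD' e0; exact: lip01_time_diff.
Qed.

Let J_combine (m m' g0 a1 b1 a2 b2 a3 b3 a4 b4 K1 K2 K3 K4 D : R) :
  `|a1 - b1| <= K1 * D -> `|a2 - b2| <= K2 * D -> `|a3 - b3| <= K3 * D ->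
  `|a4 - b4| <= K4 * D ->
  `|m - g0 - a1 - 2^-1 * a2 - (a3 + a4) - (m' - g0 - b1 - 2^-1 * b2 - (b3 + b4))|
    <= `|m - m'| + (K1 + K2 + K3 + K4) * D.
Proof.
move=> H1 H2 H3 H4.
have -> : m - g0 - a1 - 2^-1 * a2 - (a3 + a4) - (m' - g0 - b1 - 2^-1 * b2 - (b3 + b4)) =
  (m - m') - (a1 - b1) - 2^-1 * (a2 - b2) - (a3 - b3) - (a4 - b4) by ring.
have H2' : `|2^-1 * (a2 - b2)| <= K2 * D.
  by rewrite normrM ger0_norm ?invr_ge0//; have := normr_ge0 (a2 - b2); lra.
rewrite !mulrDl.
have := ler_normB (m - m' - (a1 - b1) - 2^-1 * (a2 - b2) - (a3 - b3)) (a4 - b4).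
have := ler_normB (m - m' - (a1 - b1) - 2^-1 * (a2 - b2)) (a3 - b3).
have := ler_normB (m - m' - (a1 - b1)) (2^-1 * (a2 - b2)).
have := ler_normB (m - m') (a1 - b1).
lra.
Qed.

(** The linear term is the only one that sees the final time; the others are
    integrals of Lipschitz functions of the density. *)
Lemma J_D1_cont M (c : {ffun 'I_(M.*2.+1) -> bool} -> R) (gamma : R -> R) G :
  C12 T G -> exists2 K, 0 <= K & forall pi pi' (e : R), D1 pi -> D1 pi' -> 0 < e ->
  `|J_D1 c gamma G pi - J_D1 c gamma G pi'| <=
    `|mpair (pi T) (G T) - mpair (pi' T) (G T)| +
    K * (e * T + time_int T (fun t => tint (fun u =>
     (dens (pi t) u - dens (pi' t) u) ^+ 2)) / e).
Proof.
move=> GC; have [[pG dG cG cdx] ddG dtG cdxx cdt] := GC.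
have c1 : cyl (fun t u => dt T G t u + 2^-1 * dxx G t u).
  by apply: cylD => //; exact: cylZ.
have [K1 K10 H1] := lip01_time_cont lip01_id c1.
have [K2 K20 H2] := lip01_time_cont lip01_chi (cylX2 cdx).
have [K3 K30 H3] := lip01_time_cont (lip01_birth c) (cyl_exp cG).
have [K4 K40 H4] := lip01_time_cont (lip01_death c) (cyl_exp (cylN cG)).
exists (K1 + K2 + K3 + K4); first by rewrite !addr_ge0.
move=> pi pi' e pD pD' e0; rewrite (J_D1E T0 c gamma pD GC) (J_D1E T0 c gamma pD' GC).
exact: J_combine (H1 pi pi' e pD pD' e0) (H2 pi pi' e pD pD' e0)
  (H3 pi pi' e pD pD' e0) (H4 pi pi' e pD pD' e0).
Qed.

Lemma periodic1_derive1 (f : R -> R) : periodic1 f -> periodic1 (derive1 f).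
Proof.
move=> pf u; rewrite /derive1.
rewrite (_ : (fun h => _) = fun h => h^-1 *: (f (h + u) - f u))//.
by apply/funext => h /=; rewrite addrA !pf.
Qed.

Lemma derivable_is_derive1 (f : R -> R) (x : R) : derivable f x 1 ->
  is_derive x 1 f (derive1 f x).
Proof. by move=> df; rewrite derive1E; apply: DeriveDef. Qed.

Let mul01_le (a b e : R) : 0 <= a <= 1 -> `|b| <= e -> a * b <= e.
Proof.
move=> /andP[a0 a1] be; rewrite (le_trans (ler_norm _))// normrM ger0_norm//.
by rewrite (le_trans _ be)// ler_piMl.
Qed.

Let energy_arith (q1 q2 q3 e E : R) : q1 - q2 <= e -> 2 * q2 <= E + q3 ->
  2 * q1 <= 2 * e + (E + q3).
Proof. lra. Qed.

Let energy_arith_end (q1 q2 e E C : R) : 2 * q1 <= e + (E + q2) -> E <= C ->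
  2 * q1 - q2 <= C + e.
Proof. lra. Qed.

Let weighted_young (v s x g : R) : 0 <= v -> v <= 1 ->
  2 * (v * (- (s * g)) * x) <= v * s ^+ 2 * x ^+ 2 + g ^+ 2.
Proof.
move=> v0 v1; rewrite -subr_ge0.
have -> : v * s ^+ 2 * x ^+ 2 + g ^+ 2 - 2 * (v * (- (s * g)) * x) =
  v * (s * x + g) ^+ 2 + (1 - v) * g ^+ 2 by ring.
by rewrite addr_ge0// mulr_ge0 ?sqr_ge0// subr_ge0.
Qed.

(** Bessel's inequality for G against the Fourier energy of the trajectory. *)
Lemma energy_le pi (C : R) : D1 pi -> (forall N, fenergy pi N.+1 <= C) ->
  (energy pi <= C%:E)%E.
Proof.
move=> pD HC; apply: ge_ereal_sup => _ [G [pG dG cG cdx] <-]; rewrite lee_fin.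
have E1 : time_int T (fun t => fpair (density (pi t)) (dx G t)) =
    time_int T (fun t => tint (fun u => dens (pi t) u * dx G t u)).
  apply: eq_time => t tT; apply: (@fpair_density _ _ id); first exact: pD.
    by move=> x; exact: cvg_id.
  by apply: continuous_bd; exact: cylinder_cont_space cdx.
have E2 : time_int T (fun t => fpair (G t) (G t)) =
    time_int T (fun t => tint (fun u => 1 * G t u ^+ 2)).
  by apply: eq_time => t tT; apply: eq_tint => u _; rewrite mul1r expr2.
rewrite E1 E2.
have b1 := tb_lin T0 pD cdx.
have b2 := tb_lip01 T0 pD (lip01_cst 1) (cylX2 cG).
apply/ler_addgt0Pr => e e0.
pose e' := e / (2 * T); have e'0 : 0 < e' by rewrite divr_gt0// mulr_gt0.
have pdx t : 0 <= t <= T -> periodic1 (dx G t).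
  by move=> tT; apply: periodic1_derive1; apply: pG; rewrite in_itv.
have [N0 _ HN] := fejer_unif T0' pdx cdx e'0.
have {}HN := HN N0.+1 (leqnSn N0).
set n := N0.+1 in HN.
have b3 := tb_fenergy_density pi n.
have key t : 0 <= t <= T -> 2 * tint (fun u => dens (pi t) u * dx G t u) <=
    2 * e' + (fenergy_density pi n t + tint (fun u => 1 * G t u ^+ 2)).
  move=> tT; have bt := bd_densD pD tT.
  have cGt : continuous (G t) by exact: cylinder_cont_space cG.
  have cdt : continuous (dx G t) by exact: cylinder_cont_space cdx.
  have bG := continuous_bd cGt; have bdx := continuous_bd cdt.
  have h1 : tint (fun u => dens (pi t) u * dx G t u)
      - tint (fun u => dens (pi t) u * fejer n (dx G t) u) <= e'.
    have ba := bdmM bt bdx; have bb := bdmM bt (bd_fejer n (dx G t)).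
    rewrite -(tintB ba bb); apply: (tint_le_cst (bdmB ba bb)).
    move=> u du; rewrite -mulrBr.
    exact: mul01_le (dens01 (pi t) u) (HN t u tT du).
  have h2 : 2 * tint (fun u => dens (pi t) u * fejer n (dx G t) u) <=
      fenergy_density pi n t + tint (fun u => G t u ^+ 2).
    rewrite (tint_trigpoly _ _ bt) mulr_sumr.
    apply: (@le_trans _ _ (\sum_(p <- idx n) (wt n p * freq p.2 ^+ 2 * xc pi p t ^+ 2
       + coef (G t) (flip p) ^+ 2))).
      rewrite big_seq [leRHS]big_seq; apply: ler_sum => p pn.
      have /andP[w0 w1] := @wt01 R _ _ pn.
      have dGt (x : R) : is_derive x 1 (G t) (dx G t x).
        by apply: derivable_is_derive1; apply: dG; rewrite in_itv.
      have G01 : G t 1 = G t 0.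
        by rewrite -[1]add0r pG// in_itv.
      rewrite (coef_derive p dGt cdt G01) (coef_dens p pD tT) -sfreq_sqr.
      exact: weighted_young.
    rewrite big_split/= lerD2l.
    apply: le_trans (bessel n bG).
    by rewrite !sum_idx; apply: ler_sum => k _; rewrite addrC.
  have -> : tint (fun u => 1 * G t u ^+ 2) = tint (fun u => G t u ^+ 2).
    by apply: eq_tint => u _; rewrite mul1r.
  exact: energy_arith h1 h2.
have b4 : tb (fun=> 2 * e') by exact: bdm_cst.
have := le_time T0 (bdmZ 2 b1) (bdmD b4 (bdmD b3 b2)) key.
rewrite (timeZ T0 _ b1) (timeD T0 b4 (bdmD b3 b2)) (timeD T0 b3 b2) (time_cst T0).
have -> : 2 * e' * T = e by rewrite /e'; field; rewrite gt_eqF.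
by move/energy_arith_end; apply; exact: HC.
Qed.

End Energy.

(** * Separable test functions *)

Section Local_FTC.
Context {R : realType}.
Local Notation mu := (@lebesgue_measure R).
Implicit Types F f : R -> R.

(** The base point -1 leaves room to differentiate at time 0 from both sides. *)
Definition primitive f (t : R) : R := \int[mu]_(x in `[-1, t]) f x.

Lemma is_derive_primitive f (t : R) : continuous f -> -1 < t ->
  is_derive t 1 (primitive f) (f t).
Proof.
move=> cf t1.
have [] := @continuous_FTC1_closed _ f (-1) t (t + 1) _ _ t1 (cf t).
- by rewrite ltrDl.
- apply: continuous_compact_integrable; first exact: segment_compact.
  exact: continuous_subspaceT.
by move=> df E; rewrite -E derive1E; apply: DeriveDef.
Qed.

Lemma is_derive_bigsum (I : Type) (s : seq I) (F : I -> R -> R) (D : I -> R) (x : R) :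
  (forall i, is_derive x 1 (F i) (D i)) ->
  is_derive x 1 (fun x => \sum_(i <- s) F i x) (\sum_(i <- s) D i).
Proof.
move=> dF; elim: s => [|i s IH].
  rewrite big_nil (_ : (fun x => _) = cst 0); first exact: is_derive_cst.
  by apply/funext => y; rewrite big_nil.
rewrite big_cons (_ : (fun x => _) = F i \+ (fun x => \sum_(i <- s) F i x)).
  exact: is_deriveD.
by apply/funext => y; rewrite big_cons.
Qed.

(** At each time of the closed interval there are other times of the interval
    arbitrarily close, so the one-sided limits defining the time derivative at
    the end points are unique. *)
Lemma within_itv_proper (T t : R) : 0 < T -> 0 <= t <= T ->
  ProperFilter (within (`[0, T]%classic : set R) t^').
Proof.
move=> T0 /andP[t0 tT].
apply: Build_ProperFilter_ex => A; rewrite /within/= => /nbhs_ballP[e /= e0 H].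
have [tlt|teq] := ltP t T.
  pose s := Num.min (t + e / 2) T.
  have ts : t < s by rewrite lt_min tlt andbT ltrDl divr_gt0.
  exists s; apply: H.
  - rewrite /ball/= distrC ger0_norm ?subr_ge0 ?(ltW ts)// ltrBlDl.
    by rewrite (@le_lt_trans _ _ (t + e / 2)) ?ge_min ?lexx// ltrD2l ltr_pdivrMr// ltr_pMr// ltr1n.
  - by rewrite gt_eqF.
  - by rewrite in_itv/= (le_trans t0 (ltW ts))/= ge_min lexx orbT.
have {}tT : t = T by apply/eqP; rewrite eq_le tT.
pose s := Num.max (t - e / 2) 0.
have st : s < t by rewrite gt_max tT T0 andbT ltrBlDr ltrDl divr_gt0.
exists s; apply: H.
- rewrite /ball/= ger0_norm ?subr_ge0 ?(ltW st)// ltrBlDr -ltrBlDl.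
  by rewrite (@lt_le_trans _ _ (t - e / 2)) ?le_max ?lexx// ltrD2l ltrN2 ltr_pdivrMr// ltr_pMr// ltr1n.
- by rewrite lt_eqF.
- by rewrite in_itv/= le_max lexx orbT/= -tT ltW.
Qed.

Lemma dt_quotient_cvg (T t u D : R) (G : R -> R -> R) :
  is_derive t 1 (G ^~ u) D ->
  dt_quotient G t u s @[s --> within (`[0, T]%classic : set R) t^'] --> D.
Proof.
move=> dG.
have c : (fun h : R => h^-1 *: (G (h + t) u - G t u)) @ 0^' --> D.
  have E := is_derive1_val dG; rewrite -E.
  have [df _] := dG; move: df; rewrite /derivable.
  rewrite (_ : (fun h => _) = fun h : R => h^-1 *: (G (h + t) u - G t u))//.
  by apply/funext => h; rewrite /GRing.scale/= mulr1.
apply/cvgrPdist_lt => e e0.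
have /cvgrPdist_lt /(_ e e0) := c.
move=> /nbhs_ballP[d /= d0 Hd].
apply/nbhs_ballP; exists d => //= s ts st _.
have := Hd (s - t); rewrite /ball/= sub0r normrN distrC => /(_ ts).
rewrite subr_eq0 => /(_ st); rewrite subrK /dt_quotient /GRing.scale/=.
by rewrite [(s - t)^-1 * _]mulrC.
Qed.

Lemma dt_val (T t u D : R) (G : R -> R -> R) : 0 < T -> 0 <= t <= T ->
  is_derive t 1 (G ^~ u) D -> dt T G t u = D.
Proof.
move=> T0 tT dG; have P := within_itv_proper T0 tT.
exact/cvg_lim/dt_quotient_cvg.
Qed.

End Local_FTC.

Section Separable.
Context {R : realType} (T : R).
Hypothesis T0 : 0 < T.
Local Notation cyl := (continuous_on_cylinder T).
Context {I : Type} (s : seq I).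
Variables (psi dpsi h dh ddh : I -> R -> R).
Hypothesis dpsiP : forall i t, 0 <= t <= T -> is_derive t 1 (psi i) (dpsi i t).
Hypothesis cdpsi : forall i t, 0 <= t <= T -> {for t, continuous (dpsi i)}.
Hypothesis dhP : forall i (u : R), is_derive u 1 (h i) (dh i u).
Hypothesis ddhP : forall i (u : R), is_derive u 1 (dh i) (ddh i u).
Hypothesis cddh : forall i, continuous (ddh i).
Hypothesis ph : forall i, periodic1 (h i).

Definition sepf t u := \sum_(i <- s) psi i t * h i u.

Lemma dx_sepf t u : dx sepf t u = \sum_(i <- s) psi i t * dh i u.
Proof.
apply: is_derive1_val; apply: is_derive_bigsum => i.
Qed.

Lemma dxx_sepf t u : dxx sepf t u = \sum_(i <- s) psi i t * ddh i u.
Proof.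
rewrite /dxx (_ : derive1 (sepf t) = fun u => \sum_(i <- s) psi i t * dh i u).
  apply: is_derive1_val; apply: is_derive_bigsum => i.
by apply/funext => v; exact: dx_sepf.
Qed.

Lemma is_derive_sepf t u : 0 <= t <= T ->
  is_derive t 1 (sepf ^~ u) (\sum_(i <- s) dpsi i t * h i u).
Proof.
move=> tT; apply: is_derive_bigsum => i.
rewrite (_ : (fun t => _) = (fun t => h i u *: psi i t)); last first.
  by apply/funext => r; rewrite mulrC.
by rewrite mulrC; apply: is_deriveZ; exact: dpsiP.
Qed.

Lemma dt_sepf t u : 0 <= t <= T -> dt T sepf t u = \sum_(i <- s) dpsi i t * h i u.
Proof. by move=> tT; apply: dt_val => //; exact: is_derive_sepf. Qed.

Lemma cyl_time_at (f : R -> R) :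
  (forall t, 0 <= t <= T -> {for t, continuous f}) -> cyl (fun t _ => f t).
Proof.
move=> cf; apply/subspace_continuousP => -[t u] [/= tT _].
apply: (@cvg_trans _ ((fun tu : R * R => f tu.1) @ nbhs (t, u))).
  apply: cvg_app; exact: cvg_within.
apply: (@continuous_comp _ _ _ fst f (t, u)); first exact: cvg_fst.
by apply: cf; move: tT; rewrite in_itv.
Qed.

Lemma cyl_sep (a b : I -> R -> R) :
  (forall i t, 0 <= t <= T -> {for t, continuous (a i)}) ->
  (forall i, continuous (b i)) -> cyl (fun t u => \sum_(i <- s) a i t * b i u).
Proof.
move=> ca cb; apply: cyl_sum => i; apply: cylM.
  by apply: cyl_time_at => t tT; exact: ca.
by apply: continuous_cylinder; exact: cb.
Qed.

Lemma eq_cyl (G H : R -> R -> R) :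
  (forall t u, 0 <= t <= T -> G t u = H t u) -> cyl G -> cyl H.
Proof.
move=> GH cG; apply/subspace_continuousP => -[t u] tu.
have /subspace_continuousP /(_ (t, u) tu) c := cG.
rewrite /from_subspace/= -GH; last by case: tu; rewrite /= in_itv.
apply: cvg_trans c; apply: near_eq_cvg.
rewrite /within/=; apply: (@nearW _ (nbhs (t, u))) => -[t' u'] [/= h1 _].
by rewrite /from_subspace/= GH//; move: h1; rewrite in_itv.
Qed.

Lemma C12_sepf : C12 T sepf.
Proof.
have cpsi i t : 0 <= t <= T -> {for t, continuous (psi i)}.
  by move=> tT; exact: is_derive_continuous_at (dpsiP i tT).
have ch i : continuous (h i) by exact: is_derive1_continuous (dhP i).
have cdh i : continuous (dh i) by exact: is_derive1_continuous (ddhP i).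
split; [split|..].
- by move=> t _ u; apply: eq_bigr => i _; rewrite ph.
- move=> t u _; apply: ex_derive.
  apply: is_derive_bigsum => i.
- exact: cyl_sep.
- apply: eq_cyl (cyl_sep cpsi cdh) => t u _; by rewrite dx_sepf.
- move=> t u _; rewrite (_ : dx sepf t = fun u => \sum_(i <- s) psi i t * dh i u); last first.
    by apply/funext => v; exact: dx_sepf.
  apply: ex_derive; apply: is_derive_bigsum => i.
- move=> t u; rewrite in_itv/= => tT; apply/cvg_ex; eexists.
  exact: dt_quotient_cvg (is_derive_sepf u tT).
- apply: eq_cyl (cyl_sep cpsi cddh) => t u _; by rewrite dxx_sepf.
- apply: eq_cyl (cyl_sep cdpsi ch) => t u tT; by rewrite dt_sepf.
Qed.

End Separable.

(** * Running averages and ramps in time *)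

Section Averages.
Context {R : realType}.
Implicit Types (f : R -> R).

Lemma clamp_lip (a b x y : R) : `|clamp a b x - clamp a b y| <= `|x - y|.
Proof.
wlog xy : x y / x <= y => [W|].
  by have [/W//|/ltW/W] := leP x y; rewrite distrC [leRHS]distrC.
have hmax (z v w : R) : v <= w -> 0 <= Num.max z w - Num.max z v <= w - v.
  by case: (leP z v) => h1; case: (leP z w) => h2 h3; apply/andP; split; lra.
have hmin (z v w : R) : v <= w -> 0 <= Num.min z w - Num.min z v <= w - v.
  by case: (leP z v) => h1; case: (leP z w) => h2 h3; apply/andP; split; lra.
have /andP[m1 m2] := hmin b _ _ xy.
have /andP[m3 m4] : 0 <= clamp a b y - clamp a b x <= Num.min b y - Num.min b x.
  by apply: hmax; rewrite -subr_ge0.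
by rewrite distrC [leRHS]distrC !ger0_norm ?subr_ge0 ?(le_trans m4)// -subr_ge0.
Qed.

(** The mean of [f] over [t, t + a], written with a primitive so that its
    derivative in [t] can be read off. *)
Definition avg (a : R) f (t : R) : R := (primitive f (t + a) - primitive f t) / a.

Lemma is_derive_avg (a : R) f (t : R) : 0 < a -> continuous f -> -1 < t ->
  is_derive t 1 (avg a f) ((f (t + a) - f t) / a).
Proof.
move=> a0 cf t1.
have d1 := is_derive_primitive cf t1.
have ta1 : -1 < t + a by rewrite (lt_trans t1)// ltrDl.
have sh : is_derive t 1 (fun t : R => t + a) 1.
  by have := is_deriveD (is_derive_id t 1) (is_derive_cst a t 1); rewrite addr0.
have d2 := @is_derive1_comp _ (primitive f) (fun t : R => t + a) t _ _
  (is_derive_primitive cf ta1) sh.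
rewrite mulr1 in d2.
have := is_deriveZ a^-1 (is_deriveB d2 d1).
rewrite (_ : a^-1 \*: _ = avg a f).
  by rewrite /GRing.scale/= mulrC.
by apply/funext => x; rewrite /avg /GRing.scale/= mulrC.
Qed.

Lemma avgE (a : R) f (t : R) : 0 < a -> continuous f -> -1 < t ->
  avg a f t = a^-1 * \int[lebesgue_measure]_(x in `[t, t + a]) f x.
Proof.
move=> a0 cf t1; rewrite (@Rintegral_FTC2 _ (primitive f) f t (t + a) _ _ cf).
- by rewrite /avg mulrC.
- by rewrite ltrDl.
- by move=> x /andP[tx _]; apply: is_derive_primitive => //; exact: lt_le_trans tx.
Qed.

Let mI (a b : R) : measurable (`[a, b]%classic : set (measurableTypeR R)).
Proof. exact: measurable_itv. Qed.

Let lI (a t : R) : 0 < a -> lebesgue_measure (`[t, t + a]%classic : set R) = a%:E.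
Proof.
move=> a0; rewrite lebesgue_measure_itv/= lte_fin ltrDl a0.
by rewrite -EFinB addrAC subrr add0r.
Qed.

Let lfin (a t : R) : 0 < a ->
  (lebesgue_measure (`[t, (t + a)%R]%classic : set R) < +oo)%E.
Proof. by move=> a0; rewrite lI// ltry. Qed.

Let bI (a t : R) f : continuous f ->
  @bdm _ (measurableTypeR R) R `[t, t + a]%classic f.
Proof.
move=> cf; split; first by apply: measurable_funTS; exact: continuous_measurable_fun.
have [C _ HC] := cylinder_bounded t (t + a) (lexx 0) (@continuous_cylinder _ 0 _ cf).
by exists C => u; rewrite /= in_itv/= => uT; apply: (HC 0); rewrite ?lexx.
Qed.

Lemma avg_le (a : R) f (t C : R) : 0 < a -> continuous f -> -1 < t ->
  (forall r, t <= r <= t + a -> f r <= C) -> avg a f t <= C.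
Proof.
move=> a0 cf t1 H; rewrite avgE//.
have := bint_le_cst (mI t (t + a)) (lfin t a0) (bI a t cf)
  (C := C).
move=> K; rewrite ler_pdivrMl// mulrC.
apply: (le_trans (K _)) => [r|]; first by rewrite /= in_itv/=; exact: H.
by rewrite [X in fine X]lI.
Qed.

Lemma avg_ge (a : R) f (t C : R) : 0 < a -> continuous f -> -1 < t ->
  (forall r, t <= r <= t + a -> C <= f r) -> C <= avg a f t.
Proof.
move=> a0 cf t1 H.
have cN : continuous (fun r => - f r) by move=> r; apply: continuousN; exact: cf.
have : avg a (fun r => - f r) t <= - C.
  by apply: avg_le => // r /H; rewrite lerN2.
rewrite !avgE// (bintN (mI t (t + a)) (lfin t a0) (bI a t cf)).
by rewrite mulrN lerN2.
Qed.

Lemma avg_near (a : R) f (t e : R) : 0 < a -> continuous f -> -1 < t ->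
  (forall r, t <= r <= t + a -> `|f r - f t| <= e) -> `|avg a f t - f t| <= e.
Proof.
move=> a0 cf t1 H; rewrite ler_distl; apply/andP; split.
  by apply: avg_ge => // r /H; rewrite ler_distl => /andP[].
by apply: avg_le => // r /H; rewrite ler_distl => /andP[].
Qed.

Lemma avg_sum (I : Type) (s : seq I) (c : I -> R) (F : I -> R -> R) (a t : R) :
  0 < a -> (forall i, continuous (F i)) -> -1 < t ->
  \sum_(i <- s) c i * avg a (F i) t = avg a (fun r => \sum_(i <- s) c i * F i r) t.
Proof.
move=> a0 cF t1.
have cS : continuous (fun r => \sum_(i <- s) c i * F i r) by exact: continuous_lincomb.
rewrite avgE// (bint_sum (mu := lebesgue_measure) (mI t (t + a)) (lfin t a0)); last first.
  by move=> i _; apply: bdmZ; exact: bI.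
rewrite mulr_sumr; apply: eq_bigr => i _.
rewrite avgE// (bintZ (mI t (t + a)) (lfin t a0) _ (bI a t (cF i))).
by rewrite mulrCA.
Qed.

(** The integral of V(t + a) - V(t) telescopes to the difference of the means of
    V over the two end windows of length a. *)
Lemma time_shift_le (T a : R) (V : R -> R) : 0 < T -> 0 < a -> continuous V ->
  (forall t, 0 <= V t <= 1) ->
  time_int T (fun t => V (t + a) - V t) <= a.
Proof.
move=> T0 a0 cV V01.
have csh : continuous (fun t => V (t + a)).
  move=> t; apply: (@continuous_comp _ _ _ (fun t => t + a) V); last exact: cV.
  by apply: continuousD; [exact: cvg_id|exact: cst_continuous].
have dW (t : R) : 0 <= t <= T -> is_derive t 1 (avg a V \o (fun t => t)) ((V (t + a) - V t) / a).
  move=> /andP[t0 _]; apply: is_derive_avg => //.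
  by rewrite (lt_le_trans _ t0)// ltrN10.
have c2 : continuous (fun t => (V (t + a) - V t) / a).
  apply: (@continuousM2 _ (fun t => V (t + a) - V t) (fun=> a^-1)).
    by move=> t; apply: continuousB; [exact: csh|exact: cV].
  exact: cst_continuous.
have := Rintegral_FTC2 T0 dW c2; rewrite /=.
rewrite -/(time_int T _) => E.
have b : @bdm _ (measurableTypeR R) R `[0, T]%classic (fun t => V (t + a) - V t).
  by apply: continuous_tb => t; apply: continuousB; [exact: csh|exact: cV].
have : time_int T (fun t => V (t + a) - V t) = a * time_int T (fun t => (V (t + a) - V t) / a).
  rewrite [in RHS](eq_time (g := fun t => a^-1 * (V (t + a) - V t))).
    by rewrite (timeZ T0 _ b) mulrA divff ?mul1r// gt_eqF.
  by move=> t _; rewrite mulrC.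
move=> ->; rewrite E -[leRHS]mulr1 ler_pM2l//.
have h1 : avg a V T <= 1.
  by apply: avg_le => // [|r _]; [rewrite (lt_trans _ T0)// ltrN10|have /andP[] := V01 r].
have h2 : 0 <= avg a V 0.
  by apply: avg_ge => // r _; have /andP[] := V01 r.
lra.
Qed.

End Averages.

Section Ramp.
Context {R : realType}.

(** A C^1 ramp increasing from 0 at [s] to 1 at [s + a]: the running average over
    a window of length a / 2 of a piecewise linear ramp from [s + a / 2] to
    [s + a]. *)
Definition ramp_base (a s v : R) : R := clamp 0 1 ((v - s - a / 2) / (a / 2)).
Definition rampa (a s : R) : R -> R := avg (a / 2) (ramp_base a s).
Definition drampa (a s r : R) : R :=
  (ramp_base a s (r + a / 2) - ramp_base a s r) / (a / 2).

Let base_continuous a s : continuous (ramp_base a s).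
Proof.
move=> r; apply: (@continuous_comp _ _ _ (fun v => (v - s - a / 2) / (a / 2))
  (clamp (0 : R) 1)); last exact: continuous_clamp.
apply: continuousM; last exact: cst_continuous.
apply: continuousB; last exact: cst_continuous.
by apply: continuousB; [exact: cvg_id|exact: cst_continuous].
Qed.

Let half_gt0 (a : R) : 0 < a -> 0 < a / 2. Proof. by move=> ?; exact: divr_gt0. Qed.

Let tgt1 (t : R) : 0 <= t -> -1 < t.
Proof. by apply: lt_le_trans; rewrite ltrN10. Qed.

Let base01 a s v : 0 <= ramp_base a s v <= 1. Proof. exact: clamp_itv. Qed.

Let base0 (a s v : R) : 0 < a -> v <= s + a / 2 -> ramp_base a s v = 0.
Proof.
move=> a0 vs; rewrite /ramp_base /clamp max_l// ge_min; apply/orP; right.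
by rewrite ler_pdivrMr ?half_gt0// mul0r; lra.
Qed.

Let base1 (a s v : R) : 0 < a -> s + a <= v -> ramp_base a s v = 1.
Proof.
move=> a0 vs; rewrite /ramp_base /clamp min_l ?max_r//.
by rewrite ler_pdivlMr ?half_gt0// mul1r; lra.
Qed.

Lemma is_derive_rampa (a s r : R) : 0 < a -> 0 <= r ->
  is_derive r 1 (rampa a s) (drampa a s r).
Proof.
move=> a0 r0; apply: is_derive_avg; [exact: half_gt0|exact: base_continuous|exact: tgt1].
Qed.

Lemma continuous_drampa a s : continuous (drampa a s).
Proof.
apply: (@continuousM2 _ (fun r => ramp_base a s (r + a / 2) - ramp_base a s r)
  (fun=> (a / 2)^-1)); last exact: cst_continuous.
have csh : continuous (fun r => ramp_base a s (r + a / 2)).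
  move=> r; apply: (@continuous_comp _ _ _ (fun r => r + a / 2) (ramp_base a s));
    last exact: base_continuous.
  by apply: continuousD; [exact: cvg_id|exact: cst_continuous].
by move=> r; exact: (continuousB (csh r) (@base_continuous a s r)).
Qed.

Lemma rampa01 (a s r : R) : 0 < a -> 0 <= r -> 0 <= rampa a s r <= 1.
Proof.
move=> a0 r0; have cb := @base_continuous a s.
apply/andP; split.
  by apply: (avg_ge (half_gt0 a0) cb (tgt1 r0)) => v _; have /andP[] := base01 a s v.
by apply: (avg_le (half_gt0 a0) cb (tgt1 r0)) => v _; have /andP[] := base01 a s v.
Qed.

Lemma rampa_le (a s r : R) : 0 < a -> 0 <= r -> r <= s ->
  rampa a s r = 0 /\ drampa a s r = 0.
Proof.
move=> a0 r0 rs; have a20 := half_gt0 a0; split.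
  have /andP[h _] := rampa01 s a0 r0; apply/eqP; rewrite eq_le h andbT.
  apply: (avg_le a20 (@base_continuous a s) (tgt1 r0)) => v /andP[_ h1].
  by rewrite base0//; lra.
by rewrite /drampa !base0 ?subrr ?mul0r//; lra.
Qed.

Lemma rampa_ge (a s r : R) : 0 < a -> 0 <= r -> s + a <= r ->
  rampa a s r = 1 /\ drampa a s r = 0.
Proof.
move=> a0 r0 rs; have a20 := half_gt0 a0; split.
  have /andP[_ h] := rampa01 s a0 r0; apply/eqP; rewrite eq_le h/=.
  apply: (avg_ge a20 (@base_continuous a s) (tgt1 r0)) => v /andP[h1 _].
  by rewrite base1//; lra.
by rewrite /drampa !base1 ?subrr ?mul0r//; lra.
Qed.

Lemma drampa_ge0 (a s r : R) : 0 < a -> 0 <= drampa a s r.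
Proof.
move=> a0; have a20 := half_gt0 a0; rewrite divr_ge0 ?(ltW a20)// subr_ge0.
rewrite /ramp_base /clamp ge_max !le_max !le_min !ge_min lexx/=.
have -> : (r - s - a / 2) / (a / 2) <= (r + a / 2 - s - a / 2) / (a / 2).
  by rewrite ler_pM2r ?invr_gt0//; lra.
by rewrite lexx !orbT.
Qed.

(** The derivative of the ramp is a probability density concentrated just to the
    right of [s], so right continuity suffices; at [s = T] the ramp vanishes on
    the whole interval and both sides are 0. *)
Lemma ramp_average (T : R) (x : R -> R) (s : R) : 0 < T ->
  @bdm _ (measurableTypeR R) R `[0, T]%classic x ->
  (forall t, 0 <= t < T -> x r @[r --> t^'+] --> x t) -> 0 <= s <= T ->
  forall e : R, 0 < e -> exists2 a0, 0 < a0 & forall a, 0 < a <= a0 ->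
  `|rampa a s T * x T - time_int T (fun r => drampa a s r * x r) - (x T - x s)| <= e.
Proof.
move=> T0 bx rc /andP[s0 sT] e e0.
move: sT; rewrite le_eqVlt => /predU1P[->|sT].
  exists 1 => // a /andP[a0 _].
  have [-> _] := rampa_le a0 (ltW T0) (lexx T).
  rewrite (eq_time (g := fun=> 0)); last first.
    by move=> r /andP[r0 rT]; have [_ ->] := rampa_le a0 r0 rT; rewrite mul0r.
  by rewrite (time_cst T0) !mul0r !subrr normr0 ltW.
have /cvgrPdist_le /(_ e e0) : x r @[r --> s^'+] --> x s.
  by apply: rc; rewrite s0.
move=> [d /= d0 Hd].
pose a0 := Num.min (d / 2) (T - s).
have a00 : 0 < a0 by rewrite lt_min divr_gt0//= subr_gt0.
exists a0 => // a /andP[a_gt0 aa0].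
have ad : a < d.
  rewrite (le_lt_trans aa0)// gt_min; apply/orP; left.
  by rewrite ltr_pdivrMr// ltr_pMr// ltr1n.
have aT : s + a <= T.
  by rewrite -lerBrDl (le_trans aa0)// ge_min lexx orbT.
have [rT _] := rampa_ge a_gt0 (ltW T0) aT.
have [r0 _] := rampa_le a_gt0 (lexx 0) s0.
have cd : continuous (drampa a s) := @continuous_drampa a s.
have bd := continuous_tb T cd.
have I1 : time_int T (drampa a s) = 1.
  rewrite /time_int (@Rintegral_FTC2 _ (rampa a s) _ 0 T T0 _ cd) ?rT ?r0 ?subr0//.
  by move=> r /andP[h0 _]; exact: is_derive_rampa.
rewrite rT mul1r.
have -> : x T - time_int T (fun r => drampa a s r * x r) - (x T - x s) =
   time_int T (fun r => x s * drampa a s r - drampa a s r * x r).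
  by rewrite (timeB T0 (bdmZ _ bd) (bdmM bd bx)) (timeZ T0 _ bd) I1; ring.
have -> : e = time_int T (fun r => e * drampa a s r) by rewrite (timeZ T0 _ bd) I1 mulr1.
apply: (abs_time_le T0 (bdmB (bdmZ _ bd) (bdmM bd bx)) (bdmZ _ bd)).
move=> r /andP[r0' _]; have dr0 := drampa_ge0 s r a_gt0.
rewrite [x s * _]mulrC -mulrBr normrM ger0_norm// mulrC.
have [rs|rs] := leP r s.
  by have [_ ->] := rampa_le a_gt0 r0' rs; rewrite !mulr0.
have [ra|ra] := leP (s + a) r.
  by have [_ ->] := rampa_ge a_gt0 r0' ra; rewrite !mulr0.
rewrite ler_wpM2r//; apply: Hd => //=.
by rewrite ler0_norm ?subr_le0 ?(ltW rs)// opprB ltrBlDl (lt_trans ra)// ltrD2l.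
Qed.

End Ramp.

(** * A priori bounds on the level sets *)

Section Trig_test.
Context {R : realType} (T : R).
Hypothesis T0 : 0 < T.
Local Notation dom := (@torus_dom R).
Local Notation itv := (`[0, T]%classic : set R).
Local Notation tb := (@bdm _ (measurableTypeR R) R itv).
Local Notation cyl := (continuous_on_cylinder T).
Implicit Types (pi : cadlag (Mplus R) T).

Let T0' : 0 <= T. Proof. exact: ltW. Qed.

Lemma tb_continuous_at (f : R -> R) :
  (forall t, 0 <= t <= T -> {for t, continuous f}) -> tb f.
Proof.
move=> cf; have cyf : cyl (fun t _ => f t) by exact: cyl_time_at.
split; first exact: (@cylinder_meas_time _ T (fun t _ => f t) 0).
have [C _ HC] := cylinder_bounded 0 1 T0' cyf.
by exists C => t /itvP0 tT; apply: (HC t 0) => //; rewrite lexx ler01.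
Qed.

Section Test.
Variables (s : seq (bool * nat)) (psi dpsi : bool * nat -> R -> R).
Hypothesis dpsiP : forall p t, 0 <= t <= T -> is_derive t 1 (psi p) (dpsi p t).
Hypothesis cdpsi : forall p t, 0 <= t <= T -> {for t, continuous (dpsi p)}.

Definition tsep t u : R := \sum_(p <- s) psi p t * trig p u.

Let dh (p : bool * nat) (u : R) : R := sfreq p * trig (flip p) u.
Let ddh (p : bool * nat) (u : R) : R := - freq p.2 ^+ 2 * trig p u.

Let ddhP p (u : R) : is_derive u 1 (dh p) (ddh p u).
Proof.
have -> : ddh p u = sfreq p *: (sfreq (flip p) * trig (flip (flip p)) u).
  rewrite /ddh flipK sfreq_flip -sfreq_sqr /GRing.scale/=; ring.
by apply: is_deriveZ; exact: is_derive_trig.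
Qed.

Let cddh p : continuous (ddh p).
Proof. by apply: continuousZ2; exact: trig_continuous. Qed.

Lemma C12_tsep : C12 T tsep.
Proof.
exact: (C12_sepf T0 s dpsiP cdpsi (@is_derive_trig R) ddhP cddh (@trig_periodic R)).
Qed.

Lemma dt_tsep t u : 0 <= t <= T -> dt T tsep t u = \sum_(p <- s) dpsi p t * trig p u.
Proof. by move=> tT; exact: (dt_sepf T0 s (@trig R) dpsiP u tT). Qed.

Lemma dx_tsep t u :
  dx tsep t u = \sum_(p <- s) psi p t * (sfreq p * trig (flip p) u).
Proof. exact: (dx_sepf s psi (@is_derive_trig R)). Qed.

Lemma dxx_tsep t u :
  dxx tsep t u = \sum_(p <- s) psi p t * (- freq p.2 ^+ 2 * trig p u).
Proof. exact: (dxx_sepf s psi (@is_derive_trig R) ddhP). Qed.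

Lemma tb_psi p : tb (psi p).
Proof.
apply: tb_continuous_at => t tT; exact: is_derive_continuous_at (dpsiP p tT).
Qed.

Lemma tb_dpsi p : tb (dpsi p).
Proof. by apply: tb_continuous_at => t tT; exact: cdpsi. Qed.

Lemma mpair_trigsum (m : Mplus R) (a : bool * nat -> R) :
  mpair m (fun u => \sum_(p <- s) a p * trig p u) =
  \sum_(p <- s) a p * mpair m (trig p).
Proof.
rewrite (mpair_sum m); last by move=> p _; apply: bdmZ; exact: bd_trig.
by apply: eq_bigr => p _; rewrite mpairZ//; exact: bd_trig.
Qed.

Lemma linear_tsep pi : D1 pi ->
  time_int T (fun t => tint (fun u => dens (pi t) u *
     (dt T tsep t u + 2^-1 * dxx tsep t u))) =
  time_int T (fun t => \sum_(p <- s) dpsi p t * xc pi p t)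
  - 2^-1 * time_int T (fun t => \sum_(p <- s) psi p t * freq p.2 ^+ 2 * xc pi p t).
Proof.
move=> pD.
have b1 : tb (fun t => \sum_(p <- s) dpsi p t * xc pi p t).
  by apply: bdm_sum => p _; apply: bdmM; [exact: tb_dpsi|exact: tb_xc].
have b2 : tb (fun t => \sum_(p <- s) psi p t * freq p.2 ^+ 2 * xc pi p t).
  apply: bdm_sum => p _; apply: bdmM; last exact: tb_xc.
  by apply: bdmM; [exact: tb_psi|exact: bdm_cst].
rewrite -(timeZ T0 _ b2) -(timeB T0 b1 (bdmZ _ b2)).
apply: eq_time => t tT.
pose a p := dpsi p t - 2^-1 * (psi p t * freq p.2 ^+ 2).
transitivity (tint (fun u => dens (pi t) u * \sum_(p <- s) a p * trig p u)).
  apply: eq_tint => u _; rewrite (dt_tsep _ tT) dxx_tsep; congr (_ * _).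
  rewrite mulr_sumr -big_split/=; apply: eq_bigr => p _; rewrite /a; ring.
rewrite -mpairE; [|exact: pD|].
  rewrite mpair_trigsum mulr_sumr -sumrB; apply: eq_bigr => p _.
  by rewrite /a /xc; ring.
by apply: continuous_lincomb; exact: trig_continuous.
Qed.

End Test.

Section J_bound.
Context (M : nat) (c : {ffun 'I_(M.*2.+1) -> bool} -> R) (gamma : R -> R).

Definition rate_bound (C : R) := 0 <= C /\ forall r, 0 <= r <= 1 ->
  `|birth_rate c r| <= C /\ `|death_rate c r| <= C.

Lemma rate_bound_ex : exists C, rate_bound C.
Proof.
have [_ [L L0 HL]] := lip01_birth c; have [_ [L' L'0 HL']] := lip01_death c.
exists (L + L'); split; first exact: addr_ge0.
move=> r r01; split.
  by rewrite (le_trans (HL r r r01 r01).2)// lerDl.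
by rewrite (le_trans (HL' r r r01 r01).2)// lerDr.
Qed.

Let J_arith (m g l h k r1 r2 q l1 l2 : R) : m - g - l - 2^-1 * h - (r1 + r2) <= q ->
  l = l1 - 2^-1 * l2 -> h <= k -> forall r, r1 <= r -> r2 <= r ->
  m - g - l1 + 2^-1 * l2 - 2^-1 * k - 2 * r <= q.
Proof. by move=> H lE hk r h1 h2; rewrite lE in H; lra. Qed.

Lemma reaction_le (C : R) (Psi : R -> R) (h : R -> R -> R) (rb : R -> R) pi :
  D1 pi -> 0 <= C -> lip01 Psi -> (forall r, 0 <= r <= 1 -> `|Psi r| <= C) ->
  cyl h -> tb rb -> (forall t u, 0 <= t <= T -> dom u -> `|h t u| <= rb t) ->
  time_int T (fun t => tint (fun u => Psi (dens (pi t) u) * h t u)) <=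
  C * time_int T rb.
Proof.
move=> pD C0 lP HP ch brb Hrb.
rewrite -(timeZ T0 _ brb); apply: (le_time T0 (tb_lip01 T0 pD lP ch) (bdmZ _ brb)).
move=> t tT; apply: tint_le_cst.
  apply: bdmM; last by apply: continuous_bd; exact: cylinder_cont_space ch.
  by apply: bd_lip01 => //; [exact: bd_densD|move=> u _; exact: dens01].
move=> u du; apply: (le_trans (ler_norm _)); rewrite normrM.
apply: ler_pM => //; last exact: Hrb.
by apply: HP; exact: dens01.
Qed.

(** The four nonlinear terms are only bounded: [kb] bounds the quadratic term at
    each time and [rb] the exponentials. What remains is linear in the Fourier
    coefficients. *)
Lemma J_tsep_le (C q : R) pi s psi dpsi (kb rb : R -> R) : rate_bound C -> D1 pi ->
  (forall p t, 0 <= t <= T -> is_derive t 1 (psi p) (dpsi p t)) ->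
  (forall p t, 0 <= t <= T -> {for t, continuous (dpsi p)}) ->
  J_D1 c gamma (tsep s psi) pi <= q ->
  tb kb -> tb rb ->
  (forall t, 0 <= t <= T -> tint (fun u => chi (dens (pi t) u) *
     dx (tsep s psi) t u ^+ 2) <= kb t) ->
  (forall t u, 0 <= t <= T -> dom u -> `|expR (tsep s psi t u) - 1| <= rb t /\
     `|expR (- tsep s psi t u) - 1| <= rb t) ->
  mpair (pi T) (tsep s psi T) - fpair gamma (tsep s psi 0)
  - time_int T (fun t => \sum_(p <- s) dpsi p t * xc pi p t)
  + 2^-1 * time_int T (fun t => \sum_(p <- s) psi p t * freq p.2 ^+ 2 * xc pi p t)
  - 2^-1 * time_int T kb - 2 * (C * time_int T rb) <= q.
Proof.
move=> [C0 HC] pD dP cdP Jq bkb brb Hkb Hrb.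
have GC := C12_tsep s dP cdP.
have [[pG dG cG cdx] ddG dtG cdxx cdt] := GC.
rewrite (J_D1E T0 c gamma pD GC) in Jq.
apply: (J_arith Jq (linear_tsep s dP cdP pD)).
- apply: (le_time T0 _ bkb Hkb).
  exact: (tb_lip01 T0 pD lip01_chi (cylX2 cdx)).
- apply: (reaction_le pD C0 (lip01_birth c) _ (cyl_exp cG) brb).
    by move=> r /HC[].
  by move=> t u tT du; have [] := Hrb t u tT du.
- apply: (reaction_le pD C0 (lip01_death c) _ (cyl_exp (cylN cG)) brb).
    by move=> r /HC[].
  by move=> t u tT du; have [] := Hrb t u tT du.
Qed.

(** The bounds below make the energy finite on this set, so it is the level set of
    height [q] of the rate function. *)
Definition below (q : R) pi := D1 pi /\ forall G, C12 T G -> J_D1 c gamma G pi <= q.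

Lemma mpair_tsep pi s psi t :
  mpair (pi t) (tsep s psi t) = \sum_(p <- s) psi p t * xc pi p t.
Proof. exact: mpair_trigsum. Qed.

Lemma xc_right pi p t : 0 <= t < T -> xc pi p r @[r --> t^'+] --> xc pi p t.
Proof.
move=> tT; apply: (mpair_cvg_Mplus (g := trig_test p)).
exact: traj_right_continuous.
Qed.

Lemma time_indic (a b : R) : a <= b ->
  time_int T (\1_(`[a, b]%classic) : R -> R) <= b - a.
Proof.
move=> ab; rewrite /time_int Rintegral_indic//.
set A := (`[a, b]%classic : set R); set B := (`[0, T]%classic : set R).
have mA : measurable (A : set (measurableTypeR R)) by exact: measurable_itv.
have mI : measurable ((A `&` B) : set (measurableTypeR R)).
  by apply: measurableI; exact: measurable_itv.
have Lab : lebesgue_measure A = (b - a)%:E.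
  rewrite lebesgue_measure_itv/= lte_fin; case: ltP => h; first by rewrite EFinB.
  by have -> : b = a; [apply/eqP; rewrite eq_le h|rewrite subrr].
have le1 : (lebesgue_measure (A `&` B) <= lebesgue_measure A)%E.
  by apply: le_measure; rewrite ?inE.
rewrite -lee_fin fineK -?Lab//.
by rewrite ge0_fin_numE//; apply: (le_lt_trans le1); rewrite Lab ltry.
Qed.

Lemma expR_sub1_le (x y : R) : `|x| <= y ->
  `|expR x - 1| <= expR y + 1 /\ `|expR (- x) - 1| <= expR y + 1.
Proof.
rewrite ler_norml => /andP[h1 h2].
have e0 z : 0 < expR z :> R := expR_gt0 z.
have a1 : expR x <= expR y by rewrite ler_expR.
have a2 : expR (- x) <= expR y by rewrite ler_expR; lra.
by split; rewrite ler_norml; apply/andP; split; have := e0 x; have := e0 (- x);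
  have := e0 y; lra.
Qed.

Definition modulus_cst (C : R) (p : bool * nat) (b : R) : R :=
  freq p.2 ^+ 2 * `|b| + 2 * b ^+ 2 * freq p.2 ^+ 2 + 2 * C * (expR (2 * `|b|) + 1).

Let ramp_arith (m l1 l2 k r q f b e C i zs zt : R) :
  m - 0 - l1 + 2^-1 * l2 - 2^-1 * k - 2 * (C * r) <= q ->
  - (2 * (f * `|b|)) * i <= l2 -> k = 4 * b ^+ 2 * f * i ->
  r = e * i -> m - l1 = b * (zs - zt) ->
  b * (zs - zt) <= q + (f * `|b| + 2 * b ^+ 2 * f + 2 * C * e) * i.
Proof.
move=> H h1 kE rE h3; rewrite kE rE in H; rewrite -h3.
have h4 : 2^-1 * l2 >= - (f * `|b| * i).
  have -> : - (f * `|b| * i) = 2^-1 * (- (2 * (f * `|b|)) * i) by field.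
  by rewrite ler_pM2l.
have -> : (f * `|b| + 2 * b ^+ 2 * f + 2 * C * e) * i =
  f * `|b| * i + 2^-1 * (4 * b ^+ 2 * f * i) + 2 * (C * (e * i)) by field.
move: H h4; set x1 := 4 * b ^+ 2 * f * i; set x2 := C * _; set x3 := f * _ * _.
lra.
Qed.

(** The test function is b (ramp at s - ramp at t) e_p. It vanishes outside
    [s, t + a], which is why the error terms carry the factor t - s + a; the
    linear terms of J are exactly b times the difference of the averages [Z],
    which tend to x_p(T) - x_p(s) and x_p(T) - x_p(t) as the ramps get steep. *)
Lemma modulus_ramp (C q : R) pi p (a s t b : R) : rate_bound C -> below q pi ->
  0 < a -> 0 <= s -> s <= t -> t <= T ->
  let Z r := rampa a r T * xc pi p T - time_int T (fun v => drampa a r v * xc pi p v) in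
  0 <= modulus_cst C p b /\
  b * (Z s - Z t) <= q + modulus_cst C p b * (t - s + a).
Proof.
move=> HC [pD Hq] a0 s0 st tT Z.
pose psi (_ : bool * nat) r := b * (rampa a s r - rampa a t r).
pose dpsi (_ : bool * nat) r := b * (drampa a s r - drampa a t r).
pose ind : R -> R := \1_(`[s, t + a]%classic).
have t0 : 0 <= t by exact: le_trans st.
have dP (p' : bool * nat) (r : R) : 0 <= r <= T -> is_derive r 1 (psi p') (dpsi p' r).
  move=> /andP[r0 _].
  have := is_deriveZ b (is_deriveB (is_derive_rampa s a0 r0) (is_derive_rampa t a0 r0)).
  exact.
have cdr r : continuous (drampa a r) := @continuous_drampa R a r.
have cdP (p' : bool * nat) (r : R) : 0 <= r <= T -> {for r, continuous (dpsi p')}.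
  move=> _; apply: (@continuousZ2 _ b (fun r => drampa a s r - drampa a t r)).
  by move=> v; apply: continuousB; exact: cdr.
have ind0 r : 0 <= ind r by rewrite /ind indicE.
have ind1 r : ind r ^+ 2 = ind r.
  by rewrite /ind indicE; case: (_ \in _); rewrite ?expr1n ?expr0n.
have psi_le r : 0 <= r -> `|psi p r| <= `|b| * ind r.
  move=> r0; rewrite /psi normrM ler_wpM2l//.
  have [rs|rs] := leP r s.
    have [-> _] := rampa_le a0 r0 rs; have [-> _] := rampa_le a0 r0 (le_trans rs st).
    by rewrite subrr normr0.
  have [ra|ra] := leP (t + a) r.
    have [-> _] := rampa_ge a0 r0 ra.
    have [-> _] : rampa a s r = 1 /\ drampa a s r = 0.
      by apply: rampa_ge => //; rewrite (le_trans _ ra)// lerD2r.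
    by rewrite subrr normr0.
  rewrite /ind indicE mem_set/= ?in_itv/= ?(ltW rs) ?(ltW ra)//.
  have /andP[? ?] := rampa01 s a0 r0; have /andP[? ?] := rampa01 t a0 r0.
  by rewrite ler_norml; apply/andP; split; lra.
have tE r u : tsep [:: p] psi r u = psi p r * trig p u by rewrite /tsep big_seq1.
have bind : tb ind by apply: bdm_indic; exact: measurable_itv.
set E := expR (2 * `|b|) + 1.
have E0 : 0 <= E by rewrite addr_ge0// expR_ge0.
pose kb r := 4 * b ^+ 2 * freq p.2 ^+ 2 * ind r.
pose rb r := E * ind r.
have bkb : tb kb by exact: bdmZ.
have brb : tb rb by exact: bdmZ.
have := J_tsep_le HC pD dP cdP (Hq _ (C12_tsep [:: p] dP cdP)) bkb brb.
move=> H; have {}H := H _ _.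
have Hk r : 0 <= r <= T -> tint (fun u => chi (dens (pi r) u) *
     dx (tsep [:: p] psi) r u ^+ 2) <= kb r.
  move=> rT; have /andP[r0 _] := rT; apply: tint_le_cst.
    apply: bdmM.
      by apply: (bd_lip01 lip01_chi); [exact: bd_densD|move=> u _; exact: dens01].
    apply: bdmX; apply: continuous_bd.
    rewrite (_ : dx _ _ = fun u => psi p r * (sfreq p * trig (flip p) u)).
      by apply: continuousZ2; apply: continuousZ2; exact: trig_continuous.
    by apply/funext => u; rewrite dx_tsep big_seq1.
  move=> u _; rewrite dx_tsep big_seq1.
  have /andP[d0 d1] := dens01 (pi r) u.
  have h1 : chi (dens (pi r) u) <= 1 by rewrite /chi; nra.
  have h2 : (psi p r * (sfreq p * trig (flip p) u)) ^+ 2 <= kb r.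
    rewrite exprMn [(sfreq p * _) ^+ 2]exprMn sfreq_sqr /kb.
    have -> : 4 * b ^+ 2 * freq p.2 ^+ 2 * ind r =
       (`|b| * ind r) ^+ 2 * (freq p.2 ^+ 2 * 2 ^+ 2).
      by rewrite [(_ * ind r) ^+ 2]exprMn ind1 real_normK ?num_real//; ring.
    apply: ler_pM; [exact: sqr_ge0|by rewrite mulr_ge0 ?sqr_ge0|..].
      rewrite -[leLHS]real_normK ?num_real// lerXn2r ?nnegrE ?mulr_ge0//; exact: psi_le.
    rewrite ler_wpM2l ?sqr_ge0// -[leLHS]real_normK ?num_real// lerXn2r ?nnegrE//.
    exact: trig_le2.
  by rewrite (le_trans _ h2)// ler_piMl ?sqr_ge0.
have Hr r u : 0 <= r <= T -> dom u -> `|expR (tsep [:: p] psi r u) - 1| <= rb r /\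
     `|expR (- tsep [:: p] psi r u) - 1| <= rb r.
  move=> /andP[r0 _] du; rewrite tE /rb.
  have hb : `|psi p r * trig p u| <= (`|b| * ind r) * 2.
    by rewrite normrM ler_pM ?trig_le2//; exact: psi_le.
  move: hb; rewrite /ind indicE; case: (_ \in _) => hb; last first.
    have -> : psi p r * trig p u = 0.
      by apply/eqP; rewrite -normr_le0; move: hb; rewrite mulr0 mul0r.
    by rewrite oppr0 expR0 subrr normr0 mulr0.
  rewrite mulr1; apply: expR_sub1_le; apply: (le_trans hb).
  by rewrite mulr1 mulrC.
have {}H := H Hk Hr.
have f0 : fpair gamma (tsep [:: p] psi 0) = 0.
  rewrite /fpair -/(tint _) (eq_tint (g := fun=> 0)) ?tint_cst// => u _.
  rewrite tE /psi; have [-> _] := rampa_le a0 (lexx 0) s0; have [-> _] := rampa_le a0 (lexx 0) t0.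
  by rewrite subrr mulr0 mul0r mulr0.
have M0 : 0 <= modulus_cst C p b.
  case: HC => C0 _.
  rewrite /modulus_cst -/E; apply: addr_ge0; [apply: addr_ge0|].
  - by apply: mulr_ge0; [exact: sqr_ge0|exact: normr_ge0].
  - by apply: mulr_ge0; [apply: mulr_ge0; [|exact: sqr_ge0]|exact: sqr_ge0].
  - by apply: mulr_ge0; [apply: mulr_ge0|].
split => //.
have Iind : time_int T ind <= t - s + a.
  apply: le_trans (time_indic _) _; first by rewrite (le_trans st)// lerDl ltW.
  by rewrite addrAC.
apply: (@le_trans _ _ (q + modulus_cst C p b * time_int T ind)); last first.
  by rewrite lerD2l ler_wpM2l.
rewrite f0 in H.
apply: (ramp_arith H).
- rewrite -(timeZ T0 _ bind).
  have b1 : tb (fun r => \sum_(p0 <- [:: p]) psi p0 r * freq p0.2 ^+ 2 * xc pi p0 r).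
    apply: bdm_sum => p' _; apply: bdmM; last exact: tb_xc.
    by apply: bdmM; [exact: (tb_psi dP)|exact: bdm_cst].
  apply: (le_time T0 (bdmZ _ bind) b1) => r /andP[r0 _]; rewrite big_seq1.
  have h : `|psi p r * freq p.2 ^+ 2 * xc pi p r| <= `|b| * ind r * freq p.2 ^+ 2 * 2.
    have f0' : 0 <= freq p.2 ^+ 2 :> R := sqr_ge0 _.
    rewrite normrM normrM (ger0_norm f0'); apply: ler_pM.
    - exact: mulr_ge0 (normr_ge0 _) f0'.
    - exact: normr_ge0.
    - exact: (ler_wpM2r f0' (psi_le r r0)).
    - exact: abs_xc_le.
  move: h; rewrite ler_norml => /andP[h _]; apply: le_trans h.
  rewrite le_eqVlt; apply/orP; left; apply/eqP; ring.
- by rewrite /kb (timeZ T0 _ bind).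
- by rewrite /rb (timeZ T0 _ bind).
- have bx := tb_xc T0 pi p; have bs := continuous_tb T (cdr s); have bt := continuous_tb T (cdr t).
  have -> : time_int T (fun v => \sum_(p0 <- [:: p]) dpsi p0 v * xc pi p0 v) =
     b * (time_int T (fun v => drampa a s v * xc pi p v) -
          time_int T (fun v => drampa a t v * xc pi p v)).
    rewrite -(timeB T0 (bdmM bs bx) (bdmM bt bx)).
    rewrite -(timeZ T0 _ (bdmB (bdmM bs bx) (bdmM bt bx))).
    by apply: eq_time => v _; rewrite big_seq1 /dpsi; ring.
  by rewrite mpair_tsep big_seq1 /psi /Z; ring.
Qed.

End J_bound.

End Trig_test.

Section Level_sets.
Context {R : realType} (T : R).
Hypothesis T0 : 0 < T.
Context (M : nat) (c : {ffun 'I_(M.*2.+1) -> bool} -> R) (gamma : R -> R).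
Local Notation dom := (@torus_dom R).
Local Notation itv := (`[0, T]%classic : set R).
Implicit Types (pi : cadlag (Mplus R) T).
Local Notation below := (below c gamma).

Let steep_ramp_arith (q K b zs zt xs xt xT d a e : R) :
  b * (zs - zt) <= q + K * (d + a) -> 0 <= K -> 0 <= a -> K * a <= e / 2 ->
  `|zs - (xT - xs)| <= e / (4 * (`|b| + 1)) ->
  `|zt - (xT - xt)| <= e / (4 * (`|b| + 1)) -> 0 < e ->
  b * (xt - xs) <= q + K * d + e.
Proof.
move=> H K0 a0 Ka h1 h2 e0.
set z1 := zs - (xT - xs) in h1; set z2 := zt - (xT - xt) in h2.
have b1 : 0 < 4 * (`|b| + 1) by rewrite mulr_gt0// ltr_wpDl.
have -> : b * (xt - xs) = b * (zs - zt) + b * (z2 - z1) by rewrite /z1 /z2; ring.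
have h : b * (z2 - z1) <= e / 2.
  rewrite (le_trans (ler_norm _))// normrM.
  have h3 : `|z2 - z1| <= e / (4 * (`|b| + 1)) + e / (4 * (`|b| + 1)).
    by rewrite (le_trans (ler_normB _ _))// lerD.
  apply: (@le_trans _ _ ((`|b| + 1) * (e / (4 * (`|b| + 1)) + e / (4 * (`|b| + 1))))).
    by apply: ler_pM => //; rewrite lerDl.
  rewrite le_eqVlt; apply/orP; left; apply/eqP; field.
  by rewrite gt_eqF// ltr_wpDl.
have -> : q + K * d + e = q + K * (d + a) - K * a + e by ring.
lra.
Qed.

(** The ramps are made infinitely steep in [modulus_ramp]. *)
Lemma modulus_le (C q : R) pi p (s t b : R) : rate_bound c C -> below q pi ->
  0 <= s -> s <= t -> t <= T ->
  0 <= modulus_cst C p b /\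
  b * (xc pi p t - xc pi p s) <= q + modulus_cst C p b * (t - s).
Proof.
move=> HC Hpi s0 st tT.
set K := modulus_cst C p b.
have [K0 _] := modulus_ramp T0 p b HC Hpi ltr01 s0 st tT.
split; first exact: K0.
apply/ler_addgt0Pr => e e0.
have e'0 : 0 < e / (4 * (`|b| + 1)) by rewrite divr_gt0// mulr_gt0// ltr_wpDl.
have sI : 0 <= s <= T by rewrite s0 (le_trans st).
have tI : 0 <= t <= T by rewrite tT (le_trans s0).
have xr r : 0 <= r < T -> xc pi p v @[v --> r^'+] --> xc pi p r by exact: xc_right.
have [a1 a10 H1] := ramp_average T0 (tb_xc T0 pi p) xr sI e'0.
have [a2 a20 H2] := ramp_average T0 (tb_xc T0 pi p) xr tI e'0.
pose a := Num.min (Num.min a1 a2) (e / (2 * (K + 1))).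
have K1 : 0 < 2 * (K + 1) by rewrite mulr_gt0// ltr_wpDl.
have a0 : 0 < a by rewrite !lt_min a10 a20 divr_gt0.
have aa1 : a <= a1 by rewrite !ge_min lexx.
have aa2 : a <= a2 by rewrite !ge_min lexx orbT.
have aK : a <= e / (2 * (K + 1)) by rewrite ge_min lexx orbT.
have [_ HZ] := modulus_ramp T0 p b HC Hpi a0 s0 st tT.
apply: (steep_ramp_arith HZ K0 (ltW a0) _ (H1 a _) (H2 a _) e0); rewrite ?a0//.
apply: (@le_trans _ _ ((K + 1) * (e / (2 * (K + 1))))).
  by apply: ler_pM => //; [exact: ltW|rewrite lerDl].
rewrite le_eqVlt; apply/orP; left; apply/eqP; field.
by rewrite gt_eqF// ltr_wpDl.
Qed.

Let two_sided_arith (b e y q Q z : R) : 0 < b -> b * e = 2 * (Q + 1) ->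
  b * y <= q + z -> - (b * y) <= q + z -> z <= 1 -> q <= Q -> 0 <= Q -> `|y| <= e.
Proof.
move=> b0 E h1 h2 h3 h4 Q0; rewrite ler_norml -(ler_pM2l b0) -[X in _ && X](ler_pM2l b0).
by rewrite mulrN E; apply/andP; split; lra.
Qed.

(** [modulus_le] is used with b and -b, where b is so large that q / b is small;
    then the times are taken close enough for the other term to be at most 1. *)
Lemma equicontinuous_xc q p (e : R) : 0 < e -> exists2 d, 0 < d &
  forall pi, below q pi -> forall s t, 0 <= s <= T -> 0 <= t <= T ->
  `|s - t| < d -> `|xc pi p s - xc pi p t| <= e.
Proof.
move=> e0; have [C HC] := rate_bound_ex c.
(* With this b, the bound b |x_p(t) - x_p(s)| <= q + 1 gives at most e / 2. *)
pose b := 2 * (`|q| + 1) / e.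
have b0 : 0 < b by rewrite divr_gt0// mulr_gt0// ltr_wpDl.
pose K := `|modulus_cst C p b|.
have KN : modulus_cst C p (- b) = modulus_cst C p b by rewrite /modulus_cst normrN sqrrN.
have K1 : 0 < K + 1 by apply: ltr_wpDl => //; exact: normr_ge0.
exists (1 / (K + 1)); first by rewrite divr_gt0.
suff W pi (Hpi : below q pi) s t : 0 <= s -> t <= T -> s <= t ->
    `|s - t| < 1 / (K + 1) -> `|xc pi p s - xc pi p t| <= e.
  move=> pi Hpi s t /andP[s0 sT] /andP[t0 tT] st.
  have [h|/ltW h] := leP s t; first exact: W.
  by rewrite distrC; apply: W => //; rewrite distrC.
move=> s0 tT st; rewrite [`|s - t|]distrC ger0_norm ?subr_ge0// => dst; rewrite distrC.
have [_ h1] := modulus_le p b HC Hpi s0 st tT.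
have [_ h2] := modulus_le p (- b) HC Hpi s0 st tT.
rewrite KN in h2.
have hK : modulus_cst C p b * (t - s) <= 1.
  apply: (@le_trans _ _ ((K + 1) * (t - s))).
    rewrite ler_wpM2r ?subr_ge0// (le_trans (ler_norm _))// lerDl//.
  by rewrite mulrC -ler_pdivlMr// ltW.
have hq : q <= `|q| := ler_norm q.
have bE : b * e = 2 * (`|q| + 1) by rewrite /b divfK// gt_eqF.
rewrite mulNr in h2.
exact: (two_sided_arith b0 bE h1 h2 hK hq (normr_ge0 q)).
Qed.

End Level_sets.

Section Energy_bound.
Context {R : realType} (T : R).
Hypothesis T0 : 0 < T.
Context (M : nat) (c : {ffun 'I_(M.*2.+1) -> bool} -> R) (gamma : R -> R).
Local Notation dom := (@torus_dom R).
Local Notation bd := (@bdm _ (measurableTypeR R) R dom).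
Local Notation itv := (`[0, T]%classic : set R).
Local Notation tb := (@bdm _ (measurableTypeR R) R itv).
Implicit Types (pi : cadlag (Mplus R) T).
Local Notation below := (below c gamma).

Let T0' : 0 <= T. Proof. exact: ltW. Qed.

Lemma traj_clamp pi t : pi t = pi (clamp 0 T t).
Proof.
rewrite /clamp; case: (ltP t 0) => t0.
  rewrite min_r ?(ltW (lt_trans t0 T0))// max_l ?(ltW t0)//.
  exact: traj_before.
case: (leP T t) => tT; last by rewrite max_r.
rewrite max_r//; case: (eqVneq t T) => [-> //|tNT].
by apply: traj_after; rewrite lt_neqAle eq_sym tNT.
Qed.

Lemma xc_clamp pi p t : xc pi p t = xc pi p (clamp 0 T t).
Proof. by rewrite /xc traj_clamp. Qed.

Lemma clamp_in t : 0 <= clamp 0 T t <= T.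
Proof. exact: clamp_itv. Qed.

Lemma equicontinuous_idx q (s : seq (bool * nat)) (e : R) : 0 < e ->
  exists2 d, 0 < d & forall pi, below q pi -> forall p, p \in s -> forall u v,
  `|u - v| < d -> `|xc pi p u - xc pi p v| <= e.
Proof.
move=> e0; elim: s => [|p s [d d0 Hd]]; first by exists 1.
have [d' d'0 Hd'] := equicontinuous_xc T0 c gamma q p e0.
exists (Num.min d d'); first by rewrite lt_min d0.
move=> pi Hpi p'; rewrite inE => /orP[/eqP ->|p's] u v; rewrite lt_min => /andP[h1 h2].
  rewrite xc_clamp [xc _ _ v]xc_clamp; apply: Hd' => //; try exact: clamp_in.
  exact: (le_lt_trans (clamp_lip 0 T u v)).
exact: Hd.
Qed.

Lemma continuous_xc q pi p : below q pi -> continuous (xc pi p).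
Proof.
move=> Hpi t; apply/(@cvgrPdist_le _ _ _ (nbhs t)) => e e0.
have [d d0 Hd] := equicontinuous_idx q [:: p] e0.
near=> s; apply: (Hd _ Hpi); first exact: mem_head.
near: s; exact: (nbhsx_ballx t d d0).
Unshelve. all: by end_near. Qed.

Lemma sum_flip N (F : bool * nat -> R) :
  \sum_(p <- idx N) F (flip p) = \sum_(p <- idx N) F p.
Proof. by rewrite !sum_idx; apply: eq_bigr => k _; rewrite /flip/= addrC. Qed.

(** The test function is the Fejer mean in space of the running average in time
    of the trajectory itself. *)

Section Running_average.
Variables (q : R) (pi : cadlag (Mplus R) T) (n : nat) (a : R).
Hypotheses (Hpi : below q pi) (a0 : 0 < a).
Let N := n.+1.
Let s := idx N.
Let x p := xc pi p.
Let psi (p : bool * nat) t : R := wt N p * avg a (x p) t.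
Let dpsi (p : bool * nat) t : R := wt N p * ((x p (t + a) - x p t) / a).

Let tgt1 (t : R) : 0 <= t -> -1 < t.
Proof. by apply: lt_le_trans; rewrite ltrN10. Qed.

Let cx p : continuous (x p). Proof. exact: (continuous_xc (p := p) Hpi). Qed.

Let cxs p : continuous (fun t => x p (t + a)).
Proof.
move=> t; apply: (@continuous_comp _ _ _ (fun t => t + a) (x p)); last exact: cx.
by apply: continuousD; [exact: cvg_id|exact: cst_continuous].
Qed.

Let dP p t : 0 <= t <= T -> is_derive t 1 (psi p) (dpsi p t).
Proof.
move=> /andP[t0 _]; apply: is_deriveZ.
exact: (is_derive_avg a0 (@cx p) (tgt1 t0)).
Qed.

Let cdP p t : 0 <= t <= T -> {for t, continuous (dpsi p)}.
Proof.
move=> _; apply: (@continuousZ2 _ (wt N p) (fun t => (x p (t + a) - x p t) / a)).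
apply: (@continuousM2 _ (fun t => x p (t + a) - x p t) (fun=> a^-1)).
  by move=> r; exact: (continuousB (@cxs p r) (@cx p r)).
exact: cst_continuous.
Qed.

Let smooth t u := \sum_(p <- s) (wt N p * trig p u) * x p t.

Let smooth01 t u : 0 <= smooth t u <= 1.
Proof.
have -> : smooth t u = fejer N (dens (pi (clamp 0 T t))) u.
  apply: eq_bigr => p _; rewrite coef_dens//; [|exact: Hpi.1|exact: clamp_in].
  by rewrite -xc_clamp /x; ring.
by apply: (fejer_dens01 Hpi.1); exact: clamp_in.
Qed.

Let tsepE t u : 0 <= t -> tsep s psi t u = avg a (smooth^~ u) t.
Proof.
move=> t0; rewrite -avg_sum//; last exact: tgt1.
by apply: eq_bigr => p _; rewrite /psi; ring.
Qed.

Let tsep01 t u : 0 <= t -> 0 <= tsep s psi t u <= 1.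
Proof.
move=> t0; rewrite tsepE//.
have cs : continuous (smooth^~ u) by exact: continuous_lincomb.
apply/andP; split.
  by apply: avg_ge => //; [exact: tgt1|move=> r _; have /andP[] := smooth01 r u].
by apply: avg_le => //; [exact: tgt1|move=> r _; have /andP[] := smooth01 r u].
Qed.

Let kb t : R := 4^-1 * \sum_(p <- s) psi p t ^+ 2 * freq p.2 ^+ 2.

Let bpsi p : tb (psi p). Proof. exact: (tb_psi T0 dP). Qed.

Let bkb : tb kb.
Proof.
apply: bdmZ; apply: bdm_sum => p _; apply: bdmM; last exact: bdm_cst.
by apply: bdmX; exact: bpsi.
Qed.

Let HkbP t : 0 <= t <= T ->
  tint (fun u => chi (dens (pi t) u) * dx (tsep s psi) t u ^+ 2) <= kb t.
Proof.
move=> tT.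
pose b p := psi (flip p) t * sfreq (flip p).
have dxE u : dx (tsep s psi) t u = trigpoly b N u.
  rewrite dx_tsep -sum_flip; apply: eq_bigr => p _.
  by rewrite flipK /b; ring.
have bt := bd_trigpoly b N.
have bd2 : bd (fun u => trigpoly b N u * trigpoly b N u) by exact: bdmM.
have bdens := bd_densD Hpi.1 tT.
have bchi : bd (fun u => chi (dens (pi t) u)).
  by apply: (bd_lip01 lip01_chi bdens) => u _; exact: dens01.
apply: (@le_trans _ _ (tint (fun u => 4^-1 * (trigpoly b N u * trigpoly b N u)))).
  apply: le_tint; [|exact: bdmZ|].
    apply: (@eq_bdm _ _ _ _ (fun u => chi (dens (pi t) u) * (trigpoly b N u * trigpoly b N u))).
      by move=> u _; rewrite dxE expr2.
    exact: bdmM.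
  move=> u _; rewrite dxE expr2 ler_wpM2r//; first by rewrite -expr2 sqr_ge0.
  set r := dens _ _; rewrite -subr_ge0 (_ : _ - _ = (r - 2^-1) ^+ 2) ?sqr_ge0//.
  by rewrite /chi; field.
rewrite tintZ// tint_trigpoly2 /kb ler_pM2l// -[leRHS]sum_flip.
apply: ler_sum => p _; rewrite /b -expr2 exprMn sfreq_sqr ler_piMr//.
  by rewrite mulr_ge0 ?sqr_ge0.
by have /andP[] := @nsq01 R p.
Qed.

Let HrbP t u : 0 <= t <= T -> dom u -> `|expR (tsep s psi t u) - 1| <= expR 1 /\
  `|expR (- tsep s psi t u) - 1| <= expR 1.
Proof.
move=> /andP[t0 _] _; have /andP[h0 h1] := tsep01 u t0.
set g := tsep _ _ _ _ in h0 h1 *.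
have e1 : expR g <= expR 1 by rewrite ler_expR.
have e2 : 1 <= expR g by rewrite -expR0 ler_expR.
have e3 : expR (- g) <= 1 by rewrite -[leRHS]expR0 ler_expR oppr_le0.
have e4 : 0 < expR (- g) by exact: expR_gt0.
by split; rewrite ler_norml; apply/andP; split; lra.
Qed.

Let V t : R := \sum_(p <- s) wt N p * x p t ^+ 2.

Let V01 t : 0 <= V t <= 1.
Proof.
have -> : V t = vfejer N (dens (pi (clamp 0 T t))).
  apply: eq_bigr => p _; rewrite coef_dens//; [|exact: Hpi.1|exact: clamp_in].
  by rewrite -xc_clamp.
rewrite vfejer_ge0/= vfejer_le1//; first exact: (bd_densD Hpi.1 (clamp_in t)).
move=> u _; have /andP[? ?] := dens01 (pi (clamp 0 T t)) u.
by rewrite ger0_norm.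
Qed.

Let wt0 p : p \in s -> 0 <= wt N p :> R.
Proof. by move=> /(@wt01 R)/andP[]. Qed.

Let quotient_le (w y z b : R) : 0 < b -> 0 <= w ->
  w * ((y - z) / b) * z <= (2 * b)^-1 * (w * y ^+ 2 - w * z ^+ 2).
Proof.
move=> b0 w0; rewrite -subr_ge0.
have bn0 : b != 0 by rewrite gt_eqF.
rewrite (_ : _ - _ = w * ((2 * b)^-1 * (y - z) ^+ 2)); last by field.
by apply: mulr_ge0 => //; apply: mulr_ge0; rewrite ?sqr_ge0// invr_ge0 mulr_ge0// ltW.
Qed.

Let time_term : time_int T (fun t => \sum_(p <- s) dpsi p t * xc pi p t) <= 2^-1.
Proof.
have cV : continuous V.
  have cX p : continuous (fun t => x p t ^+ 2).
    rewrite (_ : (fun t => _) = fun t => x p t * x p t).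
      by apply: continuousM2; exact: cx.
    by apply/funext => t; rewrite expr2.
  exact: (@continuous_lincomb _ _ s (fun p => wt N p) (fun p t => x p t ^+ 2) cX).
have cVs : continuous (fun t => V (t + a)).
  move=> t; apply: (@continuous_comp _ _ _ (fun t => t + a) V); last exact: cV.
  by apply: continuousD; [exact: cvg_id|exact: cst_continuous].
have bV : tb (fun t => V (t + a) - V t).
  apply: continuous_tb => t; exact: (continuousB (cVs t) (cV t)).
apply: (@le_trans _ _ ((2 * a)^-1 * time_int T (fun t => V (t + a) - V t))).
  rewrite -(timeZ T0 _ bV); apply: (le_time T0 _ (bdmZ _ bV)).
    apply: bdm_sum => p _; apply: bdmM; last exact: (tb_xc T0).
    exact: (tb_dpsi T0 cdP).
  move=> t _; rewrite /V -sumrB mulr_sumr big_seq [leRHS]big_seq.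
  apply: ler_sum => p ps; rewrite /dpsi -/(x p t).
  exact: (quotient_le _ _ a0 (wt0 ps)).
have h := time_shift_le T0 a0 cV V01.
rewrite mulrC ler_pdivrMr ?mulr_gt0//.
by rewrite mulrA mulVf ?mul1r// pnatr_eq0.
Qed.

Let average_arith (m g l1 l2 k r q' : R) : m - g - l1 + 2^-1 * l2 - 2^-1 * k - 2 * r <= q' ->
  0 <= m -> g <= 1 -> l1 <= 2^-1 -> l2 - k <= 2 * (q' + 3 / 2 + 2 * r).
Proof. by move=> *; lra. Qed.

Let termwise (A z eta w : R) : 0 <= w <= 1 -> `|z| <= 2 -> `|A - z| <= eta -> eta <= 1 ->
  w * (3 / 4 * z ^+ 2 - 2 * eta) <= w * A * z - 4^-1 * (w * A) ^+ 2.
Proof.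
move=> /andP[w0 w1] z2 Az e1.
have -> : A = z + (A - z) by rewrite addrC subrK.
set d := A - z in Az *.
have e0 : 0 <= eta by exact: le_trans Az.
have dz : - (2 * eta) <= d * z.
  have : `|d * z| <= eta * 2 by rewrite normrM ler_pM.
  by rewrite ler_norml mulrC => /andP[].
have dd : d ^+ 2 <= eta.
  rewrite -[d ^+ 2]real_normK ?num_real// expr2 (@le_trans _ _ (eta * 1))//.
    by apply: ler_pM => //; exact: le_trans e1.
  by rewrite mulr1.
have ww : (w * (z + d)) ^+ 2 <= w * (z + d) ^+ 2.
  by rewrite exprMn ler_wpM2r ?sqr_ge0// expr2 ler_piMr.
apply: (@le_trans _ _ (w * (z + d) * z - 4^-1 * (w * (z + d) ^+ 2))); last first.
  by rewrite lerD2l lerN2 ler_pM2l.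
rewrite -subr_ge0.
have -> : w * (z + d) * z - 4^-1 * (w * (z + d) ^+ 2) - w * (3 / 4 * z ^+ 2 - 2 * eta) =
  w * (2 * eta + 2^-1 * (d * z) - 4^-1 * d ^+ 2) by field.
by rewrite mulr_ge0//; lra.
Qed.

(** The linear second-order term contributes about f_p^2 x_p^2 / 2 per
    coefficient and the quadratic term at most f_p^2 x_p^2 / 8, because chi <= 1/4
    and the weights are at most 1. The difference is 3/8, up to the error [eta] of
    the running average; the time term is at most 1/2 by [time_shift_le] and the
    initial term at most 1. *)
Lemma running_average_bound (C eta : R) :
  measurable_fun [set: R] gamma -> (forall u, 0 <= gamma u <= 1) ->
  rate_bound c C -> eta <= 1 ->
  (forall p, p \in s -> forall u v, `|u - v| <= a -> `|xc pi p u - xc pi p v| <= eta) ->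
  3 / 4 * fenergy pi N - 2 * eta * (\sum_(p <- s) wt N p * freq p.2 ^+ 2) * T <=
  2 * (q + 3 / 2 + 2 * (C * (expR 1 * T))).
Proof.
move=> mg g01 HC e1 Hx.
have [pD Jq] := Hpi.
have brb : tb (fun=> expR 1) by exact: bdm_cst.
have GC := C12_tsep T0 s dP cdP.
have H := J_tsep_le T0 HC pD dP cdP (Jq _ GC) bkb brb HkbP HrbP.
have m0 : 0 <= mpair (pi T) (tsep s psi T).
  by apply: Rintegral_ge0 => u _; have /andP[] := tsep01 u T0'.
have g1 : fpair gamma (tsep s psi 0) <= 1.
  apply: tint_le_cst.
    apply: bdmM.
      split; first exact: measurable_funTS.
      by exists 1 => u _; have /andP[? ?] := g01 u; rewrite ger0_norm.
    apply: continuous_bd; have [[_ _ cG _] _ _ _ _] := GC.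
    by apply: (cylinder_cont_space _ cG); rewrite lexx T0'.
  move=> u _; have /andP[? ?] := g01 u; have /andP[? ?] := tsep01 u (lexx 0).
  by rewrite mulr_ile1.
rewrite (time_cst T0) in H.
apply: (le_trans _ (average_arith H m0 g1 time_term)).
have b2 : tb (fun t => \sum_(p <- s) psi p t * freq p.2 ^+ 2 * xc pi p t).
  apply: bdm_sum => p _; apply: bdmM; last exact: (tb_xc T0).
  by apply: bdmM; [exact: bpsi|exact: bdm_cst].
have bf := tb_fenergy_density T0 pi N.
rewrite -(timeB T0 b2 bkb) -(timeZ T0 _ bf) -(time_cst T0).
rewrite -(timeB T0 (bdmZ _ bf) (bdm_cst _ _)).
apply: (le_time T0 (bdmB (bdmZ _ bf) (bdm_cst _ _)) (bdmB b2 bkb)) => t /andP[t0 tT].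
rewrite /fenergy_density /kb !mulr_sumr -!sumrB big_seq [leRHS]big_seq.
apply: ler_sum => p ps.
set f := freq p.2 ^+ 2; have f0 : 0 <= f :> R by exact: sqr_ge0.
have ht := termwise (@wt01 R N p ps) (abs_xc_le pi p t) _ e1.
have {}ht := ht (avg a (x p) t) _.
apply: (@le_trans _ _ (f * (wt N p * (3 / 4 * xc pi p t ^+ 2 - 2 * eta)))).
  by rewrite le_eqVlt; apply/orP; left; apply/eqP; ring.
apply: (@le_trans _ _ (f * (wt N p * avg a (x p) t * xc pi p t -
    4^-1 * (wt N p * avg a (x p) t) ^+ 2))); last first.
  by rewrite le_eqVlt; apply/orP; left; apply/eqP; rewrite /psi; ring.
apply: ler_wpM2l => //; apply: ht.
apply: avg_near => //; first exact: tgt1.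
move=> r /andP[tr ra]; apply: Hx => //; rewrite ger0_norm ?subr_ge0//.
by rewrite lerBlDl.
Qed.

End Running_average.

Lemma fenergy_bound (C q : R) pi n :
  measurable_fun [set: R] gamma -> (forall u, 0 <= gamma u <= 1) ->
  rate_bound c C -> below q pi ->
  fenergy pi n.+1 <= 8 / 3 * (q + 3 / 2 + 2 * (C * (expR 1 * T))).
Proof.
move=> mg g01 HC Hpi.
set F : R := \sum_(p <- idx n.+1) wt n.+1 p * freq p.2 ^+ 2.
have F0 : 0 <= F.
  rewrite /F big_seq; apply: sumr_ge0 => p ps.
  by rewrite mulr_ge0 ?sqr_ge0//; have /andP[] := @wt01 R _ _ ps.
suff H (e : R) : 0 < e -> 3 / 4 * fenergy pi n.+1 <=
    2 * (q + 3 / 2 + 2 * (C * (expR 1 * T))) + e.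
  have : 3 / 4 * fenergy pi n.+1 <= 2 * (q + 3 / 2 + 2 * (C * (expR 1 * T))).
    by apply/ler_addgt0Pr => e; exact: H.
  by set y := fenergy _ _; set z := q + _ + _ => h; lra.
move=> e0.
have D0 : 0 < 2 * (F * T + 1) by rewrite mulr_gt0// ltr_wpDl// mulr_ge0.
pose eta := Num.min 1 (e / (2 * (F * T + 1))).
have eta0 : 0 < eta by rewrite lt_min ltr01 divr_gt0.
have eta1 : eta <= 1 by rewrite ge_min lexx.
have eta2 : eta <= e / (2 * (F * T + 1)) by rewrite ge_min lexx orbT.
have [d d0 Hd] := equicontinuous_idx q (idx n.+1) eta0.
have d20 : 0 < d / 2 by rewrite divr_gt0.
have K : forall p, p \in idx n.+1 -> forall u v, `|u - v| <= d / 2 ->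
    `|xc pi p u - xc pi p v| <= eta.
  move=> p ps u v uv; apply: (Hd _ Hpi) => //; apply: (le_lt_trans uv).
  by rewrite ltr_pdivrMr// ltr_pMr// ltr1n.
have := running_average_bound Hpi d20 mg g01 HC eta1 K; rewrite -/F.
set X := 2 * (_ + _); set Y := 3 / 4 * _.
have : 2 * eta * F * T <= e.
  apply: (@le_trans _ _ (eta * (2 * (F * T + 1)))); last by rewrite -ler_pdivlMr.
  rewrite -subr_ge0 (_ : _ - _ = 2 * eta); first by rewrite mulr_ge0// ltW.
  by ring.
by set Z := 2 * eta * F * T => *; lra.
Qed.

End Energy_bound.

(** * Limits along an ultrafilter *)

Section Ultralimits.
Context {R : realType}.

Lemma three_close (x y x' y' e : R) : `|x - x'| <= e / 3 -> `|x' - y'| <= e / 3 ->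
  `|y - y'| <= e / 3 -> `|x - y| <= e.
Proof.
move=> h1 h2 h3; rewrite (_ : x - y = (x - x') + (x' - y') - (y - y')); last by ring.
apply: (le_trans (ler_normB _ _)).
rewrite [leRHS](_ : _ = e / 3 + e / 3 + e / 3); last by field.
by apply: lerD => //; apply: (le_trans (ler_normD _ _)); exact: lerD.
Qed.

Lemma ultra_lim01 (I : Type) (F : set_system I) (f : I -> R) : UltraFilter F ->
  (forall i, 0 <= f i <= 1) -> exists2 l : R, 0 <= l <= 1 & f i @[i --> F] --> l.
Proof.
move=> FU f01.
have F01 : (f i @[i --> F]) (`[0, 1]%classic : set R).
  by apply: (@filterE _ F) => i; rewrite /= in_itv/=.
have [l [l01 cl]] := @segment_compact R 0 1 _ _ F01.
exists l; first by move: l01; rewrite /= in_itv.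
move=> A nA; have [//|FC] := in_ultra_setVsetC (f @^-1` A) FU.
have [x [Cx Ax]] := cl (~` A) A FC nA.
by case: Cx.
Qed.

Lemma cvg_lincomb (I J : Type) (F : set_system I) (s : seq J) (a : J -> R)
    (x : J -> I -> R) (y : J -> R) : Filter F ->
  (forall j, x j i @[i --> F] --> y j) ->
  \sum_(j <- s) a j * x j i @[i --> F] --> \sum_(j <- s) a j * y j.
Proof.
move=> FF xy; elim: s => [|j s IH].
  by under eq_fun do rewrite big_nil; rewrite big_nil; exact: cvg_cst.
under eq_fun do rewrite big_cons; rewrite big_cons.
by apply: cvgD => //; apply: cvgMr.
Qed.

(** For a finitely additive function the defect of countable additivity is the
    mass of a remainder, which the dominating measure makes small. *)
Lemma dominated_sigma_additive d (X : measurableType d) (nu : {measure set X -> \bar R})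
    (l : set X -> R) : (nu [set: X] < +oo)%E -> l set0 = 0 ->
  (forall A, measurable A -> 0 <= l A <= fine (nu A)) ->
  (forall A B, measurable A -> measurable B -> A `&` B = set0 ->
    l (A `|` B) = l A + l B) ->
  semi_sigma_additive (fun A => (l A)%:E).
Proof.
move=> nufin l0 lnu lU A mA tA mB.
have fn B : measurable B -> nu B \is a fin_num.
  move=> mB'; rewrite ge0_fin_numE//; apply: le_lt_trans nufin.
  by apply: le_measure; rewrite ?inE.
have nuU C D : measurable C -> measurable D -> C `&` D = set0 ->
    fine (nu (C `|` D)) = fine (nu C) + fine (nu D).
  by move=> mC mD CD; rewrite measureU// fineD// fn.
pose C n := \big[setU/set0]_(i < n) A i.
have mC n : measurable (C n) by apply: bigsetU_measurable.
have CS n : C n.+1 = C n `|` A n by rewrite /C big_ord_recr.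
have CA n : C n `&` A n = set0.
  have := @trivIset_bigsetUI _ xpredT A _ n n isT (leqnn n).
  by apply => i j _ _; exact: tA.
have key (h : set X -> R) : h set0 = 0 ->
    (forall A B, measurable A -> measurable B -> A `&` B = set0 ->
      h (A `|` B) = h A + h B) ->
    forall n, h (\bigcup_i A i) - \sum_(i < n) h (A i) = h (\bigcup_i A i `\` C n).
  move=> h0 hU n.
  have -> : \sum_(i < n) h (A i) = h (C n).
    elim: n => [|n IH]; first by rewrite big_ord0 /C big_ord0.
    by rewrite big_ord_recr/= IH CS hU.
  have {1}-> : \bigcup_i A i = C n `|` (\bigcup_i A i `\` C n).
    rewrite setDUK// /C -bigcup_mkord.
    by apply: bigcup_sub => i _; exact: bigcup_sup.
  rewrite hU//; last by rewrite setIDA setIC -setIDA setDv setI0.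
    by rewrite addrC addKr.
  exact: measurableD.
have sE : (fun n => (\sum_(0 <= i < n) (l (A i))%:E)%E) =
    (fun n => (\sum_(i < n) l (A i))%:E).
  by apply/funext => n; rewrite big_mkord sumEFin.
rewrite sE; apply/fine_cvgP; split; first by apply: filterE.
have /fine_cvgP[_ H] : (fun n => (\sum_(0 <= i < n) nu (A i))%E) @ \oo -->
    (fine (nu (\bigcup_i A i)))%:E.
  by rewrite fineK ?fn//; exact: measure_semi_sigma_additive.
have {}H : (fun n => \sum_(i < n) fine (nu (A i))) @ \oo --> fine (nu (\bigcup_i A i)).
  apply: cvg_trans H; apply: near_eq_cvg; apply: filterE => n /=.
  rewrite big_mkord (eq_bigr (fun i : 'I_n => (fine (nu (A i)))%:E)) ?sumEFin//.
  by move=> i _; rewrite fineK ?fn.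
apply/cvgrPdist_le => e e0; move/cvgrPdist_le : H => /(_ e e0).
apply: filterS => n /=.
rewrite (key (fun A => fine (nu A)))// ?measure0// (key l)//.
have mD : measurable (\bigcup_i A i `\` C n) by exact: measurableD.
have /andP[h1 h2] := lnu _ mD.
by rewrite (ger0_norm h1); apply: le_trans; rewrite (le_trans h2)// ler_norm.
Qed.

Local Notation mu := (@lebesgue_measure R).
Local Notation dom := (@torus_dom R).
Local Notation bd := (@bdm _ (measurableTypeR R) R dom).

Let mdom : measurable (dom : set (measurableTypeR R)).
Proof. exact: measurable_dom. Qed.

Lemma Mplus1_dominated (mm : Mplus R) (A : set R) : Mplus1 mm -> measurable A ->
  fine ((mm : @torus_measure R) A) <= fine (mrestr mu mdom A).
Proof.
move=> H mA; rewrite meas_density// -Rintegral_indic//.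
have bA : bd (\1_A : R -> R) by exact: bdm_indic.
apply: le_tint => //; first by apply: bdmM => //; exact: bd_dens.
move=> u _; have /andP[? ?] := dens01 mm u.
by rewrite ler_piMl// indicE.
Qed.

Lemma torus_measure_le1 (mm : @torus_measure R) (A : set (measurableTypeR R)) :
  measurable A -> (mm A <= 1)%E.
Proof.
move=> mA; apply: (@le_trans _ _ (mm setT)); last exact: sprobability_setT.
by apply: le_measure; rewrite ?inE.
Qed.

Lemma torus_measure_dom (m : @torus_measure R) (A : set R) : measurable (A : set (measurableTypeR R)) ->
  m A = m (A `&` dom).
Proof.
move=> mA.
have mAd : measurable (A `&` dom : set (measurableTypeR R)) by exact: measurableI.
have mC : measurable (~` dom : set (measurableTypeR R)) by exact: measurableC.
have mAC : measurable (A `&` ~` dom : set (measurableTypeR R)) by exact: measurableI.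
have mC0 : m (A `&` ~` dom) = 0%E.
  apply/eqP; rewrite eq_le measure_ge0 andbT -(torus_measP m).
  by apply: le_measure; rewrite ?inE.
have dis : (A `&` dom) `&` (A `&` ~` dom) = set0 by rewrite setIACA setICr setI0.
have AU : A = (A `&` dom) `|` (A `&` ~` dom) by rewrite -setIUr setUv setIT.
have E : m A = (m (A `&` dom) + m (A `&` ~` dom))%E.
  by rewrite {1}AU; exact: (measureU m mAd mAC dis).
by rewrite mC0 adde0 in E.
Qed.

(** Where a Radon-Nikodym density exceeds 1, its integral would exceed the
    Lebesgue measure; hence it does so on a null set only. *)
Lemma dominated_density (P : subprobability (measurableTypeR R) R)
    (P0 : P (~` torus_dom) = 0%E) :
  (forall A, measurable A -> (P A <= mrestr mu mdom A)%E) ->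
  Mplus1 (TorusMeasure P0 : Mplus R).
Proof.
move=> Pmu.
have ac : P `<< (mu : set (measurableTypeR R) -> \bar R).
  apply/null_content_dominatesP => A mA A0.
  apply/eqP; rewrite eq_le measure_ge0 andbT (le_trans (Pmu _ mA))//.
  by rewrite -A0; apply: le_measure; rewrite ?inE//; exact: measurableI.
have [f [f0 ffin fint fE]] := radon_nikodym_sigma_finite ac.
have mf : measurable_fun setT f by exact: (measurable_int _ fint).
(* On the set where the density exceeds 1, its excess has integral at most 0. *)
have le1 : {ae mu, forall u, dom u -> (f u <= 1)%E}.
  pose A := dom `&` [set u | (1 < f u)%E].
  have mA : measurable (A : set (measurableTypeR R)).
    apply: measurableI => //; rewrite -[X in measurable X]setTI.
    exact: emeasurable_fun_o_infty.
  have A1 : (P A <= mu A)%E.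
    apply: (le_trans (Pmu _ mA)); rewrite /mrestr.
    by apply: le_measure; rewrite ?inE//; exact: measurableI.
  have Afin : (mu A < +oo)%E.
    apply: (@le_lt_trans _ _ (mu dom)); last by rewrite lebesgue_dom ltry.
    by apply: le_measure; rewrite ?inE// => u [].
  have i0 : (\int[mu]_(x in A) `|f x - 1| = 0)%E.
    rewrite (eq_integral (fun x => f x - 1))%E; last first.
      move=> x; rewrite inE => -[_ /=].
      rewrite -(fineK (ffin x)) lte_fin => fx1.
      by rewrite -EFinB abse_EFin ger0_norm// subr_ge0 ltW.
    rewrite integralB//.
    - rewrite integral_cst// mul1e -fE//; apply/eqP; rewrite eq_le.
      apply/andP; split; first by rewrite sube_le0.
      rewrite fE// -[X in (_ <= _ - X)%E]mul1e -integral_cst// sube_ge0; last first.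
        by apply/orP; left; rewrite integral_cst// mul1e ge0_fin_numE.
      apply: ge0_le_integral => //.
      + by apply: measurable_funTS.
      + by move=> x [_ /= /ltW].
    - exact: integrableS fint.
    - apply/integrableP; split => //.
      by rewrite (eq_integral (cst 1%E)) ?integral_cst ?mul1e// => x _; rewrite /= normr1.
  have mfA : measurable_fun A (fun x => f x - 1)%E.
    by apply: emeasurable_funB => //; exact: measurable_funTS.
  have /(ae_eq_integral_abs _ mA mfA) H := i0.
  apply: ae_lebesgueS H => u H du; rewrite leNgt; apply/negP => fu.
  have /eqP := H (conj du fu); rewrite sube_eq ?ffin// add0e => /eqP E.
  by rewrite E ltxx in fu.
pose rho u := clamp 0 1 (fine (f u)).
exists rho; split.
- apply: measurable_funTS; apply: (@measurableT_comp _ _ _ _ _ _ (clamp 0 1)).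
    by apply: continuous_measurable_fun; exact: continuous_clamp.
  exact: measurableT_comp.
- apply: (ae_lebesgueS _ le1) => u _ _; exact: clamp_itv.
- move=> A mA; have mAd : measurable ((A `&` dom) : set (measurableTypeR R)).
    exact: measurableI.
  have -> : (TorusMeasure P0 : @torus_measure R) A = P (A `&` dom).
    exact: torus_measure_dom.
  rewrite fE//; apply: ae_eq_integral => //.
  + exact: measurable_funTS.
  + apply/measurable_EFinP/measurable_funTS.
    apply: (@measurableT_comp _ _ _ _ _ _ (clamp 0 1)).
      by apply: continuous_measurable_fun; exact: continuous_clamp.
    exact: measurableT_comp.
  + apply: (ae_lebesgueS _ le1) => u H [_ du].
    rewrite /rho clamp_id ?fineK ?ffin//.
    by rewrite -!lee_fin fineK ?ffin// f0 H.
Qed.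

Section Static_limit.
Context {I : Type} {F : set_system I} {FU : UltraFilter F} (m : I -> Mplus R).
Hypothesis Fm : F [set i | Mplus1 (m i)].

(** Masses lie in the compact interval [0, 1], so they converge set by set. *)
Lemma ultra_set_limit : exists l : set R -> R, (forall A, 0 <= l A <= 1) /\
  forall A : set (measurableTypeR R), measurable A ->
    fine ((m i : @torus_measure R) A) @[i --> F] --> l A.
Proof.
have ex (A : set R) : exists l : R, 0 <= l <= 1 /\
    (clamp 0 1 (fine ((m i : @torus_measure R) A)) @[i --> F] --> l).
  have [l l01 Hl] := @ultra_lim01 I F
    (fun i => clamp 0 1 (fine ((m i : @torus_measure R) A))) FU
    (fun i => clamp_itv _ ler01).
  by exists l.
have [l Hl] := choice ex; exists l; split => [A|A mA]; first exact: (Hl A).1.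
have [_ H] := Hl A; apply: cvg_trans H; apply: near_eq_cvg.
apply: (@filterE _ F) => i; rewrite clamp_id//.
have h := torus_measure_le1 (m i) mA.
have hf : (m i : @torus_measure R) A \is a fin_num.
  by rewrite ge0_fin_numE// (le_lt_trans h)// ltry.
by rewrite fine_ge0//= -lee_fin fineK.
Qed.

Lemma ultra_density : exists2 mm : Mplus R, Mplus1 mm &
  forall g, continuous g -> mpair (m i) g @[i --> F] --> mpair mm g.
Proof.
have [l [l01 lim]] := ultra_set_limit.
have PF : ProperFilter F := ultra_proper.
have FF : Filter F by exact: PF.
have mfin i A : measurable A -> (m i : @torus_measure R) A \is a fin_num.
  move=> mA; rewrite ge0_fin_numE// (le_lt_trans (torus_measure_le1 (m i) mA))//.
  exact: ltry.
have l0 : l set0 = 0.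
  have := lim set0 measurable0; under eq_fun do rewrite measure0.
  by move/cvg_lim => <-//; rewrite lim_cst.
have lU A B : measurable A -> measurable B -> A `&` B = set0 ->
    l (A `|` B) = l A + l B.
  move=> mA mB AB; apply: (cvg_unique _ (lim _ (measurableU _ _ mA mB))) => //=.
  rewrite (_ : (fun i => _) = fun i => fine ((m i : @torus_measure R) A) +
      fine ((m i : @torus_measure R) B)).
    by apply: cvgD; exact: lim.
  by apply/funext => i; rewrite measureU// fineD// mfin.
have lmu A : measurable A -> 0 <= l A <= fine (mrestr mu mdom A).
  move=> mA; have /andP[-> _] := l01 A; rewrite /=.
  apply: (@closed_cvg _ _ F _ (fun i => fine ((m i : @torus_measure R) A))
    [set x | x <= fine (mrestr mu mdom A)]); [exact: closed_le| |exact: lim].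
  by apply: filterS Fm => i Hi; exact: Mplus1_dominated.
have rT : (mrestr mu mdom [set: R] < +oo)%E by rewrite /mrestr setTI lebesgue_dom ltry.
have rfin A : measurable A -> mrestr mu mdom A \is a fin_num.
  move=> mA; rewrite ge0_fin_numE//; apply: le_lt_trans rT.
  by apply: le_measure; rewrite ?inE.
pose mu0 : set (measurableTypeR R) -> \bar R := fun A => (l A)%:E.
have sa : semi_sigma_additive mu0.
  exact: (dominated_sigma_additive (nu := mrestr mu mdom) rT l0 lmu lU).
have mu00 : mu0 set0 = 0%E by rewrite /mu0 l0.
have mu0ge0 A : (0 <= mu0 A)%E by rewrite /mu0 lee_fin; have /andP[] := l01 A.
pose mix := isMeasure.Build _ _ _ mu0 mu00 mu0ge0 sa.
pose mm : {measure set (measurableTypeR R) -> \bar R} := HB.pack mu0 mix.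
have mmT : (mm setT <= 1)%E by rewrite /= /mu0 lee_fin; have /andP[] := l01 setT.
pose mix2 := Measure_isSubProbability.Build _ _ _ mm mmT.
pose P : subprobability (measurableTypeR R) R := HB.pack mu0 mix mix2.
have Pmu A : measurable A -> (P A <= mrestr mu mdom A)%E.
  move=> mA; rewrite /= /mu0 -(fineK (rfin _ mA)) lee_fin.
  by have /andP[] := lmu A mA.
have P0 : P (~` torus_dom) = 0%E.
  apply/eqP; rewrite eq_le measure_ge0 andbT (le_trans (Pmu _ _))//.
    exact: measurableC.
  by rewrite /mrestr setICl measure0.
exists (TorusMeasure P0 : Mplus R); first exact: dominated_density.
move=> g cg; apply/cvgrPdist_le => e e0.
have e30 : 0 < e / 3 by rewrite divr_gt0.
have [n _ /(_ n (leqnn n)) Hn] := stepf_approx_continuous cg e30.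
have close (q : @torus_measure R) : `|mpair q g - mpair q (stepf n g)| <= e / 3.
  have bs : bd (stepf n g) := bdm_stepf n g _.
  rewrite -mpairB//; last exact: continuous_bd.
  apply: abs_mpair_le => //; [exact: ltW|].
  by apply: bdmB => //; exact: continuous_bd.
have cs : mpair (m i) (stepf n g) @[i --> F] --> mpair (TorusMeasure P0) (stepf n g).
  under eq_fun do rewrite mpair_stepf.
  rewrite mpair_stepf; apply: cvg_lincomb => j.
  by apply: lim; exact: measurable_cell.
have /cvgrPdist_le /(_ _ e30) := cs; apply: filterS => i Hi.
exact: three_close (close (TorusMeasure P0)) Hi (close (m i)).
Qed.

End Static_limit.

End Ultralimits.

Section Path_limit.
Context {R : realType} (T : R).
Hypothesis T0 : 0 < T.
Context (M : nat) (c : {ffun 'I_(M.*2.+1) -> bool} -> R) (gamma : R -> R).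
Hypothesis gamma_measurable : measurable_fun [set: R] gamma.
Hypothesis gamma01 : forall u, 0 <= gamma u <= 1.
Local Notation dom := (@torus_dom R).
Local Notation bd := (@bdm _ (measurableTypeR R) R dom).
Local Notation itv := (`[0, T]%classic : set R).
Implicit Types (pi : cadlag (Mplus R) T).
Local Notation below := (below c gamma).

Let T0' : 0 <= T. Proof. exact: ltW. Qed.

(** Pairings with all test functions are uniform limits, over all measures at
    once, of combinations of finitely many Fourier coefficients. *)
Lemma mpair_fejer (g : R -> R) (e : R) : continuous g -> periodic1 g -> 0 < e ->
  exists N, forall mm : Mplus R,
    `|mpair mm g - \sum_(p <- idx N) (wt N p * coef g p) * mpair mm (trig p)| <= e.
Proof.
move=> cg pg e0; have [N _ /(_ N (leqnn N)) HN] := fejer_cvg cg pg e0.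
exists N => mm.
have bt p : bd (fun u => wt N p * coef g p * trig p u) by apply: bdmZ; exact: bd_trig.
have -> : \sum_(p <- idx N) (wt N p * coef g p) * mpair mm (trig p) = mpair mm (fejer N g).
  rewrite /fejer /trigpoly (mpair_sum mm)//; apply: eq_bigr => p _.
  by rewrite mpairZ//; exact: bd_trig.
rewrite -(mpairB mm (continuous_bd cg) (bd_fejer N g)).
apply: abs_mpair_le => //; first exact: ltW.
exact: (bdmB (continuous_bd cg) (bd_fejer N g)).
Qed.

Lemma equicontinuous_test q (g : R -> R) (e : R) : continuous g -> periodic1 g ->
  0 < e -> exists2 d, 0 < d & forall pi, below q pi -> forall u v,
  `|u - v| < d -> `|mpair (pi u) g - mpair (pi v) g| <= e.
Proof.
move=> cg pg e0; have e30 : 0 < e / 3 by rewrite divr_gt0.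
have [N HN] := mpair_fejer cg pg e30.
pose a p : R := wt N p * coef g p.
pose S : R := \sum_(p <- idx N) `|a p|.
have S0 : 0 <= S by apply: sumr_ge0.
have eS : 0 < e / 3 / (S + 1) by rewrite divr_gt0// ltr_wpDl.
have [d d0 Hd] := equicontinuous_idx T0 c gamma q (idx N) eS.
exists d => // pi Hpi u v uv.
apply: (three_close (HN (pi u)) _ (HN (pi v))).
rewrite -sumrB (le_trans (ler_norm_sum _ _ _))//.
apply: (@le_trans _ _ (S * (e / 3 / (S + 1)))).
  rewrite mulr_suml big_seq [leRHS]big_seq; apply: ler_sum => p ps.
  by rewrite -mulrBr normrM ler_wpM2l//; exact: (Hd _ Hpi _ ps _ _ uv).
by rewrite mulrCA ler_piMr ?(ltW e30)// ler_pdivrMr ?mul1r ?lerDl// ltr_wpDl.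
Qed.

Definition eval_at (t : R) (g : R -> R) pi : R := mpair (pi t) g.

Section Ultra.
Context (q : R) (F : set_system (cadlag (Mplus R) T)) {FU : UltraFilter F}.
Hypothesis Fq : F [set pi : cadlag (Mplus R) T | below q pi].

Let PF : ProperFilter F := ultra_proper.
Let FF : Filter F. Proof. exact: PF. Qed.

Let lim_ex : exists y : R -> Mplus R, forall t, Mplus1 (y t) /\
  forall g, continuous g -> eval_at t g @ F --> mpair (y t) g.
Proof.
suff ex t : exists y : Mplus R, Mplus1 y /\
    forall g, continuous g -> eval_at t g @ F --> mpair y g.
  by have [y Hy] := choice ex; exists y.
have Ft : F [set pi : cadlag (Mplus R) T | Mplus1 (pi t)].
  apply: filterS Fq => pi [pD _]; rewrite /= (traj_clamp T0).
  by apply: pD; rewrite in_itv/=; exact: clamp_in.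
by have [mm mm1 H] := ultra_density Ft; exists mm; split.
Qed.

Let lim_equicontinuous (y : R -> Mplus R) (g : R -> R) (e : R) :
  (forall t, Mplus1 (y t) /\
    forall g, continuous g -> eval_at t g @ F --> mpair (y t) g) ->
  continuous g -> periodic1 g -> 0 < e ->
  exists2 d, 0 < d & forall u v, `|u - v| < d -> `|mpair (y u) g - mpair (y v) g| <= e.
Proof.
move=> Hy cg pg e0; have [d d0 Hd] := equicontinuous_test q cg pg e0.
exists d => // u v uv.
have h : (fun pi : cadlag (Mplus R) T => `|eval_at u g pi - eval_at v g pi|) @ F -->
    `|mpair (y u) g - mpair (y v) g|.
  by apply: cvg_norm; apply: cvgB; exact: (Hy _).2.
apply: (closed_cvg (F := F) _ (@closed_le _ e) _ _ h).
by apply: filterS Fq => pi Hpi; exact: Hd.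
Qed.

(** The limit is taken separately at each time of [0, T] and extended by
    constants. Bounds on increments pass to the limit, so the result is
    continuous, in particular right continuous with left limits. *)
Lemma ultra_path : exists pil : cadlag (Mplus R) T, [/\ D1 pil,
  forall t g, continuous g -> eval_at t g @ F --> mpair (pil t) g &
  forall (g : torus_test) (e : R), 0 < e -> exists2 d, 0 < d & forall u v,
    `|u - v| < d -> `|mpair (pil u) g - mpair (pil v) g| <= e].
Proof.
have [y Hy] := lim_ex.
pose z t := y (clamp 0 T t).
have eqc (g : torus_test) (e : R) : 0 < e -> exists2 d, 0 < d & forall u v,
    `|u - v| < d -> `|mpair (z u) g - mpair (z v) g| <= e.
  move=> e0; have [d d0 Hd] := lim_equicontinuous Hy
    (@torus_fun_continuous _ g) (@torus_fun_periodic _ g) e0.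
  by exists d => // u v uv; apply: Hd; exact: (le_lt_trans (clamp_lip 0 T u v)).
have cz t : z s @[s --> t] --> z t.
  apply: cvg_Mplus => g; apply/(@cvgrPdist_le _ _ _ (nbhs t)) => e e0.
  have [d d0 Hd] := eqc g e e0.
  near=> s; apply: Hd; near: s; exact: (nbhsx_ballx t d d0).
have zr t : 0 <= t < T -> z s @[s --> t^'+] --> z t.
  by move=> _; apply: cvg_trans (cz t); apply: cvg_app; exact: cvg_within.
have zl t : 0 < t <= T -> exists l : Mplus R, z s @[s --> t^'-] --> l.
  by move=> _; exists (z t); apply: cvg_trans (cz t); apply: cvg_app; exact: cvg_within.
have zb t : t < 0 -> z t = z 0.
  move=> t0; rewrite /z; congr y; rewrite [RHS]clamp_id ?lexx//.
  by rewrite /clamp min_r ?(ltW (lt_trans t0 T0))// max_l// ltW.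
have za t : T < t -> z t = z T.
  move=> tT; rewrite /z; congr y; rewrite [RHS]clamp_id ?lexx ?T0'//.
  by rewrite /clamp min_l ?(ltW tT)// max_r.
exists (Cadlag zr zl zb za); split => //.
- by move=> t _; exact: (Hy _).1.
- move=> t g cg; have := (Hy (clamp 0 T t)).2 g cg; apply: cvg_trans.
  rewrite (_ : eval_at t g = eval_at (clamp 0 T t) g)//; apply/funext => pi.
  by rewrite /eval_at [in LHS](traj_clamp T0).
Unshelve. all: by end_near. Qed.

(** Equicontinuity of the trajectories and of the limit spreads the convergence
    at one time to a neighbourhood of it; finitely many of these cover [0, T]. *)
Lemma ultra_uniform (pil : cadlag (Mplus R) T) (g : torus_test) (e : R) :
  (forall t g, continuous g -> eval_at t g @ F --> mpair (pil t) g) ->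
  (forall (g : torus_test) (e : R), 0 < e -> exists2 d, 0 < d & forall u v,
    `|u - v| < d -> `|mpair (pil u) g - mpair (pil v) g| <= e) -> 0 < e ->
  F [set pi : cadlag (Mplus R) T | forall t, 0 <= t <= T -> `|mpair (pil t) g - mpair (pi t) g| < e].
Proof.
move=> Hlim Heq e0.
have cg := @torus_fun_continuous _ g; have pg := @torus_fun_periodic _ g.
have e40 : 0 < e / 2 / 3 by rewrite !divr_gt0.
have [d1 d10 H1] := equicontinuous_test q cg pg e40.
have [d2 d20 H2] := Heq g _ e40.
have /compact_near_coveringP cov : compact (`[0, T]%classic : set R) by exact: segment_compact.
have := cov _ F (fun pi t => `|mpair (pil t) g - mpair (pi t) g| < e) FF.
move=> K; apply: filterS (K _) => [pi {}K t tT|t _]; first by apply: K; rewrite /= in_itv.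
pose d := Num.min d1 d2.
have d0 : 0 < d by rewrite lt_min d10.
exists (ball t d, [set pi : cadlag (Mplus R) T | below q pi /\ `|mpair (pil t) g - mpair (pi t) g| <= e / 2 / 3]).
  split => /=; first exact: nbhsx_ballx.
  apply: filterI => //.
  by have /cvgrPdist_le /(_ _ e40) := Hlim t g cg.
move=> [t' pi] /= [+ [Hpi Hc]]; rewrite /ball/= lt_min => /andP[b1 b2].
apply: (@le_lt_trans _ _ (e / 2)); last by rewrite ltr_pdivrMr// ltr_pMr// ltr1n.
apply: (three_close _ Hc).
  by apply: H2; rewrite distrC.
by apply: H1 => //; rewrite distrC.
Qed.

Lemma ultra_skorokhod (pil : cadlag (Mplus R) T) :
  (forall (g : torus_test) (e : R), 0 < e ->
   F [set pi : cadlag (Mplus R) T | forall t, 0 <= t <= T -> `|mpair (pil t) g - mpair (pi t) g| < e]) ->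
  F --> pil.
Proof.
move=> H; apply/cvg_entourageP => A entA.
move: entA; rewrite /entourage/= => -[[d U] [/= d0 entU] sA].
have := @entourage_Mplus_near R U _ F
  (fun pi => [set mm | exists2 t, 0 <= t <= T & mm = (pil t, pi t)]) FF entU.
move=> K; apply: filterS (K _) => [pi {}K|].
  apply: sA => /=; exists id; first exact: time_change_id.
  move=> t tT; rewrite subrr normr0; split => //.
  by apply: K => /=; exists t => //; move: tT; rewrite in_itv.
move=> g e e0; apply: filterS (H g e e0) => pi {}K mm [t tT ->] /=.
exact: K.
Qed.

Let abs_sqr_le (x y eta : R) : `|x| <= 2 -> `|y| <= 2 -> `|x - y| <= eta ->
  x ^+ 2 <= y ^+ 2 + 4 * eta.
Proof.
move=> hx hy h; rewrite -lerBlDl subr_sqr (le_trans (ler_norm _))// normrM.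
rewrite mulrC; apply: ler_pM => //; rewrite (le_trans (ler_normD _ _))//.
by rewrite [leRHS](_ : _ = 2 + 2) ?lerD//; ring.
Qed.

(** The Fourier energy is a finite sum, and its coefficients converge uniformly in
    time. *)
Lemma ultra_fenergy (pil : cadlag (Mplus R) T) (K : R) N :
  (forall p (e : R), 0 < e ->
   F [set pi : cadlag (Mplus R) T | forall t, 0 <= t <= T -> `|xc pil p t - xc pi p t| < e]) ->
  (forall pi, below q pi -> fenergy pi N <= K) -> fenergy pil N <= K.
Proof.
move=> H HK; apply/ler_addgt0Pr => e e0.
set S : R := \sum_(p <- idx N) wt N p * freq p.2 ^+ 2.
have S0 : 0 <= S.
  rewrite /S big_seq; apply: sumr_ge0 => p ps.
  by rewrite mulr_ge0 ?sqr_ge0//; have /andP[] := @wt01 R _ _ ps.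
have D0 : 0 < 4 * S * T + 1 by rewrite ltr_wpDl// !mulr_ge0.
pose eta := e / (4 * S * T + 1).
have eta0 : 0 < eta by rewrite divr_gt0.
have : F [set pi : cadlag (Mplus R) T | forall p, p \in idx N -> forall t, 0 <= t <= T ->
    `|xc pil p t - xc pi p t| < eta].
  elim: (idx N) => [|p s IH]; first by apply: (@filterE _ F).
  apply: filterS (filterI (H p eta eta0) IH) => pi [h1 h2] p'.
  by rewrite inE => /orP[/eqP ->|/h2].
move=> /(filterI Fq) /filter_ex[pi [Hpi Hc]].
apply: (@le_trans _ _ (fenergy pi N + 4 * eta * S * T)); last first.
  apply: lerD; first exact: HK.
  rewrite (_ : 4 * eta * S * T = eta * (4 * S * T)); last by ring.
  rewrite /eta mulrAC ler_pdivrMr// ler_pM2l// lerDl//.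
have b1 := tb_fenergy_density T0 pil N; have b2 := tb_fenergy_density T0 pi N.
rewrite -(time_cst T0) /fenergy -(timeD T0 b2 (bdm_cst _ _)).
apply: (le_time T0 b1 (bdmD b2 (bdm_cst _ _))) => t tT.
rewrite /fenergy_density mulr_sumr -big_split/= big_seq [leRHS]big_seq.
apply: ler_sum => p ps.
have w0 : 0 <= wt N p * freq p.2 ^+ 2 :> R.
  by rewrite mulr_ge0 ?sqr_ge0//; have /andP[] := @wt01 R _ _ ps.
rewrite [4 * eta * _]mulrC -mulrDr; apply: ler_wpM2l => //.
apply: abs_sqr_le; [exact: abs_xc_le|exact: abs_xc_le|].
by apply: ltW; exact: Hc.
Qed.

Let eps_split (J q0 m K eps e T' I J' : R) : 0 <= K -> 0 < e -> 0 <= T' ->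
  `|J - J'| <= m + K * (e * T' + I / e) -> J' <= q0 -> m <= eps / 3 ->
  e * (3 * (K * T' + 1)) = eps -> I * (3 * (K + 1)) <= eps * e -> 0 <= I ->
  J <= q0 + eps.
Proof.
move=> K0 e0 T'0; rewrite ler_distl => /andP[_ h1] h2 h3 h4 h5 I0.
have h6 : 0 <= I / e by rewrite divr_ge0// ltW.
have h7 : K * (I / e) <= eps / 3.
  have h8 : I / e * (3 * (K + 1)) <= eps by rewrite mulrAC ler_pdivrMr.
  have h9 : 0 <= K * (I / e) by exact: mulr_ge0.
  have : I / e * (3 * (K + 1)) = 3 * (K * (I / e)) + 3 * (I / e) by ring.
  by move=> E; rewrite E in h8; lra.
have h8 : K * (e * T') <= eps / 3.
  have E : e * (3 * (K * T' + 1)) = 3 * (K * (e * T')) + 3 * e by ring.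
  by rewrite E in h4; lra.
have E : K * (e * T' + I / e) = K * (e * T') + K * (I / e) by ring.
by rewrite E in h1; lra.
Qed.

Let small_L2 (L : nat) (K B f eta I T' : R) : (0 < L)%N -> 0 < B -> L%:R <= f ->
  8 * `|K| / B <= L%:R -> 0 <= eta <= 1 -> eta * (4 * L%:R * T') <= B -> 0 <= T' ->
  I <= 2 * L%:R * eta ^+ 2 * T' + 4 * K / f ^+ 2 -> I <= B.
Proof.
move=> L0 B0 Lf KL /andP[e0 e1] eB T'0 /le_trans; apply.
have l1 : 1 <= L%:R :> R by rewrite ler1n.
have l0 : 0 < L%:R :> R by rewrite ltr0n.
have f0 : 0 < f by exact: lt_le_trans Lf.
have h1 : 2 * L%:R * eta ^+ 2 * T' <= B / 2.
  have h : eta ^+ 2 <= eta by rewrite expr2 ler_piMr.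
  apply: (@le_trans _ _ (2 * L%:R * eta * T')).
    by rewrite ler_wpM2r// ler_wpM2l// mulr_ge0// ltW.
  have E : eta * (4 * L%:R * T') = 2 * (2 * L%:R * eta * T') by ring.
  by rewrite E in eB; set z := 2 * L%:R * eta * T' in eB *; lra.
have h2 : 4 * K / f ^+ 2 <= B / 2.
  rewrite ler_pdivrMr ?exprn_gt0//.
  have f2 : L%:R <= f ^+ 2.
    have f1 : 1 <= f := le_trans l1 Lf.
    by rewrite expr2; apply: (le_trans Lf); exact: ler_peMl (ltW f0) f1.
  rewrite ler_pdivrMr// in KL.
  have h3 : B * L%:R <= B * f ^+ 2 by rewrite ler_pM2l.
  have := ler_norm K; set y := f ^+ 2 in h3 *.
  have -> : B / 2 * y = (B * y) / 2 by field.
  by rewrite mulrC in KL => h4; lra.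
lra.
Qed.

(** For a given test function G and a given precision, some trajectory of the
    level set is so close to the limit that their values of J_G nearly agree. *)
Lemma ultra_limit : exists2 pil : cadlag (Mplus R) T, below q pil & F --> pil.
Proof.
have [pil [pD Hlim Heq]] := ultra_path.
have Hu g e : 0 < e -> F [set pi : cadlag (Mplus R) T | forall t, 0 <= t <= T ->
    `|mpair (pil t) (g : torus_test) - mpair (pi t) g| < e].
  by move=> e0; exact: ultra_uniform.
have Hx p (e : R) : 0 < e -> F [set pi : cadlag (Mplus R) T | forall t, 0 <= t <= T ->
    `|xc pil p t - xc pi p t| < e].
  exact: (Hu (trig_test p)).
exists pil; last exact: ultra_skorokhod.
split => // G GC.
have [C HC] := rate_bound_ex c.
set K : R := 8 / 3 * (q + 3 / 2 + 2 * (C * (expR 1 * T))).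
have HK pi n : below q pi -> fenergy pi n.+1 <= K.
  by move=> Hpi; exact: fenergy_bound gamma_measurable gamma01 HC Hpi.
have HKl n : fenergy pil n.+1 <= K.
  by apply: ultra_fenergy => // pi; exact: HK.
have [KJ KJ0 HJ] := J_D1_cont T0 c gamma GC.
apply/ler_addgt0Pr => eps eps0.
have D1' : 0 < 3 * (KJ * T + 1) by rewrite mulr_gt0// ltr_wpDl// mulr_ge0.
have D2 : 0 < 3 * (KJ + 1) by rewrite mulr_gt0// ltr_wpDl.
(* First e for the term without distance, then B for the L2 distance, then the
   number L of frequencies to compare, and last the precision eta. *)
pose e := eps / (3 * (KJ * T + 1)).
have e0 : 0 < e by rewrite divr_gt0.
pose B := eps * e / (3 * (KJ + 1)).
have B0 : 0 < B by rewrite divr_gt0// mulr_gt0.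
pose L := (Num.truncn (8 * `|K| / B)).+1.
have L0 : 0 < 4 * L%:R * T by rewrite !mulr_gt0.
pose eta := Num.min 1 (B / (4 * L%:R * T)).
have eta0 : 0 < eta by rewrite lt_min ltr01 divr_gt0.
have etaB : eta * (4 * L%:R * T) <= B.
  by rewrite -ler_pdivlMr// ge_min lexx orbT.
have KL : 8 * `|K| / B <= L%:R by apply: ltW; exact: truncnS_gt.
have : F [set pi : cadlag (Mplus R) T | forall p, p \in idx L -> forall t, 0 <= t <= T ->
    `|xc pil p t - xc pi p t| < eta].
  elim: (idx L) => [|p s IH]; first by apply: (@filterE _ F).
  apply: filterS (filterI (Hx p eta eta0) IH) => pi [h1 h2] p'.
  by rewrite inE => /orP[/eqP ->|/h2].
have TT : 0 <= T <= T by rewrite lexx T0'.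
have cG : continuous (G T) by have [[_ _ cG _] _ _ _ _] := GC; exact: cylinder_cont_space cG.
have m30 : 0 < eps / 3 by rewrite divr_gt0.
have FT : F [set pi : cadlag (Mplus R) T | `|mpair (pil T) (G T) - mpair (pi T) (G T)| <= eps / 3].
  by have /cvgrPdist_le /(_ _ m30) := Hlim T _ cG.
move=> /(filterI (filterI Fq FT)) /filter_ex[pi [[Hpi Hm] Hc]].
apply: (eps_split KJ0 e0 T0' (HJ pil pi e pD Hpi.1 e0) (Hpi.2 _ GC) Hm).
- by rewrite /e divfK// gt_eqF.
- rewrite -ler_pdivlMr// -/B.
  apply: (small_L2 (L := L) (K := K) (f := freq L) (eta := eta) (T' := T)) => //.
  + rewrite /freq ler_peMl ?ler0n//.
    by have := pi_ge2 R; rewrite mulr2n => h; lra.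
  + by rewrite (ltW eta0)/= ge_min lexx.
  + apply: L2dist_le => //.
    * exact: Hpi.1.
    * exact: ltW.
    * by move=> n; exact: HK.
    * by move=> p t pL tT; apply: ltW; apply: Hc => //; rewrite mem_idx.
- by apply: time_ge0 => t _; apply: tint_ge0 => u _; exact: sqr_ge0.
Qed.

End Ultra.

End Path_limit.

(** * Pairings determine the measure *)

Section Identification.
Context {R : realType}.
Local Notation dom := (@torus_dom R).
Local Notation bd := (@bdm _ (measurableTypeR R) R dom).
Implicit Types (m : @torus_measure R).

Let ray (x : R) : set R := `[x, +oo[%classic.

Let mray (x : R) : measurable (ray x : set (measurableTypeR R)).
Proof. exact: measurable_itv. Qed.

(** A continuous periodic function close to the indicator of [x, 1[ on the
    fundamental domain. The cut-off vanishes at 0, which is harmless because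
    only [x > 0] is used. *)
Let tent (x : R) (n : nat) (u : R) : R :=
  cutoff (n.+1%:R^-1) u * clamp 0 1 (n.+1%:R * (u - x) + 1).

Let tent_continuous x n : continuous (tent x n).
Proof.
apply: continuousM2; first exact: cutoff_continuous.
move=> u; apply: (@continuous_comp _ _ _ (fun u : R => n.+1%:R * (u - x) + 1)
  (clamp (0 : R) 1)); last exact: continuous_clamp.
apply: continuousD; last exact: cst_continuous.
apply: continuousM; first exact: cst_continuous.
by apply: continuousB; [exact: cvg_id|exact: cst_continuous].
Qed.

Let tent0 x n u : u <= 0 \/ 1 <= u -> tent x n u = 0.
Proof. by move=> H; rewrite /tent cutoff0 ?mul0r// invr_gt0. Qed.

Let tent_test x n : @torus_test R :=
  TorusTest (periodize_continuous (@tent_continuous x n) (@tent0 x n))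
    (@periodize_periodic R (tent x n)).

Let tent_cvg (x u : R) : 0 < x -> dom u ->
  tent x n u @[n --> \oo] --> (\1_(ray x) u : R).
Proof.
move=> x0 /domP/andP[u0 u1].
have large (y : R) : 0 < y -> \forall n \near \oo, 1 <= n.+1%:R * y.
  move=> y0; exists (Num.truncn y^-1) => // n /= hn.
  rewrite -ler_pdivrMr// mul1r (le_trans (ltW (truncnS_gt _)))//.
  by rewrite ler_nat ltnS.
apply: (@cvg_trans _ ((fun=> \1_(ray x) u : R) @ \oo)); last exact: cvg_cst.
apply: near_eq_cvg.
have [ux|xu] := ltP u x.
  have xu0 : 0 < x - u by rewrite subr_gt0.
  have := large _ xu0; apply: filterS => n H.
  have nin : ~ ray x u by rewrite /ray/= in_itv/= andbT leNgt ux.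
  rewrite indicE memNset//=.
  rewrite /tent /clamp max_l ?mulr0// ge_min; apply/orP; right.
  rewrite (_ : n.+1%:R * (u - x) = - (n.+1%:R * (x - u))); last by ring.
  by rewrite addrC subr_le0.
have u0' : 0 < u by exact: lt_le_trans xu.
have u1' : 0 < 1 - u by rewrite subr_gt0.
near=> n.
have h1 : 1 <= n.+1%:R * u by near: n; exact: large.
have h2 : 1 <= n.+1%:R * (1 - u) by near: n; exact: large.
have xin : ray x u by rewrite /ray/= in_itv/= andbT.
rewrite indicE mem_set//= /tent cutoff1 ?invr_gt0//.
- rewrite mul1r /clamp min_l ?max_r//.
  by rewrite lerDr mulr_ge0// subr_ge0.
- by rewrite -[leLHS]mul1r ler_pdivrMr// mulrC.
- rewrite lerBrDr -lerBrDl -[leLHS]mul1r ler_pdivrMr// mulrC.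
  exact: h2.
Unshelve. all: by end_near. Qed.

Let ray_mass m (x : R) : 0 < x ->
  mpair m (tent_test x n) @[n --> \oo] --> fine (m (ray x `&` dom)).
Proof.
move=> x0; rewrite -Rintegral_indic//; last exact: measurable_dom.
have b n : bd (tent x n) by apply: continuous_bd; exact: tent_continuous.
have := cvg_bint measurable_dom (tmass_fin m) (f_ := tent x)
  (f := \1_(ray x) : R -> R) (C := 1).
move=> H; apply: cvg_trans (H _ _ _).
- apply: near_eq_cvg; apply: filterE => n; apply: eq_Rintegral => u; rewrite inE => du.
  by rewrite /= periodize_dom.
- by move=> n; have [] := b n.
- move=> n u _; have /andP[? ?] := @cutoff01 R (n.+1%:R^-1) u.
  have /andP[? ?] := clamp_itv (n.+1%:R * (u - x) + 1) (@ler01 R).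
  by rewrite ger0_norm ?mulr_ge0// mulr_ile1.
- by move=> u du; exact: tent_cvg.
Qed.

Let mdom : measurable (dom : set (measurableTypeR R)).
Proof. exact: measurable_dom. Qed.

Let cst_periodic : periodic1 (fun _ : R => 1 : R). Proof. by []. Qed.
Let one_test : @torus_test R :=
  TorusTest (@cst_continuous R R (1 : R)) cst_periodic.

Let total_mass m : mpair m one_test = fine (m dom).
Proof. by rewrite /mpair /= Rintegral_cst// mul1r. Qed.

Let meas_fin m (A : set R) : measurable (A : set (measurableTypeR R)) -> m A \is a fin_num.
Proof.
move=> mA; rewrite ge0_fin_numE// (le_lt_trans (torus_measure_le1 m mA))//.
exact: ltry.
Qed.

(** Half-lines generate the Borel sets and are stable under intersection. The mass
    of one starting at [x] is a limit of pairings if [x > 0], and is the total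
    mass otherwise. *)
Lemma pairing_inj m m' : (forall g : torus_test, mpair m g = mpair m' g) ->
  forall A : set (measurableTypeR R), measurable A -> m A = m' A.
Proof.
move=> H A mA.
have Hray x : m (ray x) = m' (ray x).
  rewrite (torus_measure_dom m (mray x)) (torus_measure_dom m' (mray x)).
  have mI : measurable (ray x `&` dom : set (measurableTypeR R)) by exact: measurableI.
  rewrite -(fineK (meas_fin m mI)) -(fineK (meas_fin m' mI)); congr _%:E.
  have [x0|x0] := leP x 0.
    have -> : ray x `&` dom = dom.
      apply/setIidr => u /domP/andP[u0 _]; rewrite /ray/= in_itv/= andbT.
      exact: le_trans u0.
    by rewrite -!total_mass H.
  have h1 := @ray_mass m x x0; have h2 := @ray_mass m' x x0.
  rewrite (_ : (fun n => mpair m _) = fun n => mpair m' (tent_test x n)) in h1.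
    exact: (cvg_unique _ h1 h2).
  by apply/funext => n; exact: H.
refine (@measure_unique _ R (measurableTypeR R) (@RGenCInfty.G R)
  (fun n => ray (- n%:R)) _ _ _ _ m m' _ _ A mA).
- exact: RGenCInfty.measurableE.
- move=> _ _ [x ->] [y ->]; exists (Num.max x y).
  by apply/seteqP; split => u /=; rewrite !in_itv/= !andbT ge_max;
    [move=> [-> ->]|move=> /andP[]].
- by move=> n; exists (- n%:R).
- apply/seteqP; split => // u _; exists (Num.truncn `|u|).+1 => //=.
  rewrite /ray/= in_itv/= andbT lerNl (le_trans _ (ltW (truncnS_gt _)))//.
  by rewrite -normrN ler_norm.
- by move=> _ [x ->]; exact: Hray.
- by move=> n; rewrite (le_lt_trans (torus_measure_le1 m (mray _)))// ltry.
Qed.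

Lemma is_density_eq (m m' : Mplus R) : (forall g : torus_test, mpair m g = mpair m' g) ->
  is_density m = is_density m'.
Proof.
move=> H; apply/funext => r; apply/propext.
have E := pairing_inj H.
split=> -[mr r01 rE]; split=> // A mA; rewrite -rE//; [exact/esym/E|exact: E].
Qed.

End Identification.

(** * Lower semicontinuity and compactness *)

Section Conclusion.
Context {R : realType} (T : R).
Hypothesis T0 : 0 < T.
Context (M : nat) (c : {ffun 'I_(M.*2.+1) -> bool} -> R) (gamma : R -> R).
Hypothesis gamma_measurable : measurable_fun [set: R] gamma.
Hypothesis gamma01 : forall u, 0 <= gamma u <= 1.
Implicit Types (pi pil : cadlag (Mplus R) T).
Local Notation below := (below c gamma).
Local Notation rate := (@rate_function R M c T gamma).

Let T0' : 0 <= T. Proof. exact: ltW. Qed.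

Let zpsi (_ : bool * nat) (_ : R) : R := 0.

Let zeroP p t : 0 <= t <= T -> is_derive t (1 : R) (zpsi p) (zpsi p t).
Proof. by move=> _; exact: is_derive_cst. Qed.

Let czero p t : 0 <= t <= T -> {for t, continuous (zpsi p)}.
Proof. by move=> _; exact: cst_continuous. Qed.

Let zero_test : R -> R -> R := tsep [::] zpsi.

Let zeroE t u : zero_test t u = 0.
Proof. by rewrite /zero_test /tsep big_nil. Qed.

Let C12_zero : C12 T zero_test.
Proof. exact: (C12_tsep T0 [::] zeroP czero). Qed.

Let J_zero pi : D1 pi -> J_D1 c gamma zero_test pi = 0.
Proof.
move=> pD; rewrite (J_D1E T0 c gamma pD C12_zero).
have z0 (f : R -> R -> R) : (forall t u, 0 <= t <= T -> f t u = 0) ->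
    time_int T (fun t => tint (f t)) = 0.
  move=> H; rewrite (eq_time (g := fun=> 0)) ?(time_cst T0) ?mul0r// => t tT.
  by rewrite (eq_tint (g := fun=> 0)) ?tint_cst// => u _; exact: H.
have -> : mpair (pi T) (zero_test T) = 0.
  by rewrite /zero_test mpair_tsep big_nil.
have -> : fpair gamma (zero_test 0) = 0.
  rewrite /fpair -/(tint _) (eq_tint (g := fun=> 0)) ?tint_cst// => u _.
  by rewrite zeroE mulr0.
rewrite !z0; first by rewrite mulr0 addr0 !subr0.
- by move=> t u _; rewrite zeroE oppr0 expR0 subrr mulr0.
- by move=> t u _; rewrite zeroE expR0 subrr mulr0.
- by move=> t u _; rewrite dx_tsep big_nil expr0n mulr0.
- move=> t u tT; rewrite (dt_tsep T0 _ zeroP _ tT) dxx_tsep !big_nil.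
  by rewrite mulr0 addr0 mulr0.
Qed.

Lemma rate_ge0 pi : (0 <= rate pi)%E.
Proof.
rewrite /rate_function; case: asboolP => [[pD _]|_]; last exact: leey.
apply: ereal_sup_ubound; exists zero_test; first exact: C12_zero.
by rewrite /J asboolT// J_zero.
Qed.

Lemma rate_le_below q pi : (rate pi <= q%:E)%E <-> below q pi.
Proof.
split.
  rewrite /rate_function; case: asboolP => [[pD _] H|_]; last by rewrite leye_eq.
  split => // G GC; rewrite -lee_fin; apply: le_trans H.
  by apply: ereal_sup_ubound; exists G => //; rewrite /J asboolT.
move=> Hpi; have [pD Jq] := Hpi.
have [C HC] := rate_bound_ex c.
have HE : (energy pi < +oo)%E.
  apply: (@le_lt_trans _ _ (8 / 3 * (q + 3 / 2 + 2 * (C * (expR 1 * T))))%:E).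
    apply: (energy_le T0 pD) => N.
    exact: fenergy_bound gamma_measurable gamma01 HC Hpi.
  exact: ltry.
rewrite /rate_function asboolT//; apply: ge_ereal_sup => _ [G GC <-].
by rewrite /J asboolT// lee_fin; exact: Jq.
Qed.

Lemma rate_compact q : compact [set pi | (rate pi <= q%:E)%E].
Proof.
rewrite compact_ultra => F FU Fq.
have Fb : F [set pi | below q pi] by apply: filterS Fq => pi /rate_le_below.
have [pil Hpil Fpil] := ultra_limit T0 gamma_measurable gamma01 Fb.
by exists pil; split => //; apply/rate_le_below.
Qed.

(** The time changes allowed move the times by arbitrarily little, and the
    continuity in time of the second trajectory absorbs them. *)
Lemma indistinguishable_pairings pi pil (g : torus_test) :
  (forall e : R, 0 < e -> exists2 d, 0 < d & forall u v,
    `|u - v| < d -> `|mpair (pil u) g - mpair (pil v) g| <= e) ->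
  (forall A : set (cadlag (Mplus R) T * cadlag (Mplus R) T), entourage A ->
    A (pi, pil)) ->
  forall t, 0 <= t <= T -> mpair (pi t) g = mpair (pil t) g.
Proof.
move=> Hc HA t tT; apply/eqP; rewrite -subr_eq0 -normr_le0.
apply/ler_addgt0Pr => e e0; rewrite add0r.
have e20 : 0 < e / 2 by rewrite divr_gt0.
have [d d0 Hd] := Hc _ e20.
pose U := [set mm : Mplus R * Mplus R | `|mpair mm.1 g - mpair mm.2 g| < e / 2].
have entA : entourage (skorokhod_close (T := T) d U).
  by exists (d, U) => //; split => //=; exact: entourage_test.
have [l hl /(_ t)[|ld /= UU]] := HA _ entA; first by rewrite in_itv.
rewrite (_ : mpair (pi t) g - mpair (pil t) g = (mpair (pi t) g - mpair (pil (l t)) g)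
  + (mpair (pil (l t)) g - mpair (pil t) g)); last by ring.
rewrite (le_trans (ler_normD _ _))// [leRHS]splitr lerD//; first exact: ltW.
exact: Hd.
Qed.

Lemma below_eq q pi pil : below q pil ->
  (forall t (g : torus_test), 0 <= t <= T -> mpair (pi t) g = mpair (pil t) g) ->
  below q pi.
Proof.
move=> [pD Jq] H.
have dE t : 0 <= t <= T -> is_density (pi t) = is_density (pil t).
  by move=> tT; apply: is_density_eq => g; exact: H.
have pD' : D1 pi.
  move=> t; rewrite in_itv/= => tT; have [|r Hr] := pD t; first by rewrite in_itv.
  by exists r; rewrite dE.
have densE t : 0 <= t <= T -> dens (pi t) = dens (pil t).
  by move=> tT; rewrite /dens /density dE.
split => [//|G GC].
have <- : J_D1 c gamma G pil = J_D1 c gamma G pi; last exact: Jq.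
rewrite (J_D1E T0 c gamma pD' GC) (J_D1E T0 c gamma pD GC).
have [[pG dG cG cdx] _ _ _ _] := GC.
have TT : 0 <= T <= T by rewrite lexx T0'.
have cGT : continuous (G T) by exact: cylinder_cont_space cG.
have pGT : periodic1 (G T) by apply: pG; rewrite in_itv.
have E (f : (R -> R) -> R -> R -> R) : time_int T (fun t => tint (f (dens (pil t)) t)) =
    time_int T (fun t => tint (f (dens (pi t)) t)).
  by apply: eq_time => t tT; rewrite densE.
have <- : mpair (pi T) (G T) = mpair (pil T) (G T) := H T (TorusTest cGT pGT) TT.
rewrite (E (fun r t u => r u * (dt T G t u + 2^-1 * dxx G t u))).
rewrite (E (fun r t u => chi (r u) * dx G t u ^+ 2)).
rewrite (E (fun r t u => birth_rate c (r u) * (expR (G t u) - 1))).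
by rewrite (E (fun r t u => death_rate c (r u) * (expR (- G t u) - 1))).
Qed.

(** Were the trajectory adherent to a level set not containing it, the traces of
    its neighbourhoods on this compact set would have a cluster point there, which
    the uniformity could not separate from it. *)
Lemma rate_lsc : lower_semicontinuous rate.
Proof.
move=> pi a api; apply: contrapT => noV.
pose K := [set pi : cadlag (Mplus R) T | (rate pi <= a%:E)%E].
have meet V : nbhs pi V -> exists2 y, K y & V y.
  move=> nV; apply: contrapT => H; apply: noV; exists V; [exact: nV|move=> y Vy].
  by rewrite ltNge; apply/negP => yK; apply: H; exists y.
(* The traces on K of the neighbourhoods of the trajectory. *)
pose F := filter_from (nbhs pi) (fun V => K `&` V).
have FF : ProperFilter F.
  apply: filter_from_proper; last by move=> V /meet[y Ky Vy]; exists y.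
  apply: filter_from_filter; first by exists setT; exact: filterT.
  move=> V W nV nW; exists (V `&` W); first exact: filterI.
  by move=> y [Ky [Vy Wy]].
have FK : F K by exists setT; [exact: filterT|move=> y []].
have [pil [Kpil cl]] := rate_compact FF FK.
have Hpil : below a pil by apply/rate_le_below.
have indist (A : set (cadlag (Mplus R) T * cadlag (Mplus R) T)) : entourage A ->
    A (pi, pil).
  move=> entA; have entS := entourage_split_ent entA.
  have FV : F (K `&` xsection (split_ent A) pi).
    by exists (xsection (split_ent A) pi) => //; exact: nbhs_entourage.
  have nW : nbhs pil (xsection (split_ent A)^-1%relation pil).
    by apply: nbhs_entourage; exact: entourage_inv.
  have [y [[_ /xsectionP h1] /xsectionP h2]] := cl _ _ FV nW.
  exact: (entourage_split y).
have Hpi : below a pi.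
  apply: (below_eq Hpil) => t g tT; apply: indistinguishable_pairings tT => // e e0.
  have [d d0 Hd] := equicontinuous_test T0 c gamma a
    (@torus_fun_continuous _ g) (@torus_fun_periodic _ g) e0.
  by exists d => // u v; exact: Hd.
by move: api; rewrite ltNge; move/negP; apply; apply/rate_le_below.
Qed.

End Conclusion.

Theorem theorem4p7 (R : realType) (M : nat) (hM : (1 <= M)%N)
    (c : {ffun 'I_(M.*2.+1) -> bool} -> R) (c_gt0 : forall eta, 0 < c eta)
    (T : R) (T_gt0 : 0 < T)
    (gamma : R -> R) (gamma_periodic : periodic1 gamma)
    (gamma_measurable : measurable_fun [set: R] gamma)
    (gamma01 : forall u, 0 <= gamma u <= 1) :
  (forall pi : cadlag (Mplus R) T, (0 <= rate_function c gamma pi)%E) /\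
  lower_semicontinuous
    (fun pi : cadlag (Mplus R) T => rate_function c gamma pi) /\
  (forall q : R, 0 <= q ->
     compact [set pi : cadlag (Mplus R) T |
               (rate_function c gamma pi <= q%:E)%E]).
Proof.
split; first by move=> pi; exact: rate_ge0.
split; first exact: rate_lsc.
by move=> q _; exact: rate_compact.
Qed.
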